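(* Let $0<\beta<2$, $a=\frac2\beta-2$, and let $m\ge1$ be a fixed integer. For $b>-1$ let $\lambda$ denote the smallest eigenvalue of the $\beta$-Jacobi ensemble with parameters $a,b$ and size $m$. Then as $b\to\infty$ with $m$ (and $\beta$) fixed, the limiting distribution of the scaled smallest eigenvalue $\frac{\beta(b+m)}{2}\lambda$ is the distribution on $(0,\infty)$ with probability density $$f_m(y)=\frac{2}{\beta\pi}\,\Gamma\!\left(1+\tfrac\beta2\right)\sin\!\left(\tfrac\beta2\pi\right)\,m\,\Gamma\!\left(\tfrac{\beta(m-1)}{2}+1\right)\,y^{-\beta/2}\,e^{-my}\,U\!\left(\tfrac\beta2(m-1);-\tfrac\beta2;y\right),\qquad y>0.$$
   Context: $\beta$-Jacobi ensemble: for $\beta>0$, $a,b>-1$ and an integer $m\ge1$, the numbers $\lambda_1,\dots,\lambda_m\in[0,1]$ (the eigenvalues) form the $\beta$-Jacobi ensemble with parameters $a,b$ and size $m$ if their joint density on $[0,1]^m$ is proportional to $$\prod_{i=1}^m\lambda_i^{\frac{\beta}{2}(a+1)-1}(1-\lambda_i)^{\frac{\beta}{2}(b+1)-1}\prod_{i<j}|\lambda_i-\lambda_j|^{\beta};$$ the smallest eigenvalue is $\min_i\lambda_i$. ''Limiting distribution'' means the limit in the sense of convergence in distribution. $U(p;q;y)$ is the confluent hypergeometric function of the second kind (Tricomi's function), i.e. for non-integer $q$, $$U(p;q;y)=\frac{\pi}{\sin(\pi q)}\left[\frac{{}_1F_1(p;q;y)}{\Gamma(1+p-q)\Gamma(q)}-y^{1-q}\frac{{}_1F_1(1+p-q;2-q;y)}{\Gamma(p)\Gamma(2-q)}\right],$$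 with ${}_1F_1$ the classical one-variable function and $1/\Gamma$ read as $0$ at the poles of $\Gamma$. *)

(* Defs.v *)
From HB Require Import structures.
From mathcomp Require Import all_boot all_order all_algebra.
From mathcomp Require Import all_classical all_reals all_analysis.

Set Implicit Arguments.
Unset Strict Implicit.
Unset Printing Implicit Defensive.

Import Order.TTheory GRing.Theory Num.Theory.
Import numFieldNormedType.Exports.

Local Open Scope classical_set_scope.
Local Open Scope ring_scope.

Section special_functions.
Context {R : realType}.
Implicit Types x p q y : R.

Definition Gamma_integral x : R :=
  \int[lebesgue_measure]_(t in `]0, +oo[) (t `^ (x - 1) * expR (- t)).

(* The recurrence Gamma (x + 1) = x * Gamma x extends the Euler integral to
   x <= 0: shifting by truncn (- x) + 1 brings the argument into ]0, 1].
   At the poles x = 0, -1, -2, ... one factor x + k vanishes; as 0^-1 = 0, both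
   Gamma x and (Gamma x)^-1 are then 0. *)
Definition Gamma x : R :=
  if 0 < x then Gamma_integral x
  else let n := (Num.truncn (- x)).+1 in
       Gamma_integral (x + n%:R) / \prod_(k < n) (x + k%:R).

Definition rising p (k : nat) : R := \prod_(i < k) (p + i%:R).

Definition hyp1F1 p q y : R :=
  limn (series (fun k => rising p k / rising q k * y ^+ k / k`!%:R)).

(* Tricomi's confluent hypergeometric function of the second kind, for q not an
   integer and 0 < y. The reciprocals of Gamma 0, Gamma (-1), ... are 0 here. *)
Definition tricomiU p q y : R :=
  pi / sin (pi * q) *
    (hyp1F1 p q y / (Gamma (1 + p - q) * Gamma q)
     - y `^ (1 - q) * (hyp1F1 (1 + p - q) (2 - q) y
                       / (Gamma p * Gamma (2 - q)))).

End special_functions.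

Section sigma_finite_measure_of.
Context d (T : measurableType d) (R : realType).
Variables (m : {measure set T -> \bar R}) (sm : sigma_finite setT m).

Definition sigma_finite_measure_of of sigma_finite setT m :
  set T -> \bar R := m.

HB.instance Definition _ := Measure.copy (sigma_finite_measure_of sm) m.
HB.instance Definition _ :=
  Measure_isSigmaFinite.Build _ _ _ (sigma_finite_measure_of sm) sm.

End sigma_finite_measure_of.

Section lebesgue_measure_tuple.
Context {R : realType}.

Definition cons_pair n (xt : measurableTypeR R * n.-tuple (measurableTypeR R)) :
  n.+1.-tuple (measurableTypeR R) := [tuple of xt.1 :: xt.2].

Fixpoint lebesgue_tuple n : set (n.-tuple (measurableTypeR R)) -> \bar R :=
  match n with
  | 0 => dirac [tuple]
  | n'.+1 =>
      pushforward (lebesgue_measure \x @lebesgue_tuple n')%E (@cons_pair n')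
  end.

Lemma measurable_cons_pair n : measurable_fun setT (@cons_pair n).
Proof. exact: measurable_cons. Qed.

Let lebesgue_tupleP n :
  exists mu : {sigma_finite_measure set (n.-tuple (measurableTypeR R)) -> \bar R},
    mu = @lebesgue_tuple n :> (set _ -> \bar R).
Proof.
elim: n => [|n [mu muE]] /=.
  by exists (dirac [tuple] : {measure set _ -> \bar R}).
pose leb := @lebesgue_measure R.
pose nu : {measure set (measurableTypeR R * n.-tuple (measurableTypeR R))%type
                   -> \bar R} := (leb \x mu)%E.
pose pf := measure_function_pushforward__canonical__measure_function_Measure
  nu (@measurable_cons_pair n).
have sf : sigma_finite setT pf.
  have /sigma_finiteP[F [TF ndF Foo]] := sigma_finiteT leb.
  have /sigma_finiteP[G [TG ndG Goo]] := sigma_finiteT mu.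
  pose g (t : n.+1.-tuple (measurableTypeR R)) :=
    (thead t, [tuple of behead t] : n.-tuple (measurableTypeR R)).
  have mg : measurable_fun setT g.
    apply: measurable_fun_pair; last exact: measurable_behead.
    exact: measurable_tnth.
  have gK : cancel (@cons_pair n) g.
    move=> [x t]; rewrite /g /cons_pair theadE; congr pair.
    exact: val_inj.
  exists (fun i => g @^-1` (F i `*` G i)) => [|i].
    apply/esym; rewrite -subTset => t _.
    have [k _ Fk] : (\bigcup_k F k) (g t).1 by rewrite -TF.
    have [l _ Gl] : (\bigcup_l G l) (g t).2 by rewrite -TG.
    exists (maxn k l) => //; split.
      by move: Fk; exact/subsetPset/ndF/leq_maxl.
    by move: Gl; exact/subsetPset/ndG/leq_maxr.
  have [mF Fi] := Foo i; have [mG Gi] := Goo i; split.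
    by rewrite -[X in measurable X]setTI; apply: mg => //; exact: measurableX.
  rewrite /pf /= /pushforward -comp_preimage.
  rewrite (_ : g \o @cons_pair n = id) ?preimage_id; last by apply/funext => x; exact: gK.
  by rewrite product_measure1E// lte_mul_pinfty// ge0_fin_numE.
by exists (sigma_finite_measure_of sf); rewrite /sigma_finite_measure_of /= muE.
Qed.

Let lebesgue_tuple0 n : @lebesgue_tuple n set0 = 0%E.
Proof. by have [mu <-] := lebesgue_tupleP n; exact: measure0. Qed.

Let lebesgue_tuple_ge0 n A : (0 <= @lebesgue_tuple n A)%E.
Proof. by have [mu <-] := lebesgue_tupleP n; exact: measure_ge0. Qed.

Let lebesgue_tuple_sigma_additive n : semi_sigma_additive (@lebesgue_tuple n).
Proof.
by have [mu <-] := lebesgue_tupleP n; exact: measure_semi_sigma_additive.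
Qed.

HB.instance Definition _ n := isMeasure.Build _ _ _ (@lebesgue_tuple n)
  (@lebesgue_tuple0 n) (@lebesgue_tuple_ge0 n)
  (@lebesgue_tuple_sigma_additive n).

Let lebesgue_tuple_sigma_finite n : sigma_finite setT (@lebesgue_tuple n).
Proof. by have [mu <-] := lebesgue_tupleP n; exact: sigma_finiteT. Qed.

HB.instance Definition _ n := Measure_isSigmaFinite.Build _ _ _
  (@lebesgue_tuple n) (@lebesgue_tuple_sigma_finite n).

End lebesgue_measure_tuple.

Section probability.
Context {R : realType}.

Definition has_density d (T : measurableType d) (mu nu : set T -> \bar R)
    (D : set T) (f : T -> R) :=
  [/\ measurable D, measurable_fun D f, forall x, D x -> 0 <= f x &
      forall A, measurable A ->
        nu A = (\int[mu]_(x in A `&` D) (f x)%:E)%E].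

Definition cvg_in_distribution (I : Type) (F : set_system I)
    (d : I -> measure_display) (T : forall i, measurableType (d i))
    (P : forall i, probability (T i) R) (X : forall i, {RV (P i) >-> R})
    (nu : probability (measurableTypeR R) R) :=
  forall x : R, {for x, continuous (fun t : R => nu `]-oo, t]%classic)} ->
    cdf (X i) x @[i --> F] --> nu `]-oo, x]%classic.

End probability.
Arguments cvg_in_distribution {R I} F {d T} P X nu.

Section jacobi_ensemble.
Context {R : realType}.

Definition jacobi_weight (beta a b : R) m
    (t : m.-tuple (measurableTypeR R)) : R :=
  \prod_(i < m) (tnth t i `^ (beta / 2 * (a + 1) - 1)
                 * (1 - tnth t i) `^ (beta / 2 * (b + 1) - 1))
  * \prod_(i < m) \prod_(j < m | (i < j)%N) `|tnth t i - tnth t j| `^ beta.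

Definition is_jacobi_ensemble (beta a b : R) m d (T : measurableType d)
    (P : probability T R) (lam : 'I_m -> {RV P >-> R}) :=
  exists c : R, has_density (@lebesgue_tuple R m)
    (pushforward P (fun w => [tuple lam i w | i < m]))
    [set t | forall i, 0 <= tnth t i <= 1]
    (fun t => c * jacobi_weight beta a b t).

(* m_gt0 only supplies an initial value for the minimum. *)
Definition smallest_eigenvalue m (m_gt0 : (0 < m)%N) d (T : measurableType d)
    (P : probability T R) (lam : 'I_m -> {RV P >-> R}) : {RV P >-> R} :=
  \big[@measurable_realfun.min_mfun _ T R/lam (Ordinal m_gt0)]_(i < m) lam i.

Lemma smallest_eigenvalueE m (m_gt0 : (0 < m)%N) d (T : measurableType d)
    (P : probability T R) (lam : 'I_m -> {RV P >-> R}) w :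
  smallest_eigenvalue m_gt0 lam w
  = \big[Num.min/lam (Ordinal m_gt0) w]_(i < m) lam i w.
Proof. by rewrite /smallest_eigenvalue; elim/big_rec2: _ => //= i x y _ <-. Qed.

Definition smallest_limit_density (beta : R) (m : nat) (y : R) : R :=
  2 / (beta * pi) * Gamma (1 + beta / 2) * sin (beta / 2 * pi) * m%:R
  * Gamma (beta * (m%:R - 1) / 2 + 1) * y `^ (- (beta / 2))
  * expR (- (m%:R * y))
  * tricomiU (beta / 2 * (m%:R - 1)) (- (beta / 2)) y.

End jacobi_ensemble.
Arguments is_jacobi_ensemble {R} beta a b {m d T} P lam.

(* Main.v *)
Require Import Defs.
From HB Require Import structures.
From mathcomp Require Import all_boot all_order all_algebra.
From mathcomp Require Import all_classical all_reals all_analysis.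
From mathcomp Require Import measurable_realfun ring lra.

(** Write [s] for [beta / 2], [n] for the number of points and [k] for the scale
    [beta * (b + n) / 2].  For [a = 2 / beta - 2] the weight of the ensemble has
    exponent [- s] at [0] and [k - r] at [1], with [r = s * (n - 1) + 1], so that
    the rescaled points [t = k * lambda] have a density proportional to
    [\prod t_i `^ (- s) * (1 - t_i / k) `^ (k - r)] times the interaction
    [\prod `|t_i - t_j| `^ (2 * s)].  As [k] grows, [(1 - t / k) `^ (k - r)] tends
    to [expR (- t)], and dominated convergence ([cvg_jacobi_tail]) shows that the
    probability that every rescaled point exceeds [x] tends to [J x / J 0], where
    [J x] is the integral of the Laguerre weight
    [\prod t_i `^ (- s) * expR (- t_i)] times the interaction over the points
    with all coordinates above [x].  Translating by [x] turns [J x] into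
    [expR (- (n * x)) * H x], where [H y] is the integral over the orthant of the
    weight with [y + t_i] in place of [t_i] in the first factor
    ([laguerre_tailE]).

    The function [H] solves Kummer's equation [y H'' + (s - y) H' = n s H]
    ([kummer_laguerre_integral]).  To see it, integrate over the orthant the
    divergence of the vector field whose [j]-th component is [t_j / (y + t_j)]
    times the weight: it vanishes on the boundary and at infinity.  In the
    divergence the singular terms [1 / (t_i - t_j)] of the interaction occur in
    antisymmetric pairs and combine into products
    [1 / ((y + t_i) * (y + t_j))]; the exponent [- s] is the one for which
    these complete the square that appears in [H''].  To keep every term
    integrable, [(t_i - t_j) ^+ 2] is first replaced by
    [(t_i - t_j) ^+ 2 + e], and [e] tends to [0] in the integrated identity.

    Since [0 < s < 1], the solutions of Kummer's equation are spanned by the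
    series [M = 1F1 (n s; s; y)] and [N = y `^ (1 - s) * 1F1 (1 + n s - s; 2 - s; y)]
    ([kummer_solution_basis]).  The coefficient of [M] in [H] is the value [H 0],
    because [N] vanishes at [0].  The coefficient of [N] is forced by
    boundedness: [M] and [N] grow exponentially, [H] is at most [H 0], and only
    one ratio of coefficients lets the growth cancel ([bounded_connection]).
    That ratio is the one in Tricomi's function.  Finally the density is minus the
    derivative of [expR (- (n * y)) * H y / H 0], and two contiguous relations
    between hypergeometric series rewrite it as the stated multiple of
    [tricomiU] ([is_derive_limit_tail]). *)


Set Implicit Arguments.
Unset Strict Implicit.
Unset Printing Implicit Defensive.

Import Order.TTheory GRing.Theory Num.Theory.
Import numFieldNormedType.Exports.

Local Open Scope classical_set_scope.
Local Open Scope ring_scope.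

(** * The fundamental theorem of calculus on an open ray *)

Section ftc_ray.
Context {R : realType}.
Local Notation leb := (@lebesgue_measure R).
Variables (f F : R -> R) (a l0 l1 : R).
Hypothesis dF : forall x, a < x -> is_derive x 1 F (f x).
Hypothesis cf : forall x, a < x -> {for x, continuous f}.
Hypothesis F0 : F x @[x --> a^'+] --> l0.
Hypothesis F1 : F x @[x --> +oo] --> l1.

Let lo (n : nat) : R := a + n.+1%:R^-1.
Let hi (n : nat) : R := a + n.+2%:R.
Let K (n : nat) : set R := `[lo n, hi n].

Let lohi n : lo n < hi n.
Proof.
rewrite ltrD2l (@le_lt_trans _ _ 1)//; last by rewrite ltr1n.
by rewrite invf_le1// ler1n.
Qed.

Let a_lo n : a < lo n.
Proof. by rewrite ltrDl. Qed.

Let K_bigcup : \bigcup_n K n = `]a, +oo[%classic.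
Proof.
apply/seteqP; split=> x /=.
  by move=> [n _]; rewrite /K /= !in_itv/= andbT => /andP[+ _]; exact: lt_le_trans.
rewrite in_itv/= andbT => ax.
have xa : 0 < x - a by rewrite subr_gt0.
pose n := Num.truncn (Num.max (x - a) (x - a)^-1).
exists n => //; rewrite /K /= in_itv/=.
have := truncnS_gt (Num.max (x - a) (x - a)^-1); rewrite gt_max -/n => /andP[h1 h2].
apply/andP; split.
  by rewrite /lo -lerBrDl invf_ple ?posrE//; exact: ltW.
by rewrite /hi -lerBlDl (le_trans (ltW h1))// ler_nat.
Qed.

Let K_nd : nondecreasing_seq K.
Proof.
move=> n p np; apply/subsetPset => x; rewrite /K /= !in_itv/= => /andP[h1 h2].
apply/andP; split.
  by rewrite (le_trans _ h1)// lerD2l lef_pV2// ?posrE// ler_nat.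
by rewrite (le_trans h2)// lerD2l ler_nat.
Qed.

Let intK n : (\int[leb]_(x in K n) (f x)%:E = (F (hi n))%:E - (F (lo n))%:E)%E.
Proof.
have cF x : a < x -> {for x, continuous F}.
  by move=> /dF [/derivable1_diffP/differentiable_continuous].
apply: continuous_FTC2 => //.
- apply: continuous_in_subspaceT => x; rewrite inE/= in_itv/= => /andP[h _].
  by apply: cf; exact: lt_le_trans h.
- split.
  + move=> x; rewrite in_itv/= => /andP[h _].
    by have [] := dF (lt_trans (a_lo n) h).
  + by apply: cvg_at_right_filter; apply: cF; exact: a_lo.
  + by apply: cvg_at_left_filter; apply: cF; exact: lt_trans (lohi n).
- move=> x; rewrite in_itv/= => /andP[h _].
  by rewrite derive1E; have [_ ->] := dF (lt_trans (a_lo n) h).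
Qed.

Let cvgK : (\int[leb]_(x in K n) (f x)%:E @[n --> \oo] --> (l1 - l0)%:E)%E.
Proof.
under eq_fun do rewrite intK -EFinB.
apply: cvg_EFin; first exact: nearW.
apply: cvgB.
  apply: (cvg_comp _ _ _ F1).
  apply/cvgryPge => A; near=> n.
  rewrite -lerBlDl; apply: (le_trans (ltW (truncnS_gt _))).
  rewrite ler_nat ltnS; apply: ltnW; rewrite ltnS.
  by near: n; exact: nbhs_infty_ge.
have := (cvg_at_rightP F a l0).1 F0 lo; apply; split=> //.
rewrite -[X in _ --> X]addr0; apply: cvgD; first exact: cvg_cst.
exact: (cvg_harmonic).
Unshelve. all: by end_near. Qed.

Let mf : measurable_fun (`]a, +oo[%classic : set R) f.
Proof.
apply: open_continuous_measurable_fun; first exact: interval_open.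
by move=> x; rewrite inE/= in_itv/= andbT => /cf.
Qed.

(** The antiderivative is only required to have limits at the two ends, so that
    this covers integrands that are singular at the left end. *)
Lemma ge0_FTC_ray : (forall x, a < x -> 0 <= f x) ->
  (\int[leb]_(x in `]a, +oo[) (f x)%:E = (l1 - l0)%:E)%E.
Proof.
move=> f0; rewrite -K_bigcup.
apply: (cvg_unique _ _ cvgK) => //.
apply: ge0_nondecreasing_set_cvg_integral => //.
- by move=> n; exact: measurable_itv.
- move=> n; apply/measurable_EFinP; apply: measurable_funS mf => //.
  by rewrite -K_bigcup; exact: bigcup_sup.
- move=> n x; rewrite /K /= in_itv/= => /andP[h _].
  by rewrite lee_fin f0// (lt_le_trans (a_lo n)).
Qed.

Lemma ge0_integrable_ray : (forall x, a < x -> 0 <= f x) ->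
  leb.-integrable `]a, +oo[ (fun x => (f x)%:E).
Proof.
move=> f0; apply/integrableP; split; first exact/measurable_EFinP.
rewrite (_ : (\int[_]_(x in _) _)%E = (\int[leb]_(x in `]a, +oo[) (f x)%:E)%E).
  by rewrite ge0_FTC_ray// ltry.
by apply: eq_integral => x; rewrite inE/= in_itv/= andbT => /f0 fx0; rewrite ger0_norm.
Qed.

Lemma FTC_ray : leb.-integrable `]a, +oo[ (fun x => (f x)%:E) ->
  (\int[leb]_(x in `]a, +oo[) (f x)%:E = (l1 - l0)%:E)%E.
Proof.
move=> fi.
pose g n := (fun x => (f x)%:E) \_ (K n).
have mray : measurable (`]a, +oo[%classic : set R) by exact: measurable_itv.
have mK n : measurable (K n) by exact: measurable_itv.
have subK n : K n `<=` `]a, +oo[ by rewrite -K_bigcup; exact: bigcup_sup.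
have mg n : measurable_fun `]a, +oo[ (g n).
  apply/(measurable_restrict _ (mK n) mray); apply: measurable_funS (measurable_int _ fi) => //.
have [|||] := @dominated_convergence _ _ _ leb _ mray g (fun x => (f x)%:E)
  (fun x => `|(f x)%:E|)%E mg (measurable_int _ fi).
- apply: aeW => x; rewrite -K_bigcup => -[k _ Kx].
  apply: (cvg_near_cst).
  near=> n; rewrite /g patchE ifT// inE.
  have kn : (k <= n)%N by near: n; exact: nbhs_infty_ge.
  by have /subsetPset := K_nd kn; exact.
- exact: integrable_abse.
- apply: aeW => x n _; rewrite /g patchE; case: ifPn => //.
  by rewrite abse0.
move=> _ _ /= h; apply: (cvg_unique _ h) => //.
apply: cvg_trans cvgK.
apply: near_eq_cvg; apply: nearW => n /=.
by rewrite /g -integral_mkcondl setIidl.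
Unshelve. all: by end_near. Qed.

End ftc_ray.

(** * Auxiliary facts of real analysis, and the Gamma function *)

Section real_auxiliary.
Context {R : realType}.
Local Notation leb := (@lebesgue_measure R).

Lemma is_derive_continuous (f : R -> R) (x l : R) :
  is_derive x 1 f l -> {for x, continuous f}.
Proof. by move=> [/derivable1_diffP/differentiable_continuous]. Qed.

Lemma is_derive_powR_comp (f : R -> R) (p x l : R) : 0 < f x ->
  is_derive x 1 f l ->
  is_derive x 1 (fun y => f y `^ p) (p * f x `^ (p - 1) * l).
Proof.
move=> f0 df.
exact: (@is_derive1_comp _ (@powR R ^~ p) f x _ _ (is_derive1_powR p f0) df).
Qed.

Lemma cvgr_sum (I J : Type) (F : set_system I) {FF : Filter F} (r : seq J)
    (P : pred J) (f : J -> I -> R) (l : J -> R) :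
  (forall j, P j -> f j i @[i --> F] --> l j) ->
  \sum_(j <- r | P j) f j i @[i --> F] --> \sum_(j <- r | P j) l j.
Proof.
move=> fl; elim: r => [|j r ih].
  by rewrite big_nil; under eq_fun do rewrite big_nil; exact: cvg_cst.
rewrite big_cons; under eq_fun do rewrite big_cons.
by case: ifPn => // Pj; apply: cvgD => //; exact: fl.
Qed.

Lemma cvgr_prod (I J : Type) (F : set_system I) {FF : Filter F} (r : seq J)
    (P : pred J) (f : J -> I -> R) (l : J -> R) :
  (forall j, P j -> f j i @[i --> F] --> l j) ->
  \prod_(j <- r | P j) f j i @[i --> F] --> \prod_(j <- r | P j) l j.
Proof.
move=> fl; elim: r => [|j r ih].
  by rewrite big_nil; under eq_fun do rewrite big_nil; exact: cvg_cst.
rewrite big_cons; under eq_fun do rewrite big_cons.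
by case: ifPn => // Pj; apply: cvgM => //; exact: fl.
Qed.

Lemma gt0_powRD (x p q : R) : 0 < x -> x `^ (p + q) = x `^ p * x `^ q.
Proof. by move=> x0; rewrite powRD// (gt_eqF x0) implybT. Qed.

Lemma lebesgue_affine (a c : R) : 0 < a -> forall A : set R, measurable A ->
  leb A = (a%:E * leb ((fun x => (a * x + c)%R) @^-1` A))%E.
Proof.
move=> a0 A mA.
have maff : measurable_fun setT (fun x : measurableTypeR R => (a * x + c)%R : measurableTypeR R).
  by apply: measurable_funD => //; exact: mulrl_measurable.
pose pf := measure_function_pushforward__canonical__measure_function_Measure leb maff.
pose a' : {nonneg R} := NngNum (ltW a0).
have := @lebesgue_measure_unique R (mscale a' pf); apply=> //.
move=> _ [[u v]] _ <-.
rewrite [RHS](_ : _ =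
  (a%:E * leb ((fun x => (a * x + c)%R) @^-1` `]u, v]%classic))%E)//.
rewrite [X in (_ * leb X)%E](_ : _ = `](u - c) / a, (v - c) / a]%classic); last first.
  apply/seteqP; split=> x /=; rewrite !in_itv/= ltr_pdivrMr// ler_pdivlMr// (mulrC x).
    by rewrite ltrBlDr lerBrDr.
  by rewrite ltrBlDr lerBrDr.
rewrite !lebesgue_measure_itv/= !lte_fin ltr_pM2r ?invr_gt0// ltrD2r.
case: ifP => _; last by rewrite mule0.
by rewrite -!EFinB -EFinM; congr EFin; field; rewrite gt_eqF.
Qed.

Lemma ge0_integral_affine (a c : R) (f : R -> \bar R) : 0 < a ->
  measurable_fun setT f -> (forall x, 0 <= f x)%E ->
  (\int[leb]_x f x = a%:E * \int[leb]_x f (a * x + c)%R)%E.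
Proof.
move=> a0 mf f0.
have maff : measurable_fun setT (fun x : measurableTypeR R => (a * x + c)%R : measurableTypeR R).
  by apply: measurable_funD => //; exact: mulrl_measurable.
pose pf := measure_function_pushforward__canonical__measure_function_Measure leb maff.
pose a' : {nonneg R} := NngNum (ltW a0).
rewrite (@eq_measure_integral _ _ _ setT (mscale a' pf)); last first.
  by move=> A mA _; exact: lebesgue_affine.
rewrite ge0_integral_mscale//=; congr (_ * _)%E.
by rewrite ge0_integral_pushforward//= preimage_setT.
Qed.

Lemma addr1_le_expR (c t : R) : 1 <= c -> 1 + t <= c * expR (t / c).
Proof.
move=> c1; have c0 : 0 < c by exact: lt_le_trans c1.
rewrite (le_trans _ (ler_wpM2l (ltW c0) (expR_ge1Dx _)))//.
by rewrite mulrDr mulr1 mulrCA divff ?gt_eqF// mulr1 lerD2r.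
Qed.

(** An explicit comparison between a power and the exponential: put [t / p] in
    [1 + t <= p * expR (t / p)] and raise to the power [p]. *)
Lemma powR_addr1_le_expR (p t : R) : 1 <= p -> 0 <= t ->
  (1 + t) `^ p <= p `^ p * expR t.
Proof.
move=> p1 t0; have p0 : 0 < p by exact: lt_le_trans p1.
have := addr1_le_expR t p1 => /(@ge0_ler_powR _ p (ltW p0)).
rewrite !nnegrE addr_ge0// mulr_ge0 ?(ltW p0) ?expR_ge0// => /(_ isT isT) /le_trans; apply.
by rewrite powRM ?(ltW p0) ?expR_ge0// -expRM divfK ?gt_eqF.
Qed.

End real_auxiliary.

Section gamma.
Context {R : realType}.
Local Notation leb := (@lebesgue_measure R).
Local Notation ray := (`]0%R, +oo[%classic : set (measurableTypeR R)).

Let mray : measurable ray.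
Proof. by []. Qed.

Lemma measurable_gamma_integrand (x c : R) (D : set R) :
  measurable_fun D (fun t : R => t `^ (x - 1) * expR (- (c * t))).
Proof.
apply: (measurable_funS (E := setT)) => //.
apply: measurable_funM => //.
by do 2 apply: measurableT_comp => //.
Qed.

(** [(t / (1 + t)) `^ x] is an antiderivative of [x] times a function which
    dominates the Gamma integrand up to a constant. *)
Lemma gamma_integrable (x : R) : 0 < x ->
  leb.-integrable ray (fun t => (t `^ (x - 1) * expR (- t))%:E).
Proof.
move=> x0.
pose u (t : R) := 1 - (1 + t)^-1.
pose g (t : R) := x * u t `^ (x - 1) * (1 + t) ^- 2.
have u1 t : 0 < t -> u t = t / (1 + t).
  by move=> t0; rewrite /u; field; rewrite gt_eqF// addr_gt0.
have u0 t : 0 < t -> 0 < u t.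
  by move=> t0; rewrite u1// divr_gt0// addr_gt0.
have du (t : R) : 0 < t -> is_derive t 1 u ((1 + t) ^- 2).
  move=> t0; have t1 : 1 + t != 0 by rewrite gt_eqF// addr_gt0.
  rewrite /u; apply: is_derive_eq.
  by rewrite !add0r mul1r scaleNr opprK /GRing.scale/= mulr1.
have dG (t : R) : 0 < t -> is_derive t 1 (fun t => u t `^ x) (g t).
  by move=> t0; apply: is_derive_powR_comp; [exact: u0|exact: du].
have gi : leb.-integrable ray (fun t => (g t)%:E).
  apply: (@ge0_integrable_ray R g (fun t => u t `^ x) 0 0 1) => //.
  - move=> t t0; apply: continuousM.
      apply: continuousM; first exact: cst_continuous.
      apply: (@is_derive_continuous _ _ _ ((x - 1) * u t `^ (x - 1 - 1) * (1 + t) ^- 2)).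
      by apply: is_derive_powR_comp; [exact: u0|exact: du].
    apply: cvgV; first by rewrite expf_neq0// gt_eqF// addr_gt0.
    by apply: cvgM; (apply: cvgD; [exact: cvg_cst|exact: cvg_id]).
  - apply: (@squeeze_cvgr _ _ _ _ (fun=> 0) (@powR R ^~ x)).
    + near=> t; rewrite powR_ge0/=.
      have t0 : 0 < t by near: t; exact: nbhs_right_gt.
      apply: ge0_ler_powR; rewrite ?nnegrE ?(ltW x0) ?(ltW t0) ?(ltW (u0 _ t0))//.
      by rewrite u1// ler_piMr ?(ltW t0)// invf_le1 ?addr_gt0// lerDl ltW.
    + exact: cvg_cst.
    + exact: powR_cvg0.
  - have : {for 1, continuous (@powR R ^~ x)}.
      exact/is_derive_continuous/is_derive1_powR.
    rewrite /prop_for /continuous_at powR1; apply: cvg_comp.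
    suff : u t @[t --> +oo] --> (1 - 0 : R) by rewrite subr0.
    apply: cvgB; first exact: cvg_cst.
    apply/(gtr0_cvgV0 (f := fun t => 1 + t)); first by near=> t; rewrite addr_gt0//; near: t; exact: nbhs_pinfty_gt.
    by apply/cvgryPge => A; near=> t; rewrite -lerBlDl; near: t; exact: nbhs_pinfty_ge.
  - by move=> t t0; rewrite /g !mulr_ge0 ?powR_ge0 ?(ltW x0)// invr_ge0 exprn_ge0// addr_ge0// ltW.
have gZ := integrableZl mray ((x + 1) `^ (x + 1) / x) gi.
apply: le_integrable gZ => //.
  apply/measurable_EFinP; apply: measurable_funM.
    exact: (measurable_funS (E := setT)).
  by do 2 apply: measurableT_comp => //.
move=> t; rewrite /= in_itv/= andbT => t0.
have t1 : 0 < 1 + t by rewrite addr_gt0.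
rewrite lee_fin !ger0_norm; last 2 first.
- by rewrite !mulr_ge0 ?powR_ge0 ?invr_ge0 ?exprn_ge0 ?(ltW x0) ?(ltW t1).
- by rewrite mulr_ge0 ?powR_ge0 ?expR_ge0.
have -> : (x + 1) `^ (x + 1) / x * g t =
    t `^ (x - 1) * ((x + 1) `^ (x + 1) * (1 + t) `^ (- (x + 1))).
  rewrite /g u1// powRM ?invr_ge0 ?(ltW t0) ?(ltW t1)//.
  rewrite -(powR_inv1 (ltW t1)) -powRrM -(powR_invn 2 (ltW t1)).
  rewrite (_ : - (x + 1) = -1 * (x - 1) - 2%:R); last by ring.
  rewrite (gt0_powRD _ _ t1).
  by field; rewrite gt_eqF.
rewrite ler_wpM2l ?powR_ge0// expRN powRN -ler_pdivrMl ?powR_gt0 ?addr_gt0//.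
rewrite -invfM lef_pV2 ?posrE ?mulr_gt0 ?powR_gt0 ?expR_gt0 ?addr_gt0//.
by rewrite powR_addr1_le_expR ?(ltW t0)// lerDr ltW.
Unshelve. all: by end_near. Qed.

Lemma EFin_Gamma (x : R) : 0 < x ->
  ((Gamma_integral x)%:E = \int[leb]_(t in ray) (t `^ (x - 1) * expR (- t))%:E)%E.
Proof.
move=> x0; rewrite /Gamma_integral /Rintegral fineK//.
exact: integrable_fin_num (gamma_integrable x0).
Qed.

Lemma GammaE (x : R) : 0 < x -> Gamma x = Gamma_integral x.
Proof. by rewrite /Gamma => ->. Qed.

Lemma Gamma_gt0 (x : R) : 0 < x -> 0 < Gamma x.
Proof.
move=> x0; rewrite GammaE// -lte_fin EFin_Gamma//.
pose k := 2 `^ (- `|x - 1|) * expR (- 2) : R.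
have k0 : 0 < k by rewrite mulr_gt0 ?powR_gt0 ?expR_gt0.
have sub : `[1, 2] `<=` ray by move=> t /=; rewrite !in_itv/= andbT => /andP[+ _]; exact: lt_le_trans.
apply: (@lt_le_trans _ _ (\int[leb]_(t in `[1%R, 2%R]) k%:E)%E).
  rewrite integral_cst//= lebesgue_measure_itv/= lte_fin ltr1n -EFinB -EFinM lte_fin.
  by rewrite mulr_gt0// subr_gt0 ltr1n.
apply: (@le_trans _ _ (\int[leb]_(t in `[1%R, 2%R]) (t `^ (x - 1) * expR (- t))%:E)%E); last first.
  apply: ge0_subset_integral => //.
  - exact: measurable_int (gamma_integrable x0).
  - by move=> t _; rewrite lee_fin mulr_ge0 ?powR_ge0 ?expR_ge0.
apply: ge0_le_integral => //.
- by move=> t _; rewrite lee_fin ltW.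
- exact: measurable_funS (measurable_int _ (gamma_integrable x0)).
- move=> t /=; rewrite in_itv/= => /andP[t1 t2]; have t0 : 0 < t by exact: lt_le_trans t1.
  rewrite lee_fin ler_pM ?powR_ge0 ?expR_ge0 ?ler_expR ?lerN2//.
  rewrite (@le_trans _ _ (t `^ (- `|x - 1|)))//; last first.
    by rewrite ler_powR// lerNl -normrN ler_norm.
  rewrite !powRN lef_pV2 ?posrE ?powR_gt0//.
  by apply: ge0_ler_powR; rewrite ?nnegrE ?normr_ge0 ?(ltW t0)//.
Qed.

Let cvg_gamma_primitive0 (x : R) : 0 < x -> t `^ x * expR (- t) @[t --> 0^'+] --> 0.
Proof.
move=> x0; apply: (@squeeze_cvgr _ _ _ _ (fun=> 0) (@powR R ^~ x)).
- near=> t; rewrite mulr_ge0 ?powR_ge0 ?expR_ge0//= ler_piMr ?powR_ge0//.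
  by rewrite -expR0 ler_expR oppr_le0.
- exact: cvg_cst.
- exact: powR_cvg0.
Unshelve. all: by end_near. Qed.

Let cvg_gamma_primitivey (x : R) : 0 < x -> t `^ x * expR (- t) @[t --> +oo] --> 0.
Proof.
move=> x0; pose C := (x + 1) `^ (x + 1).
apply: (@squeeze_cvgr _ _ _ _ (fun=> 0) (fun t => C * (1 + t)^-1)).
- near=> t; have t0 : 0 < t by near: t; exact: nbhs_pinfty_gt.
  have t1 : 0 < 1 + t by rewrite addr_gt0.
  rewrite mulr_ge0 ?powR_ge0 ?expR_ge0//= expRN ler_pdivrMr ?expR_gt0//.
  rewrite mulrAC ler_pdivlMr//.
  rewrite (@le_trans _ _ ((1 + t) `^ (x + 1)))//; last first.
    by apply: powR_addr1_le_expR; [rewrite lerDr ltW|exact: ltW].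
  rewrite (gt0_powRD _ _ t1) powRr1 ?(ltW t1)//.
  rewrite ler_wpM2r ?(ltW t1)//.
  by apply: ge0_ler_powR; rewrite ?nnegrE ?(ltW x0) ?(ltW t0) ?(ltW t1)// lerDr.
- exact: cvg_cst.
- rewrite -(mulr0 C); apply: cvgM; first exact: cvg_cst.
  apply/(gtr0_cvgV0 (f := fun t => 1 + t)); first by near=> t; rewrite addr_gt0//; near: t; exact: nbhs_pinfty_gt.
  by apply/cvgryPge => A; near=> t; rewrite -lerBlDl; near: t; exact: nbhs_pinfty_ge.
Unshelve. all: by end_near. Qed.

(** Integration by parts: [t `^ x * expR (- t)] vanishes at both ends of the ray. *)
Lemma GammaS (x : R) : 0 < x -> Gamma (x + 1) = x * Gamma x.
Proof.
move=> x0; have x1 : 0 < x + 1 by rewrite addr_gt0.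
rewrite !GammaE//.
have i1 := gamma_integrable x0.
have i2 := gamma_integrable x1.
have i1x := integrableZl mray x i1.
have : (\int[leb]_(t in ray) (x * (t `^ (x - 1) * expR (- t)) -
     t `^ (x + 1 - 1) * expR (- t))%:E = (0 - 0)%:E)%E.
  have dpow (p t : R) : 0 < t -> {for t, continuous (@powR R ^~ p)}.
    by move=> t0; exact/is_derive_continuous/is_derive1_powR.
  have cexp (t : R) : {for t, continuous (fun t => expR (- t))}.
    apply: continuous_comp; first exact: oppr_continuous.
    exact: continuous_expR.
  apply: (@FTC_ray _ _ (fun t => t `^ x * expR (- t))).
  - move=> t t0; have dp := is_derive1_powR x t0.
    apply: is_derive_eq.
    by rewrite /GRing.scale/= addrK; ring.
  - move=> t t0; apply: continuousB.
      by apply: continuousM; [exact: cst_continuous|apply: continuousM => //; exact: dpow].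
    by apply: continuousM => //; exact: dpow.
  - exact: cvg_gamma_primitive0.
  - exact: cvg_gamma_primitivey.
  - exact: (integrableB mray i1x i2).
under eq_integral do rewrite EFinB EFinM.
rewrite integralB//=.
rewrite integralZl// -!EFin_Gamma// subrr => /eqP.
by rewrite -EFinM -EFinB eqe subr_eq0 => /eqP.
Qed.

(** Weighted AM-GM, that is, Young's inequality. *)
Lemma powR_le_affine (c t h : R) : 0 < c -> 0 <= t -> 0 <= h <= 1 ->
  t `^ h <= c `^ h * (h * (t / c) + (1 - h)).
Proof.
move=> c0 t0 /andP[h0 h1].
have u0 : 0 <= t / c by rewrite divr_ge0// ltW.
have -> : t `^ h = c `^ h * (t / c) `^ h.
  by rewrite -powRM ?(ltW c0)// mulrCA divff ?gt_eqF// mulr1.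
rewrite ler_wpM2l ?powR_ge0//; move: (t / c) u0 => u u0.
move: h0; rewrite le_eqVlt => /predU1P[<-|h0].
  by rewrite powRr0 mul0r add0r subr0.
move: h1; rewrite le_eqVlt => /predU1P[->|h1].
  by rewrite powRr1// mul1r subrr addr0.
have := @conjugate_powR _ (u `^ h) 1 h^-1 (1 - h)^-1.
rewrite powR_ge0 ler01 !invr_gt0 h0 subr_gt0 h1 !invrK subrKC.
rewrite -powRrM divff ?gt_eqF// powRr1// powR1 mulr1 mul1r (mulrC u).
exact.
Qed.

(** Weighted AM-GM under the integral sign: [t `^ h <= x `^ h * (h * (t / x) + 1 - h)],
    and the right-hand side integrates to [x `^ h * Gamma x]. *)
Lemma GammaD_le (x h : R) : 0 < x -> 0 <= h <= 1 ->
  Gamma (x + h) <= x `^ h * Gamma x.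
Proof.
move=> x0 /andP[h0 h1].
have xh0 : 0 < x + h by rewrite ltr_wpDr.
have x1 : 0 < x + 1 by rewrite addr_gt0.
have i1 := gamma_integrable x0.
have i2 := gamma_integrable x1.
have i1x := integrableZl mray (x `^ h * (1 - h)) i1.
have i2x := integrableZl mray (x `^ h * (h / x)) i2.
rewrite (_ : x `^ h * Gamma x = x `^ h * (h / x) * Gamma (x + 1) + x `^ h * (1 - h) * Gamma x); last first.
  by rewrite GammaS//; field; rewrite gt_eqF.
rewrite (GammaE x0) (GammaE xh0) (GammaE x1) -lee_fin (EFin_Gamma xh0) EFinD.
have E1 := integralZl mray i1 (x `^ h * (1 - h)).
have E2 := integralZl mray i2 (x `^ h * (h / x)).
rewrite -(EFin_Gamma x0) -EFinM in E1; rewrite -(EFin_Gamma x1) -EFinM in E2.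
have E3 := integralD mray i2x i1x.
rewrite -E1 -E2 -E3.
apply: ge0_le_integral => //.
- by move=> t _; rewrite lee_fin mulr_ge0 ?powR_ge0 ?expR_ge0.
- exact: measurable_int (gamma_integrable xh0).
- exact: emeasurable_funD (measurable_int _ i2x) (measurable_int _ i1x).
- move=> t /=; rewrite in_itv/= andbT => t0; rewrite -!EFinM -EFinD lee_fin.
  rewrite [leRHS](_ : _ = t `^ (x - 1) * expR (- t) *
       (x `^ h * (h * (t / x) + (1 - h)))); last first.
    rewrite addrK -(@mulr_powRB1 _ t x) ?(ltW t0)//.
    by field; rewrite gt_eqF.
  have -> : t `^ (x + h - 1) * expR (- t) = t `^ (x - 1) * expR (- t) * t `^ h.
    by rewrite (addrAC x h) (gt0_powRD (x - 1) h t0) mulrAC.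
  rewrite ler_wpM2l ?mulr_ge0 ?powR_ge0 ?expR_ge0//.
  by apply: powR_le_affine => //; [exact: ltW|rewrite h0].
Qed.

Lemma gamma_integral_scaled (x c : R) : 0 < x -> 0 < c ->
  (\int[leb]_(t in ray) (t `^ (x - 1) * expR (- (c * t)))%:E =
   (c `^ (- x) * Gamma x)%:E)%E.
Proof.
move=> x0 c0.
pose f : measurableTypeR R -> \bar R :=
  (fun t => (t `^ (x - 1) * expR (- t))%:E) \_ ray.
have mf : measurable_fun setT f.
  have m1 := measurable_int leb (gamma_integrable x0).
  exact: ((measurable_restrictT _ mray).1 m1).
have f0 t : (0 <= f t)%E.
  by rewrite erestrict_ge0// => u _; rewrite lee_fin mulr_ge0 ?powR_ge0 ?expR_ge0.
have intf : (\int[leb]_t f t = (Gamma x)%:E)%E.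
  by rewrite /f -integral_mkcond -EFin_Gamma// GammaE.
have := ge0_integral_affine 0 c0 mf f0; rewrite intf => EI.
transitivity (\int[leb]_t (((c `^ (1 - x))%:E * f (c * t + 0)%R))%E)%E.
  rewrite [LHS]integral_mkcond; apply: eq_integral => t _.
  rewrite /f !patchE !mem_setE !in_itv/= !andbT addr0 pmulr_rgt0//.
  case: ifPn => t0; last by rewrite mule0.
  rewrite -EFinM powRM ?(ltW t0) ?(ltW c0)//; congr EFin.
  by rewrite -(opprB x 1) powRN; field; rewrite gt_eqF ?powR_gt0.
rewrite ge0_integralZl//; last 2 first.
- by apply: measurableT_comp => //; apply: measurable_funD => //; exact: mulrl_measurable.
- by rewrite lee_fin powR_ge0.
rewrite [X in (_ * X)%E](_ : _ = (c^-1 * Gamma x)%:E); last first.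
  by rewrite EFinM EI muleA -EFinM mulVf ?gt_eqF// mul1e.
rewrite -EFinM mulrA; congr (EFin (_ * _)).
by rewrite -(powR_inv1 (ltW c0)) -gt0_powRD//; congr powR; ring.
Qed.

End gamma.

(** * Everywhere convergent power series and hypergeometric series *)

Section entire_series.
Context {R : realType}.
Implicit Types (c d u : nat -> R) (a b x y r s t : R).

Lemma ratio_test u r : 0 < r < 1 ->
  (\forall k \near \oo, `|u k.+1| <= r * `|u k|) -> cvgn (series u).
Proof.
move=> /andP[r0 r1] [K _ uK].
pose C := \sum_(i < K.+1) `|u i| / r ^+ i.
have ge0 i : 0 <= `|u i| / r ^+ i by rewrite divr_ge0// exprn_ge0// ltW.
have uC k : `|u k| <= C * r ^+ k.
  have [kK|] := leqP k K.
    rewrite -ler_pdivrMr ?exprn_gt0// /C.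
    rewrite (bigD1 (Ordinal (kK : (k < K.+1)%N)))//= lerDl.
    by apply: sumr_ge0.
  elim: k => // k ih; rewrite ltnS => Kk.
  apply: (le_trans (uK _ Kk)); rewrite exprS mulrCA ler_wpM2l ?(ltW r0)//.
  move: Kk; rewrite leq_eqVlt => /predU1P[<-|]; last exact: ih.
  rewrite -ler_pdivrMr ?exprn_gt0// /C big_ord_recr/= lerDr.
  exact: sumr_ge0.
apply: normed_cvg; apply: (series_le_cvg _ _ uC) => //.
- by move=> n; rewrite mulr_ge0 ?exprn_ge0 ?(ltW r0)// sumr_ge0.
- by apply: is_cvg_geometric_series; rewrite ger0_norm// ltW.
Qed.

(** Being closed under the operations below, this condition settles every
    question of convergence about the series that follow, and identities between
    them are proved by comparing coefficients. *)
Definition entire c := forall y, cvgn (pseries c y).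

Definition psum c y : R := limn (pseries c y).

Lemma cvg_psum c y : entire c -> pseries c y @ \oo --> psum c y.
Proof. exact. Qed.

Lemma psum_unique c y s : entire c -> pseries c y @ \oo --> s -> psum c y = s.
Proof. by move=> ec; apply/cvg_unique/cvg_psum. Qed.

Definition pshift c k := if k is k'.+1 then c k' else 0.

Let cvg_pscale a c y s : pseries c y @ \oo --> s ->
  pseries (fun k => a * c k) y @ \oo --> a * s.
Proof.
move=> h; have -> : pseries (fun k => a * c k) y = (fun n => a * pseries c y n).
  by apply/funext => n; rewrite /pseries /series/= mulr_sumr; apply: eq_bigr => k _; rewrite mulrA.
by apply: cvgMr.
Qed.

Let cvg_padd c d y s t : pseries c y @ \oo --> s -> pseries d y @ \oo --> t ->
  pseries (fun k => c k + d k) y @ \oo --> s + t.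
Proof.
move=> h1 h2; have -> : pseries (fun k => c k + d k) y = (fun n => pseries c y n + pseries d y n).
  apply/funext => n; rewrite /pseries /series/= -big_split.
  by apply: eq_bigr => k _; rewrite mulrDl.
exact: cvgD.
Qed.

Let cvg_pshift c y s : pseries c y @ \oo --> s ->
  pseries (pshift c) y @ \oo --> y * s.
Proof.
move=> h; rewrite -cvg_shiftS.
have -> : (fun n => pseries (pshift c) y n.+1) = (fun n => y * pseries c y n).
  apply/funext => n; rewrite /pseries /series/= big_nat_recl//= mul0r add0r mulr_sumr.
  by apply: eq_bigr => k _; rewrite exprS mulrCA.
by apply: cvgMr.
Qed.

Lemma entireZ a c : entire c -> entire (fun k => a * c k).
Proof. by move=> ec y; apply/cvg_ex; exists (a * psum c y); exact/cvg_pscale/cvg_psum. Qed.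

Lemma entireD c d : entire c -> entire d -> entire (fun k => c k + d k).
Proof.
move=> ec ed y; apply/cvg_ex; exists (psum c y + psum d y).
by apply: cvg_padd; exact: cvg_psum.
Qed.

Lemma entire_shift c : entire c -> entire (pshift c).
Proof. by move=> ec y; apply/cvg_ex; exists (y * psum c y); exact/cvg_pshift/cvg_psum. Qed.

Lemma psumZ a c y : entire c -> psum (fun k => a * c k) y = a * psum c y.
Proof. by move=> ec; apply/psum_unique; [exact: entireZ|exact/cvg_pscale/cvg_psum]. Qed.

Lemma psumD c d y : entire c -> entire d ->
  psum (fun k => c k + d k) y = psum c y + psum d y.
Proof.
move=> ec ed; apply/psum_unique; first exact: entireD.
by apply: cvg_padd; exact: cvg_psum.
Qed.

Lemma psum_shift c y : entire c -> psum (pshift c) y = y * psum c y.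
Proof. by move=> ec; apply/psum_unique; [exact: entire_shift|exact/cvg_pshift/cvg_psum]. Qed.

Lemma psum_at0 c : psum c 0 = c 0%N.
Proof.
apply/cvg_lim => //; rewrite -cvg_shiftS.
rewrite (_ : (fun _ => _) = cst (c 0%N)); first exact: cvg_cst.
apply/funext => n; rewrite /pseries /series/= big_nat_recl//= expr0 mulr1 big1 ?addr0//.
by move=> k _; rewrite expr0n mulr0.
Qed.

Lemma entire_norm c : entire c -> entire (fun k => `|c k|).
Proof.
move=> ec y; apply: (@is_cvg_pseries_inside_norm _ c (`|y| + 1)) => //.
by rewrite [ltRHS]ger0_norm ?addr_ge0// ltrDl.
Qed.

Lemma entire_diffs c : entire c -> entire (pseries_diffs c).
Proof.
move=> ec y; apply: normed_cvg.
pose z := 2 * (`|y| + 1).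
have z1 : 1 <= `|y| + 1 by rewrite lerDr.
apply: (@series_le_cvg _ _ (fun k => `|c k.+1| * z ^+ k.+1)) => //.
- by move=> n; exact: normr_ge0.
- have z0 : 0 <= z by rewrite /z mulr_ge0// addr_ge0.
  by move=> n; apply: mulr_ge0 => //; exact: exprn_ge0.
- move=> n; rewrite /= /pseries_diffs !normrM normrX mulrAC [leLHS]mulrC ler_wpM2l//.
  rewrite /z exprMn; apply: ler_pM => //.
    by rewrite normr_nat -natrX ler_nat ltnW// ltn_expl.
  rewrite (@le_trans _ _ ((`|y| + 1) ^+ n))//.
    by rewrite lerXn2r ?nnegrE ?addr_ge0// lerDl.
  by rewrite ler_weXn2l.
- have en : entire (fun k => `|c k|) by exact: entire_norm.
  have := en z; rewrite /pseries => /cvg_ex[l] hl.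
  apply/cvg_ex; exists (l - `|c 0%N|).
  rewrite -cvg_shiftS in hl.
  rewrite (_ : series _ = (fun n => series (fun i => `|c i| * z ^+ i) n.+1 - `|c 0%N|)).
    by apply: cvgB => //; exact: cvg_cst.
  apply/funext => n; rewrite /series/= big_nat_recl//= expr0 mulr1.
  by rewrite addrAC subrr add0r.
Qed.

Lemma is_derive_psum c y : entire c -> is_derive y 1 (psum c) (psum (pseries_diffs c) y).
Proof.
move=> ec; apply: (@pseries_snd_diffs _ _ (`|y| + 1)).
- exact: ec.
- exact: entire_diffs.
- exact/entire_diffs/entire_diffs.
- by rewrite [ltRHS]ger0_norm ?addr_ge0// ltrDl.
Qed.

Lemma continuous_psum c : entire c -> continuous (psum c).
Proof. by move=> ec y; exact/is_derive_continuous/is_derive_psum. Qed.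

Lemma psum_ge c y : entire c -> (forall k, 0 <= c k) -> 0 <= y -> c 0%N <= psum c y.
Proof.
move=> ec c0 y0; apply: limr_ge; first exact: ec.
exists 1%N => // n /=; case: n => // n _.
rewrite /pseries /series/= big_nat_recl//= expr0 mulr1 lerDl.
by apply: sumr_ge0 => k _; rewrite mulr_ge0// exprn_ge0.
Qed.

Lemma EFin_psum c y : entire c -> (forall k, 0 <= c k) -> 0 <= y ->
  ((psum c y)%:E = \sum_(0 <= k <oo) (c k * y ^+ k)%:E)%E.
Proof.
move=> ec c0 y0; apply/esym/cvg_lim => //.
under eq_fun do rewrite sumEFin.
by apply: cvg_EFin; [exact: nearW|exact: cvg_psum].
Qed.

End entire_series.

Section hypergeometric.
Context {R : realType}.
Implicit Types (p q y : R).

Definition hcoef p q (k : nat) : R := rising p k / rising q k / k`!%:R.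

Lemma risingS p k : rising p k.+1 = rising p k * (p + k%:R).
Proof. by rewrite /rising big_ord_recr. Qed.

Lemma rising0 p : rising p 0 = 1.
Proof. by rewrite /rising big_ord0. Qed.

Lemma rising_gt0 p k : 0 < p -> 0 < rising p k.
Proof. by move=> p0; apply: prodr_gt0 => i _; rewrite ltr_wpDr. Qed.

Lemma rising_shift p k : rising p k.+1 = p * rising (p + 1) k.
Proof.
rewrite /rising big_ord_recl addr0; congr (_ * _); apply: eq_bigr => i _.
by rewrite lift0 -addrA nat1r.
Qed.

Lemma Gamma_rising p k : 0 < p -> Gamma (p + k%:R) = rising p k * Gamma p.
Proof.
move=> p0; elim: k => [|k ih]; first by rewrite addr0 rising0 mul1r.
by rewrite -natr1 addrA GammaS ?ltr_wpDr// ih risingS mulrA (mulrC (_ + _)).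
Qed.

Lemma hcoef0 p q : hcoef p q 0 = 1.
Proof. by rewrite /hcoef !rising0 fact0 !divr1. Qed.

Lemma hcoefS p q k :
  hcoef p q k.+1 = hcoef p q k * ((p + k%:R) / ((q + k%:R) * k.+1%:R)).
Proof.
rewrite /hcoef !risingS factS natrM !invfM.
by rewrite -!mulrA; congr (_ * _); rewrite mulrCA; congr (_ * _); rewrite !mulrA; ring.
Qed.

Lemma hyp1F1E p q : hyp1F1 p q = psum (hcoef p q).
Proof.
apply/funext => y; rewrite /hyp1F1 /psum /pseries; congr (limn (series _)).
by apply/funext => k; rewrite /hcoef mulrAC.
Qed.

Lemma entire_hcoef p q : entire (hcoef p q).
Proof.
move=> y; apply: (@ratio_test _ _ 2^-1); first by rewrite invr_gt0 ltr0n invf_lt1// ltr1n.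
near=> k; rewrite /= hcoefS exprS.
rewrite [X in `|X|](_ : _ = ((p + k%:R) / (q + k%:R) * (y / k.+1%:R)) * (hcoef p q k * y ^+ k)); last first.
  by rewrite invfM; ring.
rewrite normrM ler_wpM2r// normrM.
have kq : `|q| + 1 <= k%:R by near: k; exact: nbhs_infty_ger.
have kp : `|p| + 3 * `|q| <= k%:R by near: k; exact: nbhs_infty_ger.
have ky : 6 * `|y| <= k%:R by near: k; exact: nbhs_infty_ger.
have q0 : 0 < k%:R - `|q| by rewrite subr_gt0 (lt_le_trans _ kq)// ltrDl.
rewrite (_ : 2^-1 = 3 * 6^-1); last by lra.
have qk : k%:R - `|q| <= `|q + k%:R|.
  rewrite lerBlDr; have := ler_normB (q + k%:R) q.
  by rewrite (addrC q) addrK normr_nat.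
rewrite ler_pM//.
  rewrite normrM normfV ler_pdivrMr; last exact: lt_le_trans qk.
  rewrite (le_trans (ler_normD _ _))// normr_nat.
  have k0 : 0 <= k%:R :> R by [].
  by have := normr_ge0 q; lra.
rewrite normrM normfV normr_nat ler_pdivrMr// -(natr1 k).
by lra.
Unshelve. all: by end_near. Qed.

Lemma psum_hcoef_at0 p q : psum (hcoef p q) 0 = 1.
Proof. by rewrite psum_at0 hcoef0. Qed.

Lemma hcoef_ge0 p q k : 0 < p -> 0 < q -> 0 <= hcoef p q k.
Proof.
move=> p0 q0; have := rising_gt0 k p0; have := rising_gt0 k q0 => h1 h2.
by rewrite /hcoef !divr_ge0// ltW.
Qed.

End hypergeometric.

(** * Kummer's equation *)

Section gamma_ratio.
Context {R : realType}.
Implicit Types x h p : R.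

Let cvg_ratio_addn (x y : R) : 0 < y ->
  (x + k%:R) / (y + k%:R) @[k --> \oo] --> (1 : R).
Proof.
move=> y0.
have inv0 : (y + k%:R)^-1 @[k --> \oo] --> (0 : R).
  apply/(gtr0_cvgV0 (f := fun k : nat => y + k%:R)).
    by apply: nearW => k; rewrite ltr_wpDr.
  apply/cvgryPge => A; near=> k; rewrite -lerBlDl.
  by near: k; exact: nbhs_infty_ger.
have -> : (fun k : nat => (x + k%:R) / (y + k%:R)) = (fun k => 1 + (x - y) * (y + k%:R)^-1).
  by apply/funext => k; field; rewrite gt_eqF// ltr_wpDr.
rewrite -[X in _ --> X]addr0 -[X in _ --> (_ + X)](mulr0 (x - y)).
by apply: cvgD; [exact: cvg_cst|apply: cvgM => //; exact: cvg_cst].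
Unshelve. all: by end_near. Qed.

Let cvg_Gamma_shift x h : 0 < x -> 0 <= h <= 1 ->
  Gamma (x + k%:R + h) / (Gamma (x + k%:R) * (x + k%:R) `^ h) @[k --> \oo] --> (1 : R).
Proof.
move=> x0 /andP[h0 h1].
apply: (@squeeze_cvgr _ _ _ _ (fun k : nat => (x + k%:R) / (x + 1 + k%:R)) (fun=> 1)).
- apply: nearW => k; set X := x + k%:R.
  have X0 : 0 < X by rewrite ltr_wpDr.
  have Xh0 : 0 < X + h by rewrite ltr_wpDr.
  have GX := Gamma_gt0 X0; have GXh := Gamma_gt0 Xh0.
  have PX := powR_gt0 h X0; have PXh := powR_gt0 (1 - h) Xh0.
  apply/andP; split; last first.
    rewrite ler_pdivrMr ?mulr_gt0// mul1r mulrC.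
    by apply: GammaD_le => //; rewrite h0.
  have := @GammaD_le R (X + h) (1 - h) Xh0.
  rewrite subr_ge0 h1 lerBlDr lerDl h0 => /(_ isT).
  rewrite -addrA subrKC GammaS// => le1.
  rewrite ler_pdivlMr ?mulr_gt0//.
  rewrite (_ : x + 1 + k%:R = X + 1); last by rewrite /X addrAC.
  have X10 : 0 < X + 1 by exact: addr_gt0.
  rewrite mulrAC (ler_pdivrMr _ _ X10).
  rewrite mulrA mulrAC.
  have : X * Gamma X * X `^ h <= (X + h) `^ (1 - h) * Gamma (X + h) * (X + h) `^ h.
    apply: ler_pM; rewrite ?mulr_ge0 ?(ltW X0) ?(ltW GX) ?(ltW PX)//.
    by apply: ge0_ler_powR; rewrite ?nnegrE ?(ltW X0) ?(ltW Xh0)// lerDl.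
  rewrite [X in _ <= X -> _](_ : _ = Gamma (X + h) * (X + h)); last first.
    rewrite mulrAC -gt0_powRD// subrK powRr1 ?(ltW Xh0)//; exact: mulrC.
  move=> /le_trans; rewrite [X in _ -> X <= _]mulrAC; apply.
  by rewrite ler_wpM2l ?(ltW GXh)// lerD2l.
- by apply: cvg_ratio_addn; rewrite addr_gt0.
- exact: cvg_cst.
Qed.

(** Both quotients of Gamma values grow like [k `^ h]: [GammaD_le] at [x] bounds
    [Gamma (x + h)] above, and at [x + h] with [1 - h] bounds it below. *)
Lemma cvg_Gamma_ratio x p h : 0 < x -> 0 < p -> 0 <= h <= 1 ->
  (Gamma (p + k%:R + h) / Gamma (p + k%:R)) / (Gamma (x + k%:R + h) / Gamma (x + k%:R))
    @[k --> \oo] --> (1 : R).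
Proof.
move=> x0 p0 h01.
have -> : (fun k : nat => (Gamma (p + k%:R + h) / Gamma (p + k%:R)) /
      (Gamma (x + k%:R + h) / Gamma (x + k%:R))) =
   (fun k => (Gamma (p + k%:R + h) / (Gamma (p + k%:R) * (p + k%:R) `^ h))
        * (Gamma (x + k%:R + h) / (Gamma (x + k%:R) * (x + k%:R) `^ h))^-1
        * ((p + k%:R) / (x + k%:R)) `^ h).
  apply/funext => k.
  have xk : 0 < x + k%:R by rewrite ltr_wpDr.
  have pk : 0 < p + k%:R by rewrite ltr_wpDr.
  have xkh : 0 < x + k%:R + h by rewrite ltr_wpDr//; case/andP: h01.
  rewrite powRM ?invr_ge0 ?(ltW pk) ?(ltW xk)//.
  rewrite -(powR_inv1 (ltW xk)) (powRAC _ (-1)) powR_inv1 ?powR_ge0//.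
  have := powR_gt0 h xk; have := powR_gt0 h pk.
  have := Gamma_gt0 xk; have := Gamma_gt0 pk; have := Gamma_gt0 xkh.
  by move=> *; field; rewrite !gt_eqF.
rewrite -[X in _ --> X]mulr1; apply: cvgM.
  rewrite -[X in _ --> X]mulr1; apply: cvgM; first exact: cvg_Gamma_shift.
  rewrite -[X in _ --> X]invr1; apply: cvgV; [by rewrite oner_eq0|exact: cvg_Gamma_shift].
have : {for 1, continuous (@powR R ^~ h)}.
  exact/is_derive_continuous/is_derive1_powR.
rewrite /prop_for /continuous_at powR1.
by apply: cvg_comp; exact: cvg_ratio_addn.
Qed.

End gamma_ratio.

Section kummer.
Context {R : realType}.
Implicit Types (p q y : R) (u v : R -> R).

Lemma derive0_cst_ray (f : R -> R) : (forall y, 0 < y -> is_derive y 1 f 0) ->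
  forall x y, 0 < x -> 0 < y -> f x = f y.
Proof.
move=> df; suff H x y : 0 < x -> x <= y -> f x = f y.
  by move=> x y x0 y0; have [/H|/ltW/H/esym] := leP x y; exact.
move=> x0 xy.
have [||z] := @MVT_segment R f (fun=> 0) x y xy.
- by move=> z; rewrite in_itv/= => /andP[xz _]; apply: df; exact: lt_trans xz.
- apply: continuous_in_subspaceT => t; rewrite inE/= in_itv/= => /andP[xt _].
  by apply/is_derive_continuous/df; exact: lt_le_trans xt.
- by move=> _ /eqP; rewrite mul0r subr_eq0 => /eqP.
Qed.

(** Kummer's equation [y u'' + (q - y) u' = p u], multiplied by
    [y `^ (q - 1) * expR (- y)] to make it self-adjoint: the Wronskian with
    weight [y `^ q * expR (- y)] is then constant. *)
Definition kummer_solution p q u u1 := forall y, 0 < y ->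
  is_derive y 1 u (u1 y) /\
  is_derive y 1 (fun y => y `^ q * expR (- y) * u1 y)
    (p * (y `^ (q - 1) * expR (- y) * u y)).

Lemma kummer_wronskian p q u u1 v v1 :
  kummer_solution p q u u1 -> kummer_solution p q v v1 ->
  forall x y, 0 < x -> 0 < y ->
  x `^ q * expR (- x) * (u x * v1 x - v x * u1 x) =
  y `^ q * expR (- y) * (u y * v1 y - v y * u1 y).
Proof.
move=> hu hv.
pose W y := u y * (y `^ q * expR (- y) * v1 y) - v y * (y `^ q * expR (- y) * u1 y).
have WE y : y `^ q * expR (- y) * (u y * v1 y - v y * u1 y) = W y.
  by rewrite /W; ring.
move=> x y x0 y0; rewrite !WE; apply: derive0_cst_ray => //.
move=> {x y x0 y0} y y0; have [du dPu] := hu y y0; have [dv dPv] := hv y y0.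
by apply: is_derive_eq; rewrite /GRing.scale/=; ring.
Qed.

Let powR_split (y q : R) : 0 < y -> y `^ q = y * y `^ (q - 1).
Proof. by move=> y0; have := gt0_powRD 1 (q - 1) y0; rewrite subrKC powRr1 ?(ltW y0). Qed.

Lemma kummer_hyp1F1 p q : 0 < q ->
  kummer_solution p q (hyp1F1 p q) (psum (pseries_diffs (hcoef p q))).
Proof.
move=> q0 y y0; have e0 := @entire_hcoef R p q.
set c := hcoef p q in e0 *; rewrite hyp1F1E -/c.
have e1 := entire_diffs e0; have e2 := entire_diffs e1.
split; first exact: is_derive_psum.
have dp := is_derive1_powR q y0; have d1 := is_derive_psum y e1.
apply: is_derive_eq; rewrite /GRing.scale/= (powR_split q y0).
have ode : y * psum (pseries_diffs (pseries_diffs c)) y +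
    q * psum (pseries_diffs c) y = y * psum (pseries_diffs c) y + p * psum c y.
  have s1 := entire_shift e1; have s2 := entire_shift e2.
  have z1 := @entireZ _ q _ e1; have z0 := @entireZ _ p _ e0.
  rewrite -(psum_shift _ e2) -(psumZ _ _ e1) -(psumD _ s2 z1).
  rewrite -(psum_shift _ e1) -(psumZ _ _ e0) -(psumD _ s1 z0).
  congr psum; apply/funext => -[|k].
    rewrite /pshift /pseries_diffs /c hcoefS !add0r !addr0 mulr1 hcoef0.
    by field; rewrite gt_eqF.
  rewrite /pshift /pseries_diffs /c (hcoefS _ _ k.+1) -(natr1 k.+1) -(natr1 k).
  have k0 : 0 <= k%:R :> R by [].
  by field; apply/andP; split; rewrite gt_eqF//; lra.
set P0 := y `^ (q - 1); set E0 := expR (- y).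
transitivity (P0 * E0 * (y * psum (pseries_diffs (pseries_diffs c)) y +
    q * psum (pseries_diffs c) y - y * psum (pseries_diffs c) y)); first by ring.
by rewrite ode addrAC subrr add0r; ring.
Qed.

(** The solution of exponent [1 - q] at [0]; it vanishes there when [q < 1]. *)
Definition kummer_second p q y := y `^ (1 - q) * hyp1F1 (1 + p - q) (2 - q) y.

Definition kummer_second_deriv p q y := y `^ (- q) *
  psum (fun k => (1 - q + k%:R) * hcoef (1 + p - q) (2 - q) k) y.

Lemma kummer_kummer_second p q : q < 1 ->
  kummer_solution p q (kummer_second p q) (kummer_second_deriv p q).
Proof.
move=> q1 y y0; have e0 := @entire_hcoef R (1 + p - q) (2 - q).
set c := hcoef (1 + p - q) (2 - q) in e0 *.
have e1 := entire_diffs e0; have s1 := entire_shift e1.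
have z0 := @entireZ _ (1 - q) _ e0.
pose k := fun k : nat => (1 - q + k%:R) * c k.
have kE : k = (fun k => (1 - q) * c k + pshift (pseries_diffs c) k).
  by apply/funext => -[|i]; rewrite /k /pshift /pseries_diffs ?addr0//; ring.
have ek : entire k by rewrite kE; exact: entireD.
have psk : psum k y = (1 - q) * psum c y + y * psum (pseries_diffs c) y.
  by rewrite kE psumD// psumZ// psum_shift.
rewrite /kummer_second hyp1F1E /kummer_second_deriv -/c -/k.
split.
  have dp := is_derive1_powR (1 - q) y0; have d0 := is_derive_psum y e0.
  apply: is_derive_eq; rewrite /GRing.scale/= psk.
  rewrite (powR_split (1 - q) y0) (_ : 1 - q - 1 = - q); first by ring.
  by rewrite addrAC subrr sub0r.
apply: (@near_eq_is_derive _ _ _ (fun y => expR (- y) * psum k y)).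
  near=> z; have z0' : 0 < z by near: z; exact: lt_nbhsr.
  by rewrite powRN; field; rewrite gt_eqF ?powR_gt0.
have dk := is_derive_psum y ek.
apply: is_derive_eq; rewrite /GRing.scale/=.
have ode : psum (pseries_diffs k) y = psum k y + p * psum c y.
  have z1 := @entireZ _ p _ e0.
  rewrite -(psumZ _ _ e0) -(psumD _ ek z1); congr psum; apply/funext => i.
  rewrite /pseries_diffs /k /c hcoefS -(natr1 i).
  have i0 : 0 <= i%:R :> R by [].
  by field; apply/andP; split; rewrite gt_eqF//; lra.
rewrite ode (_ : 1 - q = - (q - 1)); last by ring.
by rewrite powRN; field; rewrite gt_eqF ?powR_gt0.
Unshelve. all: by end_near. Qed.

End kummer.

Section connection.
Context {R : realType}.
Variables (p q : R).
Hypotheses (q0 : 0 < q) (q1 : q < 1).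

Local Notation c1 := (hcoef p q).
Local Notation c2 := (hcoef (1 + p - q) (2 - q)).

Let e1 : entire c1. Proof. exact: entire_hcoef. Qed.
Let e2 : entire c2. Proof. exact: entire_hcoef. Qed.

Let cvg0r (f : R -> R) : {for 0, continuous f} -> f y @[y --> 0^'+] --> f 0.
Proof. exact: cvg_at_right_filter. Qed.

Let cvg_second0 : kummer_second p q y @[y --> 0^'+] --> (0 : R).
Proof.
rewrite -[X in _ --> X](mul0r (psum c2 0)) /kummer_second; apply: cvgM.
  by apply: powR_cvg0; rewrite subr_gt0.
by rewrite hyp1F1E; apply/cvg0r/continuous_psum/entire_hcoef.
Qed.

Let cvg_first0 : hyp1F1 p q y @[y --> 0^'+] --> (1 : R).
Proof.
rewrite hyp1F1E -(psum_hcoef_at0 p q).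
by apply/cvg0r/continuous_psum/entire_hcoef.
Qed.

(** The constant is found by letting [y] tend to [0], where the weight
    [y `^ q] absorbs the factor [y `^ (- q)] of the derivative of the second
    solution. *)
Let wronskian_cst y : 0 < y -> y `^ q * expR (- y) *
  (hyp1F1 p q y * kummer_second_deriv p q y
   - kummer_second p q y * psum (pseries_diffs c1) y) = 1 - q.
Proof.
move=> y0.
pose k (k : nat) := (1 - q + k%:R) * c2 k.
have ek : entire k.
  move=> z; have /cvg_ex[l hl] := @entire_diffs _ _ (entire_shift e2) z.
  have -> : k = (fun i => pseries_diffs (pshift c2) i + (- q) * c2 i).
    by apply/funext => i; rewrite /k /pseries_diffs /pshift -(natr1 i); ring.
  have ed := entire_diffs (entire_shift e2); have eq2 := @entireZ _ (- q) _ e2.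
  exact: (entireD ed eq2).
pose G z := expR (- z) * (psum c1 z * psum k z - z * psum c2 z * psum (pseries_diffs c1) z).
have WG z : 0 < z -> z `^ q * expR (- z) *
  (hyp1F1 p q z * kummer_second_deriv p q z
   - kummer_second p q z * psum (pseries_diffs c1) z) = G z.
  move=> z0; rewrite /G /kummer_second /kummer_second_deriv !hyp1F1E -/k.
  rewrite powRN (gt0_powRD 1 (- q) z0) powRr1 ?(ltW z0)// powRN.
  by field; rewrite gt_eqF ?powR_gt0.
have cG : {for 0, continuous G}.
  apply: continuousM.
    by apply: continuous_comp; [exact: oppr_continuous|exact: continuous_expR].
  apply: continuousB; first by apply: continuousM; exact: continuous_psum.
  apply: continuousM; last exact/continuous_psum/entire_diffs.
  by apply: continuousM; [exact: cvg_id|exact: continuous_psum].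
have G0 : G 0 = 1 - q.
  rewrite /G oppr0 expR0 !psum_at0 /k !hcoef0.
  by ring.
rewrite -G0; set V := (LHS).
apply: (@cvg_unique _ _ (G z @[z --> 0^'+])) => //; last exact: cvg0r.
apply: (@cvg_trans _ ((fun=> V) z @[z --> 0^'+])); last exact: cvg_cst.
apply: near_eq_cvg; near=> z; have z0 : 0 < z by near: z; exact: nbhs_right_gt.
rewrite -WG//; apply: kummer_wronskian => //.
- exact: kummer_hyp1F1.
- exact: kummer_kummer_second.
Unshelve. all: by end_near. Qed.

(** The Wronskians of [u] with the two series are constant, and solving for [u]
    expresses it through both.  The second series vanishes at [0], so the
    coefficient of the first is the limit of [u]. *)
Lemma kummer_solution_basis (u u' : R -> R) (Z : R) :
  kummer_solution p q u u' -> u y @[y --> 0^'+] --> Z ->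
  exists B, forall y, 0 < y -> u y = Z * hyp1F1 p q y + B * kummer_second p q y.
Proof.
move=> su uZ.
have s1 := kummer_hyp1F1 p q0; have s2 := kummer_kummer_second p q1.
pose W (f f' g g' : R -> R) y := y `^ q * expR (- y) * (f y * g' y - g y * f' y).
pose M := hyp1F1 p q; pose M' := psum (pseries_diffs c1).
pose N := kummer_second p q; pose N' := kummer_second_deriv p q.
pose C1 := W u u' M M' 1; pose C2 := W u u' N N' 1.
have uE y : 0 < y -> (1 - q) * u y = C2 * M y - C1 * N y.
  move=> y0.
  have -> : C1 = W u u' M M' y by exact: (kummer_wronskian su s1 ltr01 y0).
  have -> : C2 = W u u' N N' y by exact: (kummer_wronskian su s2 ltr01 y0).
  by rewrite -(wronskian_cst y0) -/M -/N -/M' -/N' /W; ring.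
have q1' : 1 - q != 0 by rewrite subr_eq0 gt_eqF.
have C2E : C2 = (1 - q) * Z.
  apply: (@cvg_unique _ _ ((C2 * M y - C1 * N y) @[y --> 0^'+])) => //.
    suff : C2 * M y - C1 * N y @[y --> 0^'+] --> C2 * 1 - C1 * 0.
      by rewrite mulr1 mulr0 subr0.
    apply: cvgB.
      by apply: cvgM; [exact: cvg_cst|exact: cvg_first0].
    by apply: cvgM; [exact: cvg_cst|exact: cvg_second0].
  apply: (@cvg_trans _ ((1 - q) * u y @[y --> 0^'+])).
    apply: near_eq_cvg; near=> y.
    have y0 : 0 < y by near: y; exact: nbhs_right_gt.
    by rewrite uE.
  by apply: cvgM => //; exact: cvg_cst.
exists (- C1 / (1 - q)) => y y0.
by apply: (mulfI q1'); rewrite uE// C2E -/M -/N; field.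
Unshelve. all: by end_near. Qed.

End connection.

(** * The bounded solution at infinity *)

Section connection_coefficient.
Context {R : realType}.
Local Notation leb := (@lebesgue_measure R).
Local Notation ray := (`]0%R, +oo[%classic : set (measurableTypeR R)).

Let mray : measurable ray.
Proof. by []. Qed.

Lemma laplace_psum (c : nat -> R) (x s : R) : entire c -> (forall k, 0 <= c k) ->
  0 < x -> 0 < s ->
  (\int[leb]_(y in ray) (y `^ (x - 1) * expR (- (s * y)) * psum c y)%:E =
   \sum_(0 <= k <oo) (c k * (s `^ (- (x + k%:R)) * Gamma (x + k%:R)))%:E)%E.
Proof.
move=> ec c0 x0 s0.
pose g (k : nat) (y : R) := c k * (y `^ (x + k%:R - 1) * expR (- (s * y))).
have mg k : measurable_fun ray (EFin \o g k).
  apply/measurable_EFinP; apply: (measurable_funS (E := setT)) => //.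
  by apply: measurable_funM => //; exact: measurable_gamma_integrand.
transitivity (\int[leb]_(y in ray) \sum_(0 <= k <oo) (g k y)%:E)%E.
  apply: eq_integral => y; rewrite inE/= in_itv/= andbT => y0.
  rewrite EFinM EFin_psum ?(ltW y0)// -nneseriesZl; last first.
    by move=> k _; rewrite lee_fin mulr_ge0// exprn_ge0// ltW.
  apply: eq_eseriesr => k _; rewrite -EFinM /g (addrAC x) (gt0_powRD (x - 1) _ y0) powR_mulrn ?(ltW y0)//.
  by congr EFin; ring.
rewrite integral_nneseries//; last first.
  by move=> k y _; rewrite lee_fin /g !mulr_ge0 ?powR_ge0 ?expR_ge0.
apply: eq_eseriesr => k _.
have xk : 0 < x + k%:R by rewrite ltr_wpDr.
under eq_integral do rewrite /g EFinM.
rewrite ge0_integralZl ?lee_fin//.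
- by rewrite gamma_integral_scaled// -EFinM.
- apply/measurable_EFinP; apply: (measurable_funS (E := setT)) => //.
  exact: measurable_gamma_integrand.
- by move=> y _; rewrite lee_fin mulr_ge0 ?powR_ge0 ?expR_ge0.
Qed.

Variables (p q : R).
Hypotheses (p0 : 0 < p) (q0 : 0 < q) (q1 : q < 1).

Local Notation c1 := (hcoef p q).
Local Notation c2 := (hcoef (1 + p - q) (2 - q)).

Let pq0 : 0 < 1 + p - q. Proof. by move: p0 q1; lra. Qed.
Let q20 : 0 < 2 - q. Proof. by move: q1; lra. Qed.

(** The Laplace transforms of the two series solutions, taken with the weight
    [y `^ (q - 1)], are series in [s^-1] with coefficients [b k * Gamma q] and
    [b k * be k].  As [be k] tends to [L], the two diverge in the ratio of
    [Gamma q] to [L] when [s] decreases to [1]. *)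
Let b (k : nat) : R := rising p k / k`!%:R.
Let be (k : nat) : R := c2 k * Gamma (1 + k%:R) / b k.
Let L : R := Gamma (2 - q) * Gamma p / Gamma (1 + p - q).

Let b_gt0 k : 0 < b k.
Proof. by rewrite divr_gt0 ?rising_gt0. Qed.

Let bS k : b k.+1 = b k * ((p + k%:R) / k.+1%:R).
Proof.
by rewrite /b risingS factS natrM invfM; rewrite -!mulrA; congr (_ * _); ring.
Qed.

Let cvg_be : be k @[k --> \oo] --> L.
Proof.
have beE k : be k = L * ((Gamma (p + k%:R + (1 - q)) / Gamma (p + k%:R)) /
    (Gamma (1 + k%:R + (1 - q)) / Gamma (1 + k%:R))).
  have pk : 0 < p + k%:R by rewrite ltr_wpDr.
  have k1 : 0 < 1 + k%:R :> R by rewrite ltr_wpDr.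
  rewrite (_ : p + k%:R + (1 - q) = (1 + p - q) + k%:R); last by ring.
  rewrite (_ : 1 + k%:R + (1 - q) = (2 - q) + k%:R); last by ring.
  rewrite /be /b /L /hcoef [in LHS](Gamma_rising k ltr01).
  rewrite (Gamma_rising k ltr01) (Gamma_rising k pq0) (Gamma_rising k q20) (Gamma_rising k p0).
  have := Gamma_gt0 p0; have := Gamma_gt0 q20; have := Gamma_gt0 pq0.
  have := Gamma_gt0 (@ltr01 R).
  have := rising_gt0 k p0; have := rising_gt0 k q20; have := rising_gt0 k pq0.
  have := rising_gt0 k (@ltr01 R) => *.
  by field; rewrite !gt_eqF.
rewrite -[X in _ --> X]mulr1.
under eq_fun do rewrite beE.
apply: cvgM; first exact: cvg_cst.
by apply: cvg_Gamma_ratio => //; rewrite subr_ge0 (ltW q1) lerBlDr lerDl ltW.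
Qed.

Let be_bounded : exists2 D, 0 < D & forall k, `|be k| <= D.
Proof.
have /cvg_seq_bounded [M [Mr Mb]] : cvgn be by apply/cvg_ex; exists L.
exists (`|M| + 1); first by rewrite ltr_wpDl.
by move=> k; apply: Mb => //; rewrite (le_lt_trans (ler_norm M))// ltrDl.
Qed.

Let m (s : R) (k : nat) := c1 k * (s `^ (- (q + k%:R)) * Gamma (q + k%:R)).
Let n (s : R) (k : nat) := c2 k * (s `^ (- (1 + k%:R)) * Gamma (1 + k%:R)).

Let mE s k : m s k = b k * s `^ (- (q + k%:R)) * Gamma q.
Proof.
rewrite /m Gamma_rising// /b /hcoef.
by have := rising_gt0 k q0 => h; field; rewrite !gt_eqF ?ltr0n ?fact_gt0.
Qed.

Let nE s k : 0 < s -> n s k = b k * s `^ (- (q + k%:R)) * (be k * s `^ (q - 1)).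
Proof.
move=> s0; rewrite /n (_ : - (1 + k%:R) = - (q + k%:R) + (q - 1)); last by ring.
rewrite (gt0_powRD (- (q + k%:R)) (q - 1) s0) /be.
by have := b_gt0 k => h; field; rewrite gt_eqF.
Qed.

Let cvg_m s : 1 < s -> cvgn (series (m s)).
Proof.
move=> s1; have s0 : 0 < s by exact: lt_trans s1.
have sV1 : s^-1 < 1 by rewrite invf_lt1.
have sV0 : 0 < s^-1 by rewrite invr_gt0.
apply: (@ratio_test _ _ ((s^-1 + 1) / 2)).
  by apply/andP; split; lra.
near=> k.
rewrite !mE bS -natr1 addrA opprD (gt0_powRD _ _ s0) (powR_inv1 (ltW s0)).
rewrite [X in `|X|](_ : _ = ((p + k%:R) / (k%:R + 1) * s^-1) * (b k * s `^ (- (q + k%:R)) * Gamma q)); last by ring.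
rewrite normrM ler_wpM2r//.
have pk : 0 < p + k%:R by rewrite ltr_wpDr.
have k1 : 0 < k%:R + 1 :> R by rewrite ltr_wpDl.
rewrite ger0_norm; last by rewrite mulr_ge0 ?divr_ge0 ?(ltW pk) ?(ltW k1) ?(ltW sV0).
rewrite mulrAC ler_pdivrMr//.
have kp : 2 * p / (1 - s^-1) <= k%:R by near: k; exact: nbhs_infty_ger.
move: kp; rewrite ler_pdivrMr ?subr_gt0// => kp.
have : p * s^-1 <= p by rewrite ler_piMr ?(ltW p0) ?(ltW sV1).
by move: kp sV0 sV1; set t := s^-1; nra.
Unshelve. all: by end_near. Qed.

Let m_ge0 s k : 0 <= m s k.
Proof.
rewrite mE; apply: mulr_ge0; last exact/ltW/Gamma_gt0.
by apply: mulr_ge0; [exact/ltW/b_gt0|exact: powR_ge0].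
Qed.

Let n_ge0 s k : 0 <= n s k.
Proof.
have k1 : 0 < 1 + k%:R :> R by rewrite ltr_wpDr.
apply: mulr_ge0; first exact: hcoef_ge0.
by apply: mulr_ge0; [exact: powR_ge0|exact/ltW/Gamma_gt0].
Qed.

Let cvg_n s : 1 < s -> cvgn (series (n s)).
Proof.
move=> s1; have s0 : 0 < s by exact: lt_trans s1.
have [D D0 hD] := be_bounded.
pose C := D * s `^ (q - 1) / Gamma q.
apply: (@series_le_cvg _ _ (fun k => C * m s k)) => //.
- move=> k; apply: mulr_ge0 => //; apply: divr_ge0; last exact/ltW/Gamma_gt0.
  by apply: mulr_ge0; [exact: ltW|exact: powR_ge0].
- move=> k; rewrite nE// mE /C.
  rewrite [leRHS](_ : _ = b k * s `^ (- (q + k%:R)) * (D * s `^ (q - 1))); last first.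
    by field; rewrite gt_eqF// Gamma_gt0.
  apply: ler_wpM2l; first by apply: mulr_ge0; [exact/ltW/b_gt0|exact: powR_ge0].
  by rewrite ler_wpM2r ?powR_ge0// (le_trans (ler_norm _)).
- rewrite (_ : (fun _ => _) = C *: m s); last exact/funext.
  exact: (is_cvg_seriesZ (cvg_m s1)).
Qed.

Let EFin_series (u : nat -> R) : cvgn (series u) ->
  (\sum_(0 <= k <oo) (u k)%:E = (limn (series u))%:E)%E.
Proof.
move=> cu; apply/cvg_lim => //; under eq_fun do rewrite sumEFin.
by apply: cvg_EFin; first exact: nearW.
Qed.


Local Notation M := (hyp1F1 p q).
Local Notation N := (kummer_second p q).
Local Notation w s := (fun y : R => y `^ (q - 1) * expR (- (s * y))).

Let mw s : measurable_fun ray (w s).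
Proof.
apply: (measurable_funS (E := setT)) => //; exact: measurable_gamma_integrand.
Qed.

Let w_ge0 s y : 0 <= w s y.
Proof. by rewrite mulr_ge0 ?powR_ge0 ?expR_ge0. Qed.

Let measurable_hyp (p' q' : R) : measurable_fun ray (hyp1F1 p' q').
Proof.
apply: (measurable_funS (E := setT)) => //.
apply: continuous_measurable_fun; rewrite hyp1F1E.
exact/continuous_psum/entire_hcoef.
Qed.

Let ge0_integrable_ray' (f : R -> R) (l : R) : measurable_fun ray f ->
  (forall y, 0 < y -> 0 <= f y) ->
  (\int[leb]_(y in ray) (f y)%:E = l%:E)%E ->
  leb.-integrable ray (fun y => (f y)%:E).
Proof.
move=> mf f0 fl; apply/integrableP; split; first exact/measurable_EFinP.
rewrite (_ : (\int[_]_(x in _) _)%E = (\int[leb]_(x in ray) (f x)%:E)%E).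
  by rewrite fl ltry.
by apply: eq_integral => x; rewrite inE/= in_itv/= andbT => /f0 fx0; rewrite ger0_norm.
Qed.

Let integral_M s : 1 < s ->
  (\int[leb]_(y in ray) (w s y * M y)%:E = (limn (series (m s)))%:E)%E.
Proof.
move=> s1; have s0 : 0 < s by exact: lt_trans s1.
rewrite hyp1F1E laplace_psum//; first exact/EFin_series/cvg_m.
- exact: entire_hcoef.
- by move=> k; exact: hcoef_ge0.
Qed.

Let integral_N s : 1 < s ->
  (\int[leb]_(y in ray) (w s y * N y)%:E = (limn (series (n s)))%:E)%E.
Proof.
move=> s1; have s0 : 0 < s by exact: lt_trans s1.
rewrite -(EFin_series (cvg_n s1)) -laplace_psum//; last 2 first.
- exact: entire_hcoef.
- by move=> k; exact: hcoef_ge0.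
apply: eq_integral => y; rewrite inE/= in_itv/= andbT => y0.
rewrite /kummer_second hyp1F1E subrr powRr0 mul1r.
rewrite (_ : 1 - q = - (q - 1)); last by ring.
by rewrite powRN; congr EFin; field; rewrite gt_eqF// powR_gt0.
Qed.

Let hyp_ge0 (p' q' y : R) : 0 < p' -> 0 < q' -> 0 < y -> 0 <= hyp1F1 p' q' y.
Proof.
move=> p'0 q'0 y0; rewrite hyp1F1E.
rewrite (le_trans _ (psum_ge _ _ _))//.
- by rewrite hcoef0.
- exact: entire_hcoef.
- by move=> k; exact: hcoef_ge0.
- exact: ltW.
Qed.

Let series_bound (Z B K : R) : 0 <= K ->
  (forall y, 0 < y -> Z * M y + B * N y <= K) ->
  forall s, 1 < s -> limn (series (fun k => Z * m s k + B * n s k)) <= K * Gamma q.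
Proof.
move=> K0 uK s s1; have s0 : 0 < s by exact: lt_trans s1.
have iM : leb.-integrable ray (fun y => (w s y * M y)%:E).
  apply: ge0_integrable_ray' (integral_M s1); first exact: measurable_funM.
  by move=> y y0; rewrite mulr_ge0// hyp_ge0.
have iN : leb.-integrable ray (fun y => (w s y * N y)%:E).
  apply: ge0_integrable_ray' (integral_N s1).
    apply: measurable_funM => //; apply: measurable_funM => //.
    exact: (measurable_funS (E := setT)).
  by move=> y y0; rewrite mulr_ge0// mulr_ge0 ?powR_ge0// hyp_ge0.
have iw : leb.-integrable ray (fun y => (w s y)%:E).
  exact: ge0_integrable_ray' (gamma_integral_scaled q0 s0).
have iZM := integrableZl mray Z iM.
have iBN := integrableZl mray B iN.
have iKw := integrableZl mray K iw.
have E1 := integralZl mray iM Z; rewrite (integral_M s1) -EFinM in E1.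
have E2 := integralZl mray iN B; rewrite (integral_N s1) -EFinM in E2.
have E3 := integralD mray iZM iBN; rewrite E1 E2 -EFinD in E3.
have E4 := integralZl mray iw K; rewrite (gamma_integral_scaled q0 s0) -EFinM in E4.
have -> : limn (series (fun k => Z * m s k + B * n s k)) =
    Z * limn (series (m s)) + B * limn (series (n s)).
  have -> : (fun k => Z * m s k + B * n s k) = (Z *: m s + B *: n s).
    exact/funext.
  have cm : cvgn (series (Z *: m s)) by exact: (is_cvg_seriesZ (cvg_m s1)).
  have cn : cvgn (series (B *: n s)) by exact: (is_cvg_seriesZ (cvg_n s1)).
  rewrite (lim_seriesD cm cn) (@lim_seriesZ _ _ _ (cvg_m s1)) (@lim_seriesZ _ _ _ (cvg_n s1)).
  by [].
rewrite (@le_trans _ _ (K * (s `^ (- q) * Gamma q)))//; last first.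
  rewrite ler_wpM2l// ler_piMl ?(ltW (Gamma_gt0 q0))//.
  rewrite -(powRr0 s); apply: ler_powR; first exact: ltW.
  by rewrite oppr_le0 ltW.
rewrite -lee_fin -E3 -E4.
apply: le_integral => //.
  exact: integrableD.
move=> y; rewrite inE/= in_itv/= andbT => y0.
rewrite -!EFinM -EFinD lee_fin.
rewrite [leLHS](_ : _ = w s y * (Z * M y + B * N y)); last by ring.
by rewrite [leRHS]mulrC ler_wpM2l// uK.
Qed.

Let dvg_b (C : R) : ~ (forall k, series b k <= C).
Proof.
move=> bC.
have cb : cvgn (series b).
  apply: nondecreasing_is_cvgn.
    by apply: nondecreasing_series => k _ _; exact/ltW/b_gt0.
  by exists C => _ [k _ <-]; exact: bC.
have lb k : p * k.+1%:R^-1 <= b k.+1.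
  elim: k => [|k ih].
    rewrite bS (_ : b 0%N = 1) ?mul1r ?addr0//.
    by rewrite /b rising0 fact0 divr1.
  rewrite (bS k.+1) (le_trans _ (ler_wpM2r _ ih))//; last first.
    by rewrite divr_ge0// addr_ge0// ltW.
  rewrite -mulrA ler_wpM2l ?(ltW p0)// mulrA ler_peMl ?invr_ge0//.
  by rewrite ler_pdivlMl// mulr1 lerDr ltW.
apply: (@dvg_harmonic R).
have cb1 : cvgn (series (fun k => p^-1 * b k.+1)).
  have /cvg_ex[l hl] := cb.
  apply/cvg_ex; exists (p^-1 * (l - b 0%N)).
  rewrite -cvg_shiftS in hl.
  rewrite (_ : series _ = (fun j => p^-1 * (series b j.+1 - b 0%N))).
    by apply: cvgM; [exact: cvg_cst|apply: cvgB => //; exact: cvg_cst].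
  apply/funext => j; rewrite /series/= big_nat_recl//= addrAC subrr add0r.
  by rewrite mulr_sumr.
apply: (series_le_cvg _ _ _ cb1) => [k|k|k].
- by rewrite /= invr_ge0.
- by rewrite /= mulr_ge0 ?invr_ge0 ?(ltW p0)//; exact/ltW/b_gt0.
- by rewrite /= ler_pdivlMl.
Qed.

(** Were this combination positive, the transform of the left-hand side would
    eventually dominate a positive multiple of the divergent series of [b], but it
    is at most the transform of the constant [K]. *)
Let coefficient_le0 (Z B K : R) :
  (forall y, 0 < y -> Z * M y + B * N y <= K) -> Z * Gamma q + B * L <= 0.
Proof.
move=> uK; rewrite leNgt; apply/negP; set e := (X in 0 < X) => e0.
have K'0 : 0 <= Num.max K 0 by rewrite le_max lexx orbT.
have {}uK y : 0 < y -> Z * M y + B * N y <= Num.max K 0.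
  by move=> /uK h; rewrite le_max h.
have bound := series_bound K'0 uK.
set C := Num.max K 0 * Gamma q in bound.
pose W (s : R) k := Z * Gamma q + B * (be k * s `^ (q - 1)).
have termE s k : 0 < s -> Z * m s k + B * n s k = b k * s `^ (- (q + k%:R)) * W s k.
  by move=> s0; rewrite mE nE// /W; ring.
have [D D0 hD] := be_bounded.
(* W s k is within e / 4 of e for large k, and within e / 2 once s is close to 1 *)
have [k0 hk0] : exists k0, forall k, (k0 <= k)%N -> `|B| * `|L - be k| <= e / 4.
  have e4 : 0 < e / (4 * (`|B| + 1)) by rewrite divr_gt0// mulr_gt0// ltr_wpDl.
  have /cvgrPdist_le/(_ _ e4)[k0 _ h] := cvg_be.
  exists k0 => k /h /= hk.
  rewrite (le_trans (ler_wpM2l _ hk))//.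
  rewrite (_ : e / (4 * (`|B| + 1)) = (e / 4) / (`|B| + 1)); last by rewrite invfM mulrA.
  rewrite mulrCA ler_piMr ?divr_ge0 ?(ltW e0)//.
  by rewrite ler_pdivrMr ?ltr_wpDl// mul1r lerDl.
have cpow (c : R) : t `^ c @[t --> (1 : R)^'+] --> (1 : R).
  have : {for 1, continuous (@powR R ^~ c)}.
    exact/is_derive_continuous/is_derive1_powR.
  by move=> /cvg_at_right_filter; rewrite powR1.
have near_s : \forall s \near (1 : R)^'+, forall k, (k0 <= k)%N -> e / 2 <= W s k.
  have e4 : 0 < e / (4 * (`|B| * D + 1)).
    by rewrite divr_gt0// mulr_gt0// ltr_wpDl// mulr_ge0// ltW.
  have /cvgrPdist_le/(_ _ e4) := cpow (q - 1).
  apply: filterS => s hs k /hk0 hk.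
  have E : W s k = e - B * (L - be k) - B * (be k * (1 - s `^ (q - 1))).
    by rewrite /W /e; ring.
  have h1 : B * (L - be k) <= e / 4 by rewrite (le_trans (ler_norm _))// normrM.
  have h2 : B * (be k * (1 - s `^ (q - 1))) <= e / 4.
    rewrite (le_trans (ler_norm _))// normrM (normrM (be k)) mulrA.
    have BD0 : 0 < `|B| * D + 1 by rewrite ltr_wpDl// mulr_ge0// ltW.
    rewrite (@le_trans _ _ (`|B| * D * (e / (4 * (`|B| * D + 1)))))//.
      by apply: ler_pM => //; exact: ler_wpM2l.
    rewrite (_ : e / (4 * (`|B| * D + 1)) = (e / 4) / (`|B| * D + 1)); last by rewrite invfM mulrA.
    rewrite mulrCA ler_piMr ?divr_ge0 ?(ltW e0)//.
    by rewrite ler_pdivrMr// mul1r lerDl.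
  by rewrite E; lra.
have partial j : (k0 <= j)%N -> \sum_(0 <= k < j) b k * W 1 k <= C.
  move=> kj.
  apply: (@cvgr_to_le _ ((1 : R)^'+) _ _ (fun s => \sum_(0 <= k < j) b k * s `^ (- (q + k%:R)) * W s k)).
    apply: cvgr_sum => k _.
    rewrite (_ : b k * W 1 k = b k * 1 * W 1 k); last by rewrite mulr1.
    apply: cvgM.
      by apply: cvgM; [exact: cvg_cst|exact: cpow].
    rewrite /W powR1; apply: cvgD; first exact: cvg_cst.
    by apply: cvgM; [exact: cvg_cst|apply: cvgM; [exact: cvg_cst|exact: cpow]].
  near=> s.
  have s1 : 1 < s by near: s; exact: nbhs_right_gt.
  have s0 : 0 < s by exact: lt_trans s1.
  have hW : forall k, (k0 <= k)%N -> e / 2 <= W s k by near: s.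
  apply: le_trans (bound s s1).
  under eq_bigr do rewrite -termE//.
  apply: limr_ge.
    have -> : (fun k => Z * m s k + B * n s k) = (Z *: m s + B *: n s) by exact/funext.
    by apply: is_cvg_seriesD; apply: is_cvg_seriesZ; [exact: cvg_m|exact: cvg_n].
  exists j => // i /= ji.
  rewrite /series/= (big_cat_nat _ ji)//= lerDl.
  rewrite big_nat_cond; apply: sumr_ge0 => k /andP[/andP[jk _] _].
  rewrite termE//; apply: mulr_ge0.
    by apply: mulr_ge0; [exact/ltW/b_gt0|exact: powR_ge0].
  by rewrite (le_trans _ (hW k (leq_trans kj jk)))// divr_ge0// ltW.
pose C' := \sum_(0 <= k < k0) b k * W 1 k.
apply: (@dvg_b (series b k0 + (C - C') / (e / 2))) => j.
have [jk|kj] := leqP j k0.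
  rewrite (@le_trans _ _ (series b k0))//.
    by apply: nondecreasing_series => // k _ _; exact/ltW/b_gt0.
  by rewrite lerDl divr_ge0 ?divr_ge0 ?(ltW e0)// subr_ge0 partial.
have h := partial j (ltnW kj).
rewrite (big_cat_nat _ (ltnW kj))//= -/C' in h.
rewrite /series/= (big_cat_nat _ (ltnW kj))//= lerD2l ler_pdivlMr ?divr_gt0//.
rewrite lerBrDl; apply: le_trans h.
rewrite lerD2l mulr_suml ler_sum_nat// => k /andP[kk _].
rewrite ler_wpM2l//; first exact/ltW/b_gt0.
rewrite (_ : W 1 k = e - B * (L - be k)); last by rewrite /W powR1 /e; ring.
have h1 : B * (L - be k) <= e / 4 by rewrite (le_trans (ler_norm _))// normrM hk0.
by move: e0 h1; lra.
Unshelve. all: by end_near. Qed.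

(** This replaces the asymptotics of the two series at infinity: instead of
    comparing their exponential growth, it compares the divergence of their
    Laplace transforms as the parameter decreases to [1]. *)
Lemma bounded_connection (Z B K : R) :
  (forall y, 0 < y -> `|Z * M y + B * N y| <= K) ->
  Z * Gamma q + B * (Gamma (2 - q) * Gamma p / Gamma (1 + p - q)) = 0.
Proof.
move=> uK; apply/eqP; rewrite eq_le; apply/andP; split.
  apply: (@coefficient_le0 _ _ K) => y /uK; exact/le_trans/ler_norm.
rewrite -oppr_le0 opprD -!mulNr.
apply: (@coefficient_le0 _ _ K) => y /uK; rewrite -normrN opprD -!mulNr.
exact/le_trans/ler_norm.
Qed.

End connection_coefficient.

(** * Lebesgue measure on tuples of reals *)

Section tuple_integral.
Context {R : realType}.
Local Notation leb := (@lebesgue_measure R).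
Local Notation mR := (measurableTypeR R).
Local Notation lebn n := (@lebesgue_tuple R n).
Local Open Scope ereal_scope.

Lemma measurable_fun_tuple d (T : measurableType d) n (f : T -> n.-tuple mR) :
  (forall i, measurable_fun setT (fun x => tnth (f x) i)) -> measurable_fun setT f.
Proof. by move=> mf; apply/measurable_fun_tnthP. Qed.

Let measurable_cons_section n (f : n.+1.-tuple mR -> \bar R) (x : mR) :
  measurable_fun setT f -> measurable_fun setT (fun t => f (cons_pair (x, t))).
Proof.
move=> mf; apply: (measurableT_comp mf).
apply: (measurableT_comp (@measurable_cons_pair R n)).
exact: measurable_pair1.
Qed.

Lemma ge0_integral_tupleS n (f : n.+1.-tuple mR -> \bar R) :
  measurable_fun setT f -> (forall t, 0 <= f t) ->
  \int[lebn n.+1]_t f t = \int[leb]_x \int[lebn n]_t f (cons_pair (x, t)).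
Proof.
move=> mf f0.
rewrite [LHS](@ge0_integral_pushforward _ _ _ _ _ _ (@measurable_cons_pair R n)
  (leb \x lebn n) setT)//.
have mfc : measurable_fun setT (f \o @cons_pair R n).
  exact: measurableT_comp mf (@measurable_cons_pair R n).
rewrite preimage_setT (@fubini_tonelli1 _ _ _ _ _ leb (lebn n) _ mfc)//.
by move=> z; exact: f0.
Qed.

Lemma ge0_integral_tupleS_swap n (f : n.+1.-tuple mR -> \bar R) :
  measurable_fun setT f -> (forall t, 0 <= f t) ->
  \int[lebn n.+1]_t f t = \int[lebn n]_t \int[leb]_x f (cons_pair (x, t)).
Proof.
move=> mf f0; rewrite ge0_integral_tupleS//.
have mfc : measurable_fun setT (f \o @cons_pair R n).
  exact: measurableT_comp mf (@measurable_cons_pair R n).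
by rewrite (@fubini_tonelli _ _ _ _ _ leb (lebn n) _ mfc)// => z; exact: f0.
Qed.

Lemma integral_tuple0 (f : 0.-tuple mR -> \bar R) : 
  measurable_fun setT f -> \int[lebn 0]_t f t = f [tuple].
Proof. by move=> mf; rewrite [LHS]integral_dirac// diracT mul1e. Qed.

Definition set_coord n (t : n.-tuple mR) (i : 'I_n) (x : mR) : n.-tuple mR :=
  [tuple if k == i then x else tnth t k | k < n].

Lemma tnth_set_coord n (t : n.-tuple mR) (i k : 'I_n) (x : mR) :
  tnth (set_coord t i x) k = if k == i then x else tnth t k.
Proof. by rewrite tnth_mktuple. Qed.

Lemma tnth_cons_pair0 n (x : mR) (t : n.-tuple mR) : tnth (cons_pair (x, t)) ord0 = x.
Proof. by []. Qed.

Lemma tnth_cons_pairS n (x : mR) (t : n.-tuple mR) (i : 'I_n) :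
  tnth (cons_pair (x, t)) (lift ord0 i) = tnth t i.
Proof. by rewrite [LHS](tnth_nth x) (tnth_nth x). Qed.

(** Equality of the integrals along one coordinate axis suffices; working with
    nonnegative functions spares any integrability condition on sections. *)
Lemma ge0_eq_integral_coord n (i : 'I_n) (f g : n.-tuple mR -> \bar R) :
  measurable_fun setT f -> measurable_fun setT g ->
  (forall t, 0 <= f t) -> (forall t, 0 <= g t) ->
  (forall t, \int[leb]_x f (set_coord t i x) = \int[leb]_x g (set_coord t i x)) ->
  \int[lebn n]_t f t = \int[lebn n]_t g t.
Proof.
elim: n i f g => [[]//|n ih] i f g mf mg f0 g0 fg.
case: (unliftP ord0 i) fg => [j ->|->] fg; last first.
  rewrite (ge0_integral_tupleS_swap mf f0) (ge0_integral_tupleS_swap mg g0); apply: eq_integral => t _.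
  have E x : cons_pair (x, t) = set_coord (cons_pair (0%R : mR, t)) ord0 x.
    apply: eq_from_tnth => k; rewrite tnth_set_coord.
    by case: (unliftP ord0 k) => [k' ->|->]; rewrite ?eqxx// !tnth_cons_pairS.
  under eq_integral do rewrite E.
  by under [RHS]eq_integral do rewrite E.
rewrite (ge0_integral_tupleS mf f0) (ge0_integral_tupleS mg g0); apply: eq_integral => x _.
apply: (ih j) => //; try exact: measurable_cons_section.
move=> t.
have E z : cons_pair (x, set_coord t j z) = set_coord (cons_pair (x, t)) (lift ord0 j) z.
  apply: eq_from_tnth => k; rewrite tnth_set_coord.
  case: (unliftP ord0 k) => [k' ->|->]; last by rewrite tnth_cons_pair0.
  by rewrite !tnth_cons_pairS tnth_set_coord (inj_eq lift_inj).
under eq_integral do rewrite E.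
by under [RHS]eq_integral do rewrite E.
Qed.

Definition affine_tuple n (a c : R) (t : n.-tuple mR) : n.-tuple mR :=
  [tuple (a * tnth t i + c)%R | i < n].

Lemma measurable_affine_tuple n a c : measurable_fun setT (@affine_tuple n a c).
Proof.
apply: measurable_fun_tuple => i; under eq_fun do rewrite tnth_mktuple.
apply: measurable_funD => //; apply: measurable_funM => //; exact: measurable_tnth.
Qed.

Lemma ge0_integral_affine_tuple n (a c : R) (f : n.-tuple mR -> \bar R) : (0 < a)%R ->
  measurable_fun setT f -> (forall t, 0 <= f t) ->
  \int[lebn n]_t f t = (a ^+ n)%:E * \int[lebn n]_t f (affine_tuple a c t).
Proof.
move=> a0; elim: n f => [|n ih] f mf f0.
  rewrite !integral_tuple0//; last exact: (measurableT_comp mf (@measurable_affine_tuple 0 a c)).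
  by rewrite expr0 mul1e; congr (f _); apply: eq_from_tnth => -[].
have mfa : measurable_fun setT (f \o @affine_tuple n.+1 a c).
  exact: (measurableT_comp mf (@measurable_affine_tuple n.+1 a c)).
rewrite !ge0_integral_tupleS//=.
have mF : measurable_fun setT (fun x => \int[lebn n]_t f (cons_pair (x, t))).
  apply: (@measurable_fun_fubini_tonelli_F _ _ _ _ _ (lebn n) (f \o @cons_pair R n)).
    exact: measurableT_comp mf (@measurable_cons_pair R n).
  by move=> z; exact: f0.
rewrite (@ge0_integral_affine R a c _ a0 mF); last by move=> x; exact: integral_ge0.
rewrite exprS EFinM -muleA; congr (_ * _).
rewrite -ge0_integralZl//; last 3 first.
- have := @measurable_fun_fubini_tonelli_F _ _ _ _ _ (lebn n) ((f \o @affine_tuple n.+1 a c) \o @cons_pair R n).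
  apply; last by move=> z; exact: f0.
  exact: measurableT_comp mfa (@measurable_cons_pair R n).
- by move=> x _; exact: integral_ge0.
- by rewrite lee_fin exprn_ge0// ltW.
apply: eq_integral => x _.
rewrite (ih (fun t => f (cons_pair ((a * x + c)%R, t))))//; last exact: measurable_cons_section.
congr (_ * _); apply: eq_integral => t _; congr f.
apply: eq_from_tnth => k; rewrite tnth_mktuple.
by case: (unliftP ord0 k) => [k' ->|->]; rewrite ?tnth_cons_pair0 ?tnth_cons_pairS ?tnth_mktuple.
Qed.

Lemma measurable_fun_prod_tnth n (g : mR -> R) : measurable_fun setT g ->
  measurable_fun setT (fun t : n.-tuple mR => \prod_(i < n) g (tnth t i))%R.
Proof.
move=> mg; apply: measurable_prod => i _.
by apply: measurableT_comp => //; exact: measurable_tnth.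
Qed.

Lemma ge0_integral_prod_tnth n (g : mR -> R) : measurable_fun setT g ->
  (forall x, 0 <= g x)%R -> (\int[leb]_x (g x)%:E < +oo) ->
  \int[lebn n]_t (\prod_(i < n) g (tnth t i))%R%:E < +oo.
Proof.
move=> mg g0 gy.
have gfin : \int[leb]_x (g x)%:E \is a fin_num.
  by rewrite ge0_fin_numE// integral_ge0// => x _; rewrite lee_fin.
have mp k : measurable_fun setT (fun t : k.-tuple mR => (\prod_(i < k) g (tnth t i))%R%:E).
  by apply/measurable_EFinP; exact: measurable_fun_prod_tnth.
elim: n => [|n ih].
  by rewrite (integral_tuple0 (mp 0%N)) big_ord0 ltry.
have p0 k (t : k.-tuple mR) : (0 <= \prod_(i < k) g (tnth t i))%R by exact: prodr_ge0.
rewrite (ge0_integral_tupleS (mp n.+1)); last by move=> t; rewrite lee_fin.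
under eq_integral => x _.
  under eq_integral => t _.
    rewrite big_ord_recl tnth_cons_pair0.
    under eq_bigr do rewrite tnth_cons_pairS.
    rewrite EFinM.
    over.
  rewrite ge0_integralZl//=; last 3 first.
  - exact: mp.
  - by move=> t _; rewrite lee_fin; exact: p0.
  - by rewrite lee_fin.
  over.
rewrite ge0_integralZr//=; last 3 first.
- exact/measurable_EFinP.
- by move=> x _; rewrite lee_fin.
- by apply: integral_ge0 => t _; rewrite lee_fin; exact: p0.
by rewrite lte_mul_pinfty// integral_ge0// => x _; rewrite lee_fin.
Qed.

End tuple_integral.

(** * The interaction and a common dominating function *)

Section measurable_auxiliary.
Context {R : realType} d (T : measurableType d).

Lemma measurable_sum_cond (I : eqType) (r : seq I) (P : pred I) (h : I -> T -> R) :
  (forall i, measurable_fun setT (h i)) ->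
  measurable_fun setT (fun t => \sum_(i <- r | P i) h i t).
Proof.
move=> mh; under eq_fun do rewrite -big_filter; exact: measurable_sum.
Qed.

Lemma measurable_prod_cond (I : eqType) (r : seq I) (P : pred I) (h : I -> T -> R) :
  (forall i, measurable_fun setT (h i)) ->
  measurable_fun setT (fun t => \prod_(i <- r | P i) h i t).
Proof.
by move=> mh; under eq_fun do rewrite -big_filter; apply: measurable_prod => i _.
Qed.

Lemma measurable_fun_inv (f : T -> R) : measurable_fun setT f ->
  measurable_fun setT (fun t => (f t)^-1).
Proof.
move=> mf; rewrite (_ : (fun _ => _) = fun t => f t * (f t ^+ 2) `^ (- 1)).
  apply: measurable_funM => //; apply: (measurableT_comp (measurable_powR (- 1))).
  exact: measurable_funX.
apply/funext => t; rewrite powR_inv1 ?sqr_ge0//.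
have [->|z] := eqVneq (f t) 0; first by rewrite invr0 mul0r.
by field.
Qed.

End measurable_auxiliary.

Section laguerre_weight.
Context {R : realType}.
Local Notation leb := (@lebesgue_measure R).
Local Notation mR := (measurableTypeR R).
Variables (n : nat) (s : R).
Hypotheses (s0 : 0 < s) (s1 : s < 1).
Local Notation lebn := (@lebesgue_tuple R n).
Implicit Types (t : n.-tuple mR) (e x y : R).

Definition orthant : set (n.-tuple mR) := [set t | forall i, 0 < tnth t i].

Lemma measurable_tnthR (i : 'I_n) : measurable_fun setT (fun t : n.-tuple mR => tnth t i : R).
Proof. exact: measurable_tnth. Qed.

Lemma measurable_orthant : measurable orthant.
Proof.
rewrite (_ : orthant = \bigcap_(i in [set: 'I_n]) ((fun t => tnth t i : R) @^-1` `]0, +oo[)).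
  apply: fin_bigcap_measurable => // i _.
  by rewrite -[X in measurable X]setTI; exact: measurable_tnthR.
apply/seteqP; split => t /=; first by move=> h i _ /=; rewrite in_itv/= andbT.
by move=> h i; have := h i I; rewrite /= in_itv/= andbT.
Qed.

(** The power [beta = 2 * s] of the Vandermonde determinant, for [e = 0]; a
    positive [e] removes the singularities of its logarithmic derivative. *)
Definition vandermonde_pow e t : R :=
  \prod_(i < n) \prod_(j < n | (i < j)%N)
     ((tnth t i - tnth t j) ^+ 2 + e) `^ s.

(** The interaction costs a factor [expR (4^-1 * t_i)] per point, and the decay of
    the weights is at least [expR (- (2^-1 * t_i))]; this is what remains. *)
Definition dominator t : R :=
  \prod_(i < n) (tnth t i `^ (- s) * expR (- (4^-1 * tnth t i))).

Lemma measurable_vandermonde_pow e : measurable_fun setT (vandermonde_pow e).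
Proof.
apply: measurable_prod => i _.
apply: measurable_prod_cond => j.
apply: (measurableT_comp (measurable_powR s)).
apply: measurable_funD => //; apply: measurable_funX.
by apply: measurable_funB; exact: measurable_tnthR.
Qed.

Lemma vandermonde_pow_ge0 e t : 0 <= vandermonde_pow e t.
Proof. by do 2 apply: prodr_ge0 => ? _; exact: powR_ge0. Qed.

Lemma dominator_ge0 t : 0 <= dominator t.
Proof. by apply: prodr_ge0 => i _; rewrite mulr_ge0 ?powR_ge0 ?expR_ge0. Qed.

Lemma measurable_dominator : measurable_fun setT dominator.
Proof.
apply: (@measurable_fun_prod_tnth R n (fun x => x `^ (- s) * expR (- (4^-1 * x)))).
apply: measurable_funM => //.
by do 2 apply: measurableT_comp => //.
Qed.

(** Every factor is at most a power of [1 + \sum_i t_i], which is polynomial in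
    the sum of the coordinates and hence dominated by its exponential. *)
Lemma vandermonde_pow_le : exists2 C : R, 0 < C &
  forall e t, 0 <= e <= 1 -> orthant t ->
  vandermonde_pow e t <= C * \prod_(i < n) expR (4^-1 * tnth t i).
Proof.
pose N := (2 * n * n)%N; pose c : R := 4 * N%:R + 1.
have N0 : 0 <= N%:R :> R by [].
have c1 : 1 <= c by rewrite lerDr mulr_ge0.
have c0 : 0 < c by exact: lt_le_trans c1.
exists (c ^+ N) => [|e t /andP[e0 e1] t0]; first exact: exprn_gt0.
pose S : R := \sum_(i < n) tnth t i.
have tS i : tnth t i <= S.
  by rewrite /S (bigD1 i)//= lerDl sumr_ge0// => j _; exact/ltW/t0.
have S0 : 0 <= S by apply: sumr_ge0 => j _; exact/ltW/t0.
have S1 : 1 <= (1 + S) ^+ 2 by rewrite exprn_ege1// lerDl.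
have pair i j : ((tnth t i - tnth t j) ^+ 2 + e) `^ s <= (1 + S) ^+ 2.
  have u : (tnth t i - tnth t j) ^+ 2 + e <= (1 + S) ^+ 2.
    have := tS i; have := tS j; have := ltW (t0 i); have := ltW (t0 j).
    move: e1; set a := tnth t i; set b := tnth t j => *.
    have : (a - b) ^+ 2 <= S ^+ 2.
      rewrite -[leLHS]real_normK ?num_real// lerXn2r ?nnegrE//.
      by rewrite ler_norml; apply/andP; split; lra.
    by rewrite !expr2; lra.
  have u0 : 0 <= (tnth t i - tnth t j) ^+ 2 + e by rewrite addr_ge0// sqr_ge0.
  rewrite (@le_trans _ _ (((1 + S) ^+ 2) `^ s))//.
    by apply: ge0_ler_powR; rewrite ?nnegrE ?(ltW s0)// (le_trans _ S1).
  by apply: ler1_powR => //; exact: ltW.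
have VS : vandermonde_pow e t <= (1 + S) ^+ N.
  rewrite /N -mulnA exprM -/(n * n)%N.
  rewrite (@le_trans _ _ (\prod_(i < n) ((1 + S) ^+ 2) ^+ n))//; last first.
    by rewrite prodr_const card_ord -exprM.
  apply: ler_prod => i _; apply/andP; split; first by apply: prodr_ge0 => j _; exact: powR_ge0.
  rewrite (@le_trans _ _ (\prod_(j < n | (i < j)%N) (1 + S) ^+ 2))//.
    by apply: ler_prod => j _; rewrite powR_ge0 pair.
  rewrite prodr_const ler_weXn2l//.
  by rewrite (leq_trans (max_card _))// card_ord.
apply: (le_trans VS).
rewrite (@le_trans _ _ ((c * expR (S / c)) ^+ N))//.
  by rewrite lerXn2r ?nnegrE ?addr_ge0 ?mulr_ge0 ?expR_ge0 ?(ltW c0)// addr1_le_expR.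
rewrite exprMn ler_wpM2l ?exprn_ge0 ?(ltW c0)// -expRM_natl -expR_sum ler_expR.
rewrite -mulr_sumr -/S mulrA mulrAC ler_wpM2r// ler_pdivrMr// /c; lra.
Qed.

Definition dominator1 (x : R) : R := x `^ (- s) * expR (- (4^-1 * x)).

Lemma measurable_dominator1 : measurable_fun setT dominator1.
Proof.
apply: measurable_funM => //.
by do 2 apply: measurableT_comp => //.
Qed.

Lemma dominator1_ge0 x : 0 <= dominator1 x.
Proof. by rewrite mulr_ge0 ?powR_ge0 ?expR_ge0. Qed.

Let mray : measurable (`]0%R, +oo[%classic : set mR).
Proof. by []. Qed.

Lemma integral_dominator1_lty :
  (\int[leb]_(x in `]0%R, +oo[) (dominator1 x)%:E < +oo)%E.
Proof.
have := @gamma_integral_scaled R (1 - s) 4^-1.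
rewrite addrAC subrr add0r => -> //; first exact: ltry.
by rewrite subr_gt0.
Qed.

Lemma integrable_dominator1 : leb.-integrable `]0%R, +oo[ (EFin \o dominator1).
Proof.
apply/integrableP; split.
  apply/measurable_EFinP; apply: (measurable_funS (E := setT)) => //.
  exact: measurable_dominator1.
rewrite (_ : (\int[_]_(x in _) _)%E = (\int[leb]_(x in `]0%R, +oo[) (dominator1 x)%:E)%E).
  exact: integral_dominator1_lty.
by apply: eq_integral => x _; rewrite /= ger0_norm// dominator1_ge0.
Qed.

Lemma integrable_dominator : lebn.-integrable orthant (EFin \o dominator).
Proof.
apply/integrableP; split.
  apply/measurable_EFinP; apply: (measurable_funS (E := setT)) => //.
  exact: measurable_dominator.
pose g : mR -> R := dominator1 \_ (`]0%R, +oo[%classic : set mR).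
have g0 x : 0 <= g x.
  by rewrite /g patchE; case: ifP => // _; exact: dominator1_ge0.
have mg : measurable_fun setT g.
  have m1 : measurable_fun (`]0%R, +oo[%classic : set mR) (dominator1 : mR -> R).
    by apply: (measurable_funS (E := setT)) => //; exact: measurable_dominator1.
  exact: ((measurable_restrictT _ mray).1 m1).
rewrite (_ : (\int[_]_(x in _) _)%E = (\int[lebn]_t (\prod_(i < n) g (tnth t i))%:E)%E).
  apply: ge0_integral_prod_tnth => //.
  rewrite (_ : (\int[_]_x _)%E = (\int[leb]_(x in `]0%R, +oo[) (dominator1 x)%:E)%E).
    exact: integral_dominator1_lty.
  rewrite [RHS]integral_mkcond; apply: eq_integral => x _.
  by rewrite /g !patchE; case: ifP.
rewrite [LHS]integral_mkcond; apply: eq_integral => t _; rewrite patchE.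
case: ifPn => [|/negP nt].
  rewrite inE => tpos; rewrite /= ger0_norm ?dominator_ge0//; congr EFin.
  apply: eq_bigr => i _; rewrite /g patchE ifT// inE/= in_itv/= andbT; exact: tpos.
have [i ti] : exists i, ~~ (0 < tnth t i).
  apply: contrapT => h; apply: nt; rewrite inE => i.
  by apply/negP => /negP h'; apply: h; exists i.
rewrite (bigD1 i)//= /g patchE ifF ?mul0r//.
by rewrite mem_setE in_itv/= andbT; exact: negbTE.
Qed.

Lemma le_dominator_integrable (f : n.-tuple mR -> R) (C : R) :
  measurable_fun setT f ->
  (forall t, orthant t -> `|f t| <= C * dominator t) ->
  lebn.-integrable orthant (EFin \o f).
Proof.
move=> mf fC.
apply: (le_integrable measurable_orthant _ _ (integrableZl measurable_orthant C integrable_dominator)).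
  by apply/measurable_EFinP; exact: (measurable_funS (E := setT)).
move=> t tpos /=; rewrite lee_fin (le_trans (fC t tpos))//.
exact: ler_norm.
Qed.

End laguerre_weight.

Section derive_product.
Context {R : realType}.

(** Products are differentiated through their logarithmic derivatives. *)
Lemma is_derive_prod (I : Type) (r : seq I) (P : pred I) (f : I -> R -> R)
    (l : I -> R) (x : R) :
  (forall i, P i -> is_derive x 1 (f i) (f i x * l i)) ->
  is_derive x 1 (fun y => \prod_(i <- r | P i) f i y)
    ((\prod_(i <- r | P i) f i x) * \sum_(i <- r | P i) l i).
Proof.
move=> df; elim: r => [|i r ih].
  rewrite !big_nil mulr0.
  by under eq_fun do rewrite big_nil; exact: is_derive_cst.
rewrite !big_cons; under eq_fun do rewrite big_cons.
case: ifPn => // Pi; have dfi := df i Pi.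
by apply: is_derive_eq; rewrite /GRing.scale/=; ring.
Qed.

End derive_product.

(** * The Laguerre weight and its derivatives in the shift *)

Section laguerre_integral.
Context {R : realType}.
Local Notation mR := (measurableTypeR R).
Variables (n : nat) (s : R).
Hypotheses (s0 : 0 < s) (s1 : s < 1).
Local Notation lebn := (@lebesgue_tuple R n).
Local Notation orth := (@orthant R n).
Local Notation dom := (@dominator R n s).
Implicit Types (t : n.-tuple mR) (e x y : R).

Definition laguerre_weight e y t : R :=
  (\prod_(i < n) ((y + tnth t i) `^ (- s) * expR (- tnth t i)))
  * vandermonde_pow s e t.

Lemma laguerre_weight_ge0 e y t : 0 <= laguerre_weight e y t.
Proof.
rewrite mulr_ge0 ?vandermonde_pow_ge0//.
by apply: prodr_ge0 => i _; rewrite mulr_ge0 ?powR_ge0 ?expR_ge0.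
Qed.

Lemma measurable_laguerre_weight e y : measurable_fun setT (laguerre_weight e y).
Proof.
apply: measurable_funM; last exact: measurable_vandermonde_pow.
apply: (@measurable_fun_prod_tnth R n (fun x => (y + x) `^ (- s) * expR (- x))).
apply: measurable_funM; last by do 2 apply: measurableT_comp => //.
by apply: (measurableT_comp (measurable_powR (- s))); exact: measurable_funD.
Qed.

Lemma laguerre_weight_le : exists2 C : R, 0 < C & forall e y t,
  0 <= e <= 1 -> 0 <= y -> orth t -> laguerre_weight e y t <= C * dom t.
Proof.
have [C C0 hC] := @vandermonde_pow_le R n s s0 s1.
exists C => // e y t e01 y0 tpos.
rewrite (le_trans (ler_wpM2l _ (hC e t e01 tpos)))//.
  by apply: prodr_ge0 => i _; rewrite mulr_ge0 ?powR_ge0 ?expR_ge0.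
rewrite mulrCA ler_wpM2l ?(ltW C0)// -big_split/=.
apply: ler_prod => i _; have ti := tpos i.
rewrite !mulr_ge0 ?powR_ge0 ?expR_ge0//= -mulrA -expRD.
rewrite ler_pM ?powR_ge0 ?expR_ge0//; last by rewrite ler_expR; move: ti; set x := tnth t i; lra.
rewrite !powRN lef_pV2 ?posrE ?powR_gt0 ?ltr_wpDl//.
by apply: ge0_ler_powR; rewrite ?nnegrE ?(ltW s0) ?(ltW ti) ?addr_ge0 ?lerDr// ltW.
Qed.

Definition invsum1 y t : R := \sum_(i < n) (y + tnth t i)^-1.
Definition invsum2 y t : R := \sum_(i < n) (y + tnth t i) ^- 2.

Lemma measurable_inv_tnth y (i : 'I_n) : measurable_fun setT (fun t => (y + tnth t i)^-1).
Proof.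
have m1 : measurable_fun setT (fun t => y + tnth t i : R).
  by apply: measurable_funD => //; exact: measurable_tnthR.
exact: measurable_fun_inv.
Qed.

Lemma measurable_invsum1 y : measurable_fun setT (invsum1 y).
Proof. by apply: measurable_sum => i; exact: measurable_inv_tnth. Qed.

Lemma measurable_invsum2 y : measurable_fun setT (invsum2 y).
Proof.
apply: measurable_sum => i.
rewrite (_ : (fun _ => _) = (fun t => (y + tnth t i)^-1 ^+ 2)).
  by apply: measurable_funX; exact: measurable_inv_tnth.
by apply/funext => t; rewrite exprVn.
Qed.

Lemma invsum1_bound y t : 0 < y -> orth t -> 0 <= invsum1 y t <= n%:R / y.
Proof.
move=> y0 tpos; have h i : 0 <= (y + tnth t i)^-1 <= y^-1.
  have ti := ltW (tpos i).
  by rewrite invr_ge0 addr_ge0 ?(ltW y0)//= lef_pV2 ?posrE ?ltr_wpDr// lerDl.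
apply/andP; split; first by apply: sumr_ge0 => i _; case/andP: (h i).
rewrite mulr_natl -[X in _ *+ X](card_ord n) -sumr_const ler_sum// => i _.
by case/andP: (h i).
Qed.

Lemma invsum2_bound y t : 0 < y -> orth t -> 0 <= invsum2 y t <= n%:R / y ^+ 2.
Proof.
move=> y0 tpos; have h i : 0 <= (y + tnth t i) ^- 2 <= y ^- 2.
  have ti := ltW (tpos i).
  rewrite invr_ge0 exprn_ge0 ?addr_ge0 ?(ltW y0)//= lef_pV2 ?posrE ?exprn_gt0 ?ltr_wpDr//.
  by rewrite lerXn2r ?nnegrE ?addr_ge0 ?(ltW y0)// lerDl.
apply/andP; split; first by apply: sumr_ge0 => i _; case/andP: (h i).
rewrite mulr_natl -[X in _ *+ X](card_ord n) -sumr_const ler_sum// => i _.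
by case/andP: (h i).
Qed.

Lemma is_derive_laguerre_weight e y t : 0 < y -> orth t ->
  is_derive y 1 (laguerre_weight e ^~ t) (- s * invsum1 y t * laguerre_weight e y t).
Proof.
move=> y0 tpos; rewrite /laguerre_weight.
have d : is_derive y 1 (fun y => \prod_(i < n) ((y + tnth t i) `^ (- s) * expR (- tnth t i)))
  ((\prod_(i < n) ((y + tnth t i) `^ (- s) * expR (- tnth t i))) *
   \sum_(i < n) (- s * (y + tnth t i)^-1)).
  apply: is_derive_prod => i _.
  have yi : 0 < y + tnth t i by rewrite ltr_wpDr// ltW.
  have dp : is_derive y 1 (fun y => (y + tnth t i) `^ (- s)) (- s * (y + tnth t i) `^ (- s - 1) * 1).
    apply: is_derive_powR_comp => //.
    by apply: is_derive_eq; rewrite addr0.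
  apply: is_derive_eq; rewrite /GRing.scale/= (gt0_powRD (- s) (-1) yi) powR_inv1 ?(ltW yi)//.
  by ring.
apply: is_derive_eq; rewrite /GRing.scale/= mulr0 add0r -mulr_sumr /invsum1.
by ring.
Qed.

Lemma is_derive_invsum1 y t : 0 < y -> orth t ->
  is_derive y 1 (invsum1 ^~ t) (- invsum2 y t).
Proof.
move=> y0 tpos; rewrite /invsum1 /invsum2 -sumrN.
rewrite (_ : (fun _ => _) = \sum_(i < n) (fun y => (y + tnth t i)^-1)); last first.
  by apply/funext => z; rewrite fct_sumE.
apply: is_derive_sum => i.
have yi : y + tnth t i != 0 by rewrite gt_eqF// ltr_wpDr// ltW.
by apply: is_derive_eq; rewrite addr0 /GRing.scale/= mulr1.
Qed.

(** Differentiation under the integral sign; the bound is asked for on a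
    neighborhood of [a] bounded away from [0], since the derivatives of the weight
    blow up at [0]. *)
Lemma is_derive_dominated (f f' : R -> n.-tuple mR -> R) (a K : R) : 0 < a ->
  (forall x, 0 < x -> lebn.-integrable orth (EFin \o f x)) ->
  (forall x t, 0 < x -> orth t -> is_derive x 1 (f ^~ t) (f' x t)) ->
  0 <= K ->
  (forall x t, a / 2 < x -> orth t -> `|f' x t| <= K * dom t) ->
  is_derive a 1 (fun x => \int[lebn]_(t in orth) f x t)%R
                (\int[lebn]_(t in orth) f' a t)%R.
Proof.
move=> a0 fi df K0' f'K.
have Ia : (`](a / 2), (a * 2)[%classic : set R) a.
  by rewrite /= in_itv/=; apply/andP; split; lra.
have I0 x : (`](a / 2), (a * 2)[%classic : set R) x -> 0 < x.
  by rewrite /= in_itv/= => /andP[+ _]; apply: lt_trans; lra.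
have d1E x t : 0 < x -> orth t -> partial1of2 f x t = f' x t.
  by move=> x0 tpos; rewrite partial1of2E; have [_ ->] := df x t x0 tpos.
have mO := @measurable_orthant R n.
pose G t := K * dom t.
have G0 t : 0 <= G t by rewrite mulr_ge0// dominator_ge0.
have intG : lebn.-integrable orth (EFin \o G).
  have := integrableZl mO K (@integrable_dominator R n s s1).
  exact.
have fi' x : (`](a / 2), (a * 2)[%classic : set R) x -> lebn.-integrable orth (EFin \o f x).
  by move=> /I0; exact: fi.
have df' x t : (`](a / 2), (a * 2)[%classic : set R) x -> orth t -> derivable (f ^~ t) x 1.
  by move=> /I0 x0 tpos; have [] := df x t x0 tpos.
have ub x t : (`](a / 2), (a * 2)[%classic : set R) x -> orth t -> `|partial1of2 f x t| <= G t.
  move=> Ix tpos; rewrite d1E//; last exact: I0.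
  by apply: f'K => //; move: Ix; rewrite /= in_itv/= => /andP[].
split; first exact: (derivable_under_integral mO Ia fi' df' G0 intG ub).
rewrite -derive1E (differentiation_under_integral mO Ia fi' df' G0 intG ub).
rewrite /Rintegral; congr fine; apply: eq_integral => t; rewrite inE => tpos.
by rewrite d1E.
Qed.

End laguerre_integral.

(** * The divergence of the weighted vector field *)

Section divergence.
Context {R : realType}.
Local Notation leb := (@lebesgue_measure R).
Local Notation mR := (measurableTypeR R).
Variables (n : nat) (s : R).
Hypotheses (s0 : 0 < s) (s1 : s < 1).
Local Notation lebn := (@lebesgue_tuple R n).
Local Notation orth := (@orthant R n).
Local Notation dom := (@dominator R n s).
Local Notation weight := (@laguerre_weight R n s).
Variables (e y : R) (k : 'I_n).
Hypotheses (e0 : 0 < e) (e1 : e <= 1) (y0 : 0 < y).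
Implicit Types (t : n.-tuple mR) (x : R).

Let mray : measurable (`]0%R, +oo[%classic : set mR).
Proof. by []. Qed.

Let d (i : 'I_n) : R := (i == k)%:R.

(** Logarithmic derivative of the regularized weight along the [k]-th axis. *)
Definition weight_logderiv t : R :=
  \sum_(i < n) (d i * (- s / (y + tnth t i) - 1)) +
  \sum_(i < n) \sum_(j < n | (i < j)%N)
     2 * s * (tnth t i - tnth t j) * (d i - d j) / ((tnth t i - tnth t j) ^+ 2 + e).

(** The factor [t_k / (y + t_k)] makes the field vanish on the face [t_k = 0]
    and produces the powers of [1 / (y + t_k)] in the derivatives of the weight
    with respect to [y]. *)
Definition flux t : R := tnth t k / (y + tnth t k) * weight e y t.

(** The derivative of the [k]-th component along the [k]-th axis. *)
Definition div_flux t : R := weight e y t *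
  (y / (y + tnth t k) ^+ 2 + tnth t k / (y + tnth t k) * weight_logderiv t).

Let others t := forall i, i != k -> 0 < tnth t i.

Let coord_gt0 t x i : others t -> - y < x -> 0 < y + tnth (set_coord t k x) i.
Proof.
move=> ot yx; rewrite tnth_set_coord; case: eqP => [_|/eqP /ot ti].
  by move: yx; lra.
exact: addr_gt0.
Qed.

Let is_derive_coord t i x : is_derive x 1 (fun x => tnth (set_coord t k x) i : R) (d i).
Proof.
rewrite /d; case: (eqVneq i k) => [->|ik].
  rewrite (_ : (fun _ => _) = id); first exact: is_derive_id.
  by apply/funext => z; rewrite tnth_set_coord eqxx.
rewrite (_ : (fun _ => _) = cst (tnth t i)); first exact: is_derive_cst.
by apply/funext => z; rewrite tnth_set_coord (negbTE ik).
Qed.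

Let is_derive_weight t x : others t -> - y < x ->
  is_derive x 1 (fun x => weight e y (set_coord t k x))
    (weight e y (set_coord t k x) * weight_logderiv (set_coord t k x)).
Proof.
move=> ot yx; set u := set_coord t k x; rewrite /laguerre_weight /vandermonde_pow.
have D1 : is_derive x 1
  (fun x => \prod_(i < n) ((y + tnth (set_coord t k x) i) `^ (- s) * expR (- tnth (set_coord t k x) i)))
  ((\prod_(i < n) ((y + tnth u i) `^ (- s) * expR (- tnth u i))) *
   \sum_(i < n) (d i * (- s / (y + tnth u i) - 1))).
  apply: is_derive_prod => i _.
  have yi : 0 < y + tnth u i by exact: coord_gt0.
  have dc := is_derive_coord t i x.
  have dp : is_derive x 1 (fun x => (y + tnth (set_coord t k x) i) `^ (- s))
      (- s * (y + tnth u i) `^ (- s - 1) * d i).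
    apply: is_derive_powR_comp => //.
    by have := is_deriveD (is_derive_cst y x 1) dc; rewrite add0r.
  have de : is_derive x 1 (fun x => expR (- tnth (set_coord t k x) i : R))
      (expR (- tnth u i) * (- d i)).
    have dn : is_derive x 1 (fun x => - (tnth (set_coord t k x) i : R)) (- d i).
      exact: is_deriveN.
    exact: (is_derive1_comp (is_derive_expR _) dn).
  apply: is_derive_eq; rewrite /GRing.scale/= -/u (gt0_powRD (- s) (-1) yi) powR_inv1 ?(ltW yi)//.
  by ring.
have D2 : is_derive x 1
  (fun x => \prod_(i < n) \prod_(j < n | (i < j)%N)
     ((tnth (set_coord t k x) i - tnth (set_coord t k x) j) ^+ 2 + e) `^ s)
  ((\prod_(i < n) \prod_(j < n | (i < j)%N) ((tnth u i - tnth u j) ^+ 2 + e) `^ s) *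
   \sum_(i < n) \sum_(j < n | (i < j)%N)
     2 * s * (tnth u i - tnth u j) * (d i - d j) / ((tnth u i - tnth u j) ^+ 2 + e)).
  apply: is_derive_prod => i _; apply: is_derive_prod => j _.
  have dci := is_derive_coord t i x; have dcj := is_derive_coord t j x.
  have ue : 0 < (tnth u i - tnth u j) ^+ 2 + e by rewrite ltr_wpDl// sqr_ge0.
  have db : is_derive x 1
      (fun x => (tnth (set_coord t k x) i - tnth (set_coord t k x) j : R) ^+ 2 + e)
      (2 * (tnth u i - tnth u j) * (d i - d j)).
    apply: is_derive_eq; rewrite /GRing.scale/= -/u addr0.
    by ring.
  have dq : is_derive x 1
      (fun x => ((tnth (set_coord t k x) i - tnth (set_coord t k x) j : R) ^+ 2 + e) `^ s)
      (s * ((tnth u i - tnth u j) ^+ 2 + e) `^ (s - 1) * (2 * (tnth u i - tnth u j) * (d i - d j))).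
    exact: is_derive_powR_comp.
  rewrite [X in is_derive _ _ _ X](_ : _ =
      s * ((tnth u i - tnth u j) ^+ 2 + e) `^ (s - 1) * (2 * (tnth u i - tnth u j) * (d i - d j))) //.
  rewrite (gt0_powRD s (-1) ue) powR_inv1 ?(ltW ue)//.
  by rewrite -/u; ring.
apply: is_derive_eq; rewrite /GRing.scale/= -/u /weight_logderiv.
by ring.
Qed.

Let is_derive_flux t x : others t -> - y < x ->
  is_derive x 1 (fun x => flux (set_coord t k x)) (div_flux (set_coord t k x)).
Proof.
move=> ot yx; have dw := is_derive_weight ot yx.
have yx0 : y + x != 0 by rewrite gt_eqF//; move: yx; lra.
have E z : flux (set_coord t k z) = z / (y + z) * weight e y (set_coord t k z).
  by rewrite /flux tnth_set_coord eqxx.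
under eq_fun do rewrite E.
apply: is_derive_eq; rewrite /GRing.scale/= /div_flux tnth_set_coord eqxx.
by field.
Qed.

Let continuous_coord t i x : {for x, continuous (fun x => tnth (set_coord t k x) i : R)}.
Proof. exact: is_derive_continuous (is_derive_coord t i x). Qed.

Let continuous_div_flux t x : others t -> - y < x ->
  {for x, continuous (fun x => div_flux (set_coord t k x))}.
Proof.
move=> ot yx.
have yi i : y + tnth (set_coord t k x) i != 0 by rewrite gt_eqF// coord_gt0.
have cyi i : {for x, continuous (fun x => y + tnth (set_coord t k x) i : R)}.
  by apply: continuousD; [exact: cst_continuous|exact: continuous_coord].
have ciV i : {for x, continuous (fun x => (y + tnth (set_coord t k x) i)^-1 : R)}.
  by apply: continuousV => //; exact: yi.
apply: continuousM; first exact: is_derive_continuous (is_derive_weight ot yx).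
apply: continuousD.
  apply: continuousM; first exact: cst_continuous.
  by apply: continuousV; [rewrite expf_neq0// yi|exact: continuousM].
apply: continuousM; first by apply: continuousM => //; exact: continuous_coord.
apply: continuousD; apply: cvgr_sum => i _.
  apply: cvgM; first exact: cvg_cst.
  by apply: cvgB; [apply: cvgM => //; [exact: cvg_cst|exact: ciV]|exact: cvg_cst].
apply: cvgr_sum => j _.
have cij : {for x, continuous (fun x => tnth (set_coord t k x) i - tnth (set_coord t k x) j : R)}.
  by apply: continuousB; exact: continuous_coord.
apply: cvgM.
  by apply: cvgM; [apply: cvgM => //; exact: cvg_cst|exact: cvg_cst].
apply: cvgV; first by rewrite gt_eqF// ltr_wpDl// sqr_ge0.
by apply: cvgD; [exact: cvgM|exact: cvg_cst].
Qed.

Let flux_ge0 t : orth t -> 0 <= flux t.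
Proof.
move=> tpos; have tk := tpos k.
by rewrite /flux mulr_ge0 ?laguerre_weight_ge0// divr_ge0 ?(ltW tk)// addr_ge0 ?ltW.
Qed.

Let flux_le t : orth t -> flux t <= weight e y t.
Proof.
move=> tpos; have tk := tpos k; have ytk : 0 < y + tnth t k by exact: addr_gt0.
rewrite /flux ler_piMl ?laguerre_weight_ge0// ler_pdivrMr// mul1r.
by move: y0; lra.
Qed.

Let weight_logderiv_bounded : exists2 B : R, 0 <= B &
  forall t, orth t -> `|weight_logderiv t| <= B.
Proof.
have b1 : 0 <= s / y + 1 by rewrite addr_ge0// divr_ge0// ltW.
have b2 : 0 <= 4 * s * (e^-1 + 1).
  by rewrite !mulr_ge0 ?addr_ge0 ?invr_ge0 ?(ltW s0) ?(ltW e0).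
exists (\sum_(i < n) (s / y + 1) + \sum_(i < n) \sum_(j < n | (i < j)%N) 4 * s * (e^-1 + 1)).
  by rewrite addr_ge0// sumr_ge0// => i _; rewrite sumr_ge0.
have dle i : 0 <= d i <= 1 by rewrite /d; case: eqP; rewrite ?lexx ?ler01.
move=> t tpos; rewrite (le_trans (ler_normD _ _))// lerD//.
  rewrite (le_trans (ler_norm_sum _ _ _))// ler_sum// => i _.
  have ti := tpos i; have yti : 0 < y + tnth t i by exact: addr_gt0.
  have /andP[di0 di1] := dle i.
  rewrite normrM (ger0_norm di0) -[leRHS]mul1r; apply: ler_pM => //.
  rewrite (_ : - s / (y + tnth t i) - 1 = - (s / (y + tnth t i) + 1)); last by ring.
  rewrite normrN ger0_norm ?addr_ge0 ?divr_ge0 ?(ltW s0) ?(ltW yti)//.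
  by rewrite lerD2r ler_wpM2l ?(ltW s0)// lef_pV2 ?posrE// lerDl ltW.
rewrite (le_trans (ler_norm_sum _ _ _))// ler_sum// => i _.
rewrite (le_trans (ler_norm_sum _ _ _))// ler_sum// => j _.
set u := tnth t i - tnth t j.
have ue : 0 < u ^+ 2 + e by rewrite ltr_wpDl// sqr_ge0.
rewrite normrM normfV (gtr0_norm ue) ler_pdivrMr//.
rewrite !normrM (gtr0_norm s0) ger0_norm//.
have dd : `|d i - d j| <= 1.
  by rewrite ler_norml; case/andP: (dle i) => + +; case/andP: (dle j); lra.
have uu : `|u| <= (e^-1 + 1) * (u ^+ 2 + e).
  rewrite mulrDl mul1r mulrDr mulVf ?gt_eqF//.
  have h1 : 0 <= e^-1 * u ^+ 2 by rewrite mulr_ge0 ?sqr_ge0// invr_ge0 ltW.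
  have h2 : `|u| <= 1 + u ^+ 2.
    by have := sqr_ge0 (`|u| - 1); rewrite -(real_normK (num_real u)); move: `|u| => v; nra.
  by move: h1 h2 e0; lra.
rewrite -!mulrA.
rewrite (@le_trans _ _ (2 * (s * (`|u| * 1))))//.
  by rewrite ler_wpM2l// ler_wpM2l ?(ltW s0)// ler_wpM2l.
rewrite mulr1 (_ : 4 * _ = 2 * (s * (2 * ((e^-1 + 1) * (u ^+ 2 + e))))); last by ring.
rewrite ler_wpM2l// ler_wpM2l ?(ltW s0)//.
by have := normr_ge0 u; move: uu; lra.
Qed.

Lemma div_flux_bounded : exists C : R, forall t, orth t -> `|div_flux t| <= C * dom t.
Proof.
have [C C0 hC] := @laguerre_weight_le R n s s0 s1.
have [B B0 hB] := weight_logderiv_bounded.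
exists (C * (y^-1 + B)) => t tpos.
have tk := tpos k; have ytk : 0 < y + tnth t k by exact: addr_gt0.
have e01 : 0 <= e <= 1 by rewrite (ltW e0) e1.
rewrite /div_flux normrM ger0_norm ?laguerre_weight_ge0// [leRHS]mulrAC.
apply: ler_pM; rewrite ?laguerre_weight_ge0//; first exact: hC _ _ _ e01 (ltW y0) tpos.
rewrite (le_trans (ler_normD _ _))// lerD//.
  rewrite ger0_norm ?divr_ge0 ?exprn_ge0 ?(ltW y0) ?(ltW ytk)//.
  rewrite ler_pdivrMr ?exprn_gt0// ler_pdivlMl// -expr2 lerXn2r ?nnegrE ?(ltW y0) ?(ltW ytk)//.
  by rewrite lerDl ltW.
rewrite normrM ger0_norm ?divr_ge0 ?(ltW tk) ?(ltW ytk)//.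
rewrite -[leRHS]mul1r ler_pM// ?divr_ge0 ?(ltW tk) ?(ltW ytk) ?hB//.
by rewrite ler_pdivrMr// mul1r lerDr ltW.
Qed.

Let measurable_coord t : measurable_fun setT (fun x : mR => set_coord t k x).
Proof.
apply: measurable_fun_tuple => i.
rewrite (_ : (fun _ => _) = if i == k then id else cst (tnth t i)).
  by case: ifP.
by apply/funext => x; rewrite tnth_set_coord; case: ifP.
Qed.

Lemma measurable_div_flux : measurable_fun setT div_flux.
Proof.
have mi i : measurable_fun setT (fun t => tnth t i : R) by exact: measurable_tnthR.
have mV := @measurable_inv_tnth R n y.
apply: measurable_funM; first exact: measurable_laguerre_weight.
apply: measurable_funD.
  apply: measurable_funM => //; apply: measurable_fun_inv; apply: measurable_funX.
  exact: measurable_funD.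
apply: measurable_funM; first exact: measurable_funM.
apply: measurable_funD; apply: measurable_sum => i.
  apply: measurable_funM => //; apply: measurable_funB => //.
  exact: measurable_funM.
apply: measurable_sum_cond => j.
have mij : measurable_fun setT (fun t => tnth t i - tnth t j : R) by exact: measurable_funB.
apply: measurable_funM; first by apply: measurable_funM => //; exact: measurable_funM.
apply: measurable_fun_inv; apply: measurable_funD => //; exact: measurable_funX.
Qed.

Let dominator_coord t x :
  dom (set_coord t k x) = dominator1 s x * \prod_(i < n | i != k) dominator1 s (tnth t i).
Proof.
rewrite /dominator (bigD1 k)//= tnth_set_coord eqxx; congr (_ * _).
by apply: eq_bigr => i ik; rewrite tnth_set_coord (negbTE ik).
Qed.

Let orth_coord t x : others t -> 0 < x -> orth (set_coord t k x).
Proof. by move=> ot x0 i; rewrite tnth_set_coord; case: eqP => // /eqP /ot. Qed.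

Let integrable_div_flux_coord t : others t ->
  leb.-integrable `]0%R, +oo[ (fun x => (div_flux (set_coord t k x))%:E).
Proof.
move=> ot; have [C hC] := div_flux_bounded.
pose p := \prod_(i < n | i != k) dominator1 s (tnth t i).
apply: (le_integrable mray _ _ (integrableZl mray (C * p) (@integrable_dominator1 R s s1))).
  apply/measurable_EFinP; apply: (measurable_funS (E := setT)) => //.
  exact: (measurableT_comp measurable_div_flux (measurable_coord t)).
move=> x /=; rewrite in_itv/= andbT => x0; rewrite lee_fin.
rewrite (le_trans (hC _ (orth_coord ot x0)))// dominator_coord -/p.
rewrite (_ : C * _ = C * p * dominator1 s x); last by ring.
exact: ler_norm.
Qed.

Let integral_div_flux_coord t : others t ->
  (\int[leb]_(x in `]0%R, +oo[) (div_flux (set_coord t k x))%:E = 0)%E.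
Proof.
move=> ot; have [C C0 hC] := @laguerre_weight_le R n s s0 s1.
have e01 : 0 <= e <= 1 by rewrite (ltW e0) e1.
pose p := \prod_(i < n | i != k) dominator1 s (tnth t i).
have p0 : 0 <= p by apply: prodr_ge0 => i _; exact: dominator1_ge0.
have := @FTC_ray R (fun x => div_flux (set_coord t k x)) (fun x => flux (set_coord t k x)) 0 0 0.
rewrite subrr; apply.
- by move=> x x0; apply: is_derive_flux => //; move: y0 x0; lra.
- by move=> x x0; apply: continuous_div_flux => //; move: y0 x0; lra.
- have c0 : {for 0, continuous (fun x => flux (set_coord t k x))}.
    apply: (is_derive_continuous (is_derive_flux ot _)); by rewrite oppr_lt0.
  have := cvg_at_right_filter c0.
  by rewrite {2}/flux tnth_set_coord eqxx !mul0r.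
- apply: (@squeeze_cvgr _ _ _ _ (fun=> 0) (fun x => C * p * expR (- (4^-1 * x)))).
  + near=> x; have x1 : 1 <= x by near: x; exact: nbhs_pinfty_ge.
    have x0 : 0 < x by exact: lt_le_trans x1.
    have xpos := orth_coord ot x0.
    rewrite flux_ge0//= (le_trans (flux_le xpos))//.
    rewrite (le_trans (hC _ _ _ e01 (ltW y0) xpos))// dominator_coord -/p.
    rewrite (_ : C * _ = C * p * dominator1 s x); last by ring.
    rewrite ler_wpM2l ?mulr_ge0 ?(ltW C0)// /dominator1 ler_piMl ?expR_ge0//.
    rewrite powRN invf_le1 ?powR_gt0//.
    by rewrite -(powRr0 x) ler_powR// ltW.
  + exact: cvg_cst.
  + rewrite -(mulr0 (C * p)); apply: cvgM; first exact: cvg_cst.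
    apply: (@cvg_comp _ _ _ (fun x : R => 4^-1 * x) (fun x => expR (- x))); last exact: cvgr_expR.
    by apply/cvgryPge => A; near=> x; rewrite ler_pdivlMl//; near: x; exact: nbhs_pinfty_ge.
- exact: integrable_div_flux_coord.
Unshelve. all: by end_near. Qed.

(** The flux vanishes at both ends of each ray parallel to the [k]-th axis, so
    its derivative integrates to [0] on that ray.  Hence the positive and negative
    parts of the divergence have the same integral on every such ray, and so on
    the orthant. *)
Lemma integral_div_flux : (\int[lebn]_(t in orth) (div_flux t)%:E = 0)%E.
Proof.
pose F : n.-tuple mR -> \bar R := (fun t => (div_flux t)%:E) \_ orth.
have mO := @measurable_orthant R n.
have mF : measurable_fun setT F.
  have m1 : measurable_fun orth (fun t => (div_flux t)%:E).
    apply/measurable_EFinP; apply: (measurable_funS (E := setT)) => //.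
    exact: measurable_div_flux.
  exact: ((measurable_restrictT _ mO).1 m1).
have Fi : lebn.-integrable setT F.
  have [C hC] := div_flux_bounded.
  apply/(integrable_mkcond _ mO).1.
  exact: (le_dominator_integrable s1 measurable_div_flux hC).
rewrite integral_mkcond -/F integralE.
rewrite (@ge0_eq_integral_coord R n k F^\+ F^\-)%E; first last.
- move=> t.
  have [ot|not] := pselect (others t); last first.
    have F0 x : F (set_coord t k x) = 0%E.
      rewrite /F patchE ifF//; apply/negP; rewrite inE => h; apply: not => i ik.
      by have := h i; rewrite tnth_set_coord (negbTE ik).
    by rewrite !integral0_eq// => x _; rewrite ?funeposE ?funenegE F0 ?oppe0 maxxx.
  pose f : mR -> \bar R := (fun x => (div_flux (set_coord t k x))%:E) \_ `]0%R, +oo[.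
  have FE x : F (set_coord t k x) = f x.
    rewrite /F /f !patchE mem_setE in_itv/= andbT; congr (if _ then _ else _).
    apply/idP/idP; rewrite ?inE; last exact: orth_coord.
    by move=> h; have := h k; rewrite tnth_set_coord eqxx.
  have fi : leb.-integrable setT f.
    exact: ((integrable_mkcond _ mray).1 (integrable_div_flux_coord ot)).
  have f0 : (\int[leb]_x f x = 0)%E.
    by rewrite /f -integral_mkcond integral_div_flux_coord.
  rewrite (eq_integral f^\+%E); last by move=> x _; rewrite !funeposE FE.
  rewrite [RHS](eq_integral f^\-%E); last by move=> x _; rewrite !funenegE FE.
  rewrite [LHS]integralE in f0; move: f0 => /eqP.
  have fpos := integrable_fin_num measurableT (integrable_funepos measurableT fi).
  have fneg := integrable_fin_num measurableT (integrable_funeneg measurableT fi).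
  by rewrite -(fineK fpos) -(fineK fneg) -EFinB eqe subr_eq0 => /eqP ->.
- by move=> t; exact: funeneg_ge0.
- by move=> t; exact: funepos_ge0.
- exact: measurable_funeneg.
- exact: measurable_funepos.
by rewrite subee// (integrable_fin_num measurableT (integrable_funeneg measurableT Fi)).
Qed.

End divergence.

(** * Kummer's equation for the shifted Laguerre integral *)

Section pair_sums.
Context {R : realType}.

Lemma sqr_sum_pairs n (a : 'I_n -> R) :
  (\sum_(i < n) a i) ^+ 2 =
  \sum_(i < n) a i ^+ 2 + 2 * \sum_(i < n) \sum_(j < n | (i < j)%N) a i * a j.
Proof.
rewrite expr2 mulr_suml.
under eq_bigr => i _.
  rewrite mulr_sumr (bigID (fun j : 'I_n => (i < j)%N))/= [X in _ + X](bigD1 i)/= ?ltnn//.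
  rewrite addrCA -expr2; over.
rewrite big_split/=; congr (_ + _); rewrite big_split/= mulr_natl mulr2n; congr (_ + _).
rewrite (exchange_big_dep xpredT)//=; apply: eq_bigr => i _.
apply: eq_big => [j|j _]; last by rewrite mulrC.
by rewrite -leqNgt andbC ltn_neqAle.
Qed.

Lemma sum_indicator n (a : 'I_n -> R) (i : 'I_n) :
  \sum_(k < n) a k * (i == k)%:R = a i.
Proof.
rewrite (bigD1 i)//= eqxx mulr1 big1 ?addr0// => k ki.
by rewrite eq_sym (negbTE ki) mulr0.
Qed.

End pair_sums.

Section laguerre_kummer.
Context {R : realType}.
Local Notation mR := (measurableTypeR R).
Variables (n : nat) (s : R).
Hypotheses (s0 : 0 < s) (s1 : s < 1).
Local Notation lebn := (@lebesgue_tuple R n).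
Local Notation orth := (@orthant R n).
Local Notation dom := (@dominator R n s).
Local Notation weight := (@laguerre_weight R n s).
Local Notation S1 := (@invsum1 R n).
Local Notation S2 := (@invsum2 R n).
Implicit Types (t : n.-tuple mR) (e x y : R).

Let mO := @measurable_orthant R n.

(** The divergence of the whole field divided by the weight.  The pair [i], [j]
    contributes its singular term [1 / (t_i - t_j)] with the factor
    [t_i / (y + t_i) - t_j / (y + t_j) = y * (t_i - t_j) / ((y + t_i) * (y + t_j))],
    which cancels the singularity. *)
Let total e y t : R := (1 + s) * y * S2 y t + (y - s) * S1 y t - n%:R +
  2 * s * \sum_(i < n) \sum_(j < n | (i < j)%N)
    (y / ((y + tnth t i) * (y + tnth t j)) *
     ((tnth t i - tnth t j) ^+ 2 / ((tnth t i - tnth t j) ^+ 2 + e))).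

Let sum_div_flux e y t : 0 < e -> 0 < y -> orth t ->
  \sum_(k < n) div_flux s e y k t = weight e y t * total e y t.
Proof.
move=> e0 y0 tpos; rewrite /div_flux -mulr_sumr; congr (_ * _).
have yt i : y + tnth t i != 0 by rewrite gt_eqF// addr_gt0// tpos.
pose phi (k : 'I_n) := tnth t k / (y + tnth t k) : R.
rewrite big_split/=.
under [X in _ + X]eq_bigr do rewrite /weight_logderiv mulrDr -/(phi _).
rewrite big_split/=.
have -> : \sum_(k < n) phi k * \sum_(i < n) (i == k)%:R * (- s / (y + tnth t i) - 1) =
    \sum_(i < n) (phi i * (- s / (y + tnth t i) - 1)).
  under eq_bigr do rewrite mulr_sumr.
  rewrite exchange_big/=; apply: eq_bigr => i _.
  under eq_bigr do rewrite mulrA.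
  by rewrite -mulr_suml sum_indicator.
have -> : \sum_(k < n) phi k * \sum_(i < n) \sum_(j < n | (i < j)%N)
     2 * s * (tnth t i - tnth t j) * ((i == k)%:R - (j == k)%:R) / ((tnth t i - tnth t j) ^+ 2 + e)
  = 2 * s * \sum_(i < n) \sum_(j < n | (i < j)%N)
    (y / ((y + tnth t i) * (y + tnth t j)) *
     ((tnth t i - tnth t j) ^+ 2 / ((tnth t i - tnth t j) ^+ 2 + e))).
  under eq_bigr do rewrite mulr_sumr.
  rewrite exchange_big/= mulr_sumr; apply: eq_bigr => i _.
  under eq_bigr do rewrite mulr_sumr.
  rewrite exchange_big/= mulr_sumr; apply: eq_bigr => j _.
  set u := tnth t i - tnth t j.
  have ue : u ^+ 2 + e != 0 by rewrite gt_eqF// ltr_wpDl// sqr_ge0.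
  transitivity (2 * s * u / (u ^+ 2 + e) * (phi i - phi j)).
    rewrite -(sum_indicator phi i) -(sum_indicator phi j) -sumrB mulr_sumr.
    by apply: eq_bigr => k _; ring.
  by rewrite /phi /u; field; rewrite ue !yt.
rewrite addrA; congr (_ + _).
rewrite -big_split/= /invsum1 /invsum2 !mulr_sumr -big_split/=.
rewrite -[X in _ - X%:R](card_ord n) -sumr_const -sumrB; apply: eq_bigr => i _.
by rewrite /phi; field.
Qed.

Let measurable_pair_term e y i j : measurable_fun setT (fun t => (y / ((y + tnth t i) * (y + tnth t j)) *
     ((tnth t i - tnth t j) ^+ 2 / ((tnth t i - tnth t j) ^+ 2 + e)) : R)).
Proof.
have mi l : measurable_fun setT (fun t => tnth t l : R) by exact: measurable_tnthR.
have mu : measurable_fun setT (fun t => (tnth t i - tnth t j) ^+ 2 : R).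
  by apply: measurable_funX; exact: measurable_funB.
apply: measurable_funM; apply: measurable_funM => //; apply: measurable_fun_inv.
  by apply: measurable_funM; exact: measurable_funD.
exact: measurable_funD.
Qed.

Let measurable_total e y : measurable_fun setT (total e y).
Proof.
apply: measurable_funD; last first.
  apply: measurable_funM => //; apply: measurable_sum => i; apply: measurable_sum_cond => j.
  exact: measurable_pair_term.
apply: measurable_funB => //; apply: measurable_funD; apply: measurable_funM => //.
  exact: measurable_invsum2.
exact: measurable_invsum1.
Qed.

Let total_bounded y : 0 < y -> exists2 B : R, 0 <= B & forall e t, 0 < e -> orth t -> `|total e y t| <= B.
Proof.
move=> y0.
exists (`|(1 + s) * y| * (n%:R / y ^+ 2) + `|y - s| * (n%:R / y) + n%:R +
  `|2 * s| * \sum_(i < n) \sum_(j < n | (i < j)%N) y^-1).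
  have yV : 0 <= y^-1 by rewrite invr_ge0 ltW.
  have y2 : 0 <= y ^+ 2 by rewrite exprn_ge0// ltW.
  apply: addr_ge0; last first.
    by apply: mulr_ge0 => //; apply: sumr_ge0 => i _; exact: sumr_ge0.
  by rewrite !addr_ge0 ?mulr_ge0 ?invr_ge0 ?(ltW y0).
move=> e t e0 tpos; rewrite /total.
have /andP[a1 a2] := invsum1_bound y0 tpos; have /andP[b1 b2] := invsum2_bound y0 tpos.
rewrite (le_trans (ler_normD _ _))// lerD//.
  rewrite (le_trans (ler_normB _ _))// normr_nat lerD2r (le_trans (ler_normD _ _))// lerD//.
    by rewrite normrM ler_wpM2l// ger0_norm.
  by rewrite normrM ler_wpM2l// ger0_norm.
rewrite normrM ler_wpM2l//.
rewrite (le_trans (ler_norm_sum _ _ _))// ler_sum// => i _.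
rewrite (le_trans (ler_norm_sum _ _ _))// ler_sum// => j _.
have ti := tpos i; have tj := tpos j.
have yti : 0 < y + tnth t i by exact: addr_gt0.
have ytj : 0 < y + tnth t j by exact: addr_gt0.
set u := tnth t i - tnth t j.
have ue : 0 < u ^+ 2 + e by rewrite ltr_wpDl// sqr_ge0.
have f1 : 0 <= y / ((y + tnth t i) * (y + tnth t j)).
  by apply: divr_ge0; [exact: ltW|apply: mulr_ge0; exact: ltW].
have f2 : 0 <= u ^+ 2 / (u ^+ 2 + e) by apply: divr_ge0; [exact: sqr_ge0|exact: ltW].
rewrite ger0_norm; last exact: mulr_ge0.
rewrite -[leRHS]mulr1; apply: ler_pM => //.
- rewrite ler_pdivrMr ?mulr_gt0// ler_pdivlMl//.
  by rewrite ler_pM ?(ltW y0)// lerDl ltW.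
- by rewrite ler_pdivrMr// mul1r lerDl ltW.
Qed.

Let integral_total e y : 0 < e <= 1 -> 0 < y ->
  (\int[lebn]_(t in orth) (weight e y t * total e y t)%:E = 0)%E.
Proof.
move=> /andP[e0 e1] y0.
transitivity (\int[lebn]_(t in orth) \sum_(k < n) (div_flux s e y k t)%:E)%E.
  by apply: eq_integral => t; rewrite inE => tpos; rewrite sumEFin sum_div_flux.
rewrite integral_sum//=; last first.
  move=> k; have [C hC] := div_flux_bounded s0 s1 k e0 e1 y0.
  exact: (le_dominator_integrable s1 (measurable_div_flux s e y k) hC).
by rewrite big1// => k _; exact: integral_div_flux.
Qed.

Let eps (m : nat) : R := m.+1%:R^-1.

Let eps_gt0 m : 0 < eps m.
Proof. by rewrite invr_gt0. Qed.

Let eps_le1 m : eps m <= 1.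
Proof. by rewrite invf_le1// ler1n. Qed.

Let cvg_eps : eps m @[m --> \oo] --> (0 : R).
Proof. exact: cvg_harmonic. Qed.

Let cvg_vandermonde t : vandermonde_pow s (eps m) t @[m --> \oo] --> vandermonde_pow s 0 t.
Proof.
apply: cvgr_prod => i _; apply: cvgr_prod => j _.
set u := tnth t i - tnth t j.
have [->|u0] := eqVneq u 0.
  rewrite expr0n/= addr0 powR0 ?gt_eqF//.
  under eq_fun do rewrite add0r.
  by apply: ((cvg_at_rightP _ _ _).1 (powR_cvg0 s0)); split=> //; exact: cvg_eps.
have u2 : 0 < u ^+ 2 + 0 by rewrite addr0 exprn_even_gt0.
have : {for u ^+ 2 + 0, continuous (@powR R ^~ s)}.
  exact/is_derive_continuous/is_derive1_powR.
by apply: cvg_comp; apply: cvgD; [exact: cvg_cst|exact: cvg_eps].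
Qed.

Let cvg_weight y t : weight (eps m) y t @[m --> \oo] --> weight 0 y t.
Proof. by apply: cvgM; [exact: cvg_cst|exact: cvg_vandermonde]. Qed.

Let weight_eq0 y t (i j : 'I_n) : (i < j)%N -> tnth t i = tnth t j -> weight 0 y t = 0.
Proof.
move=> ij tij; have V0 : vandermonde_pow s 0 t = 0.
  rewrite /vandermonde_pow (bigD1 i)//= (bigD1 j)//=.
  by rewrite tij subrr expr0n/= addr0 powR0 ?gt_eqF// !mul0r.
by rewrite /laguerre_weight V0 mulr0.
Qed.

(** The limit of [total e] as [e] tends to [0]: the sum over pairs becomes half of
    the difference between the squared sum and the sum of squares. *)
Definition kummer_integrand y t : R := (1 + s) * y * S2 y t + (y - s) * S1 y t - n%:R +
  s * y * (S1 y t ^+ 2 - S2 y t).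

Let kummer_integrandE y t : orth t -> kummer_integrand y t = (1 + s) * y * S2 y t + (y - s) * S1 y t - n%:R +
  2 * s * \sum_(i < n) \sum_(j < n | (i < j)%N) (y / ((y + tnth t i) * (y + tnth t j))).
Proof.
move=> tpos; rewrite /kummer_integrand; congr (_ + _).
have -> : S2 y t = \sum_(i < n) (y + tnth t i)^-1 ^+ 2.
  by apply: eq_bigr => i _; rewrite exprVn.
rewrite /invsum1 sqr_sum_pairs addrAC subrr add0r.
have -> : \sum_(i < n) \sum_(j < n | (i < j)%N) y / ((y + tnth t i) * (y + tnth t j)) =
   y * \sum_(i < n) \sum_(j < n | (i < j)%N) (y + tnth t i)^-1 * (y + tnth t j)^-1.
  rewrite mulr_sumr; apply: eq_bigr => i _; rewrite mulr_sumr; apply: eq_bigr => j _.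
  by rewrite invfM.
by ring.
Qed.

Let cvg_total y t : 0 < y -> orth t ->
  weight (eps m) y t * total (eps m) y t @[m --> \oo] --> weight 0 y t * kummer_integrand y t.
Proof.
move=> y0 tpos; rewrite (kummer_integrandE _ tpos) mulrDr.
under eq_fun do rewrite /total mulrDr.
apply: cvgD; first by apply: cvgM; [exact: cvg_weight|exact: cvg_cst].
rewrite mulrCA; under eq_fun do rewrite mulrCA.
apply: cvgM; first exact: cvg_cst.
rewrite mulr_sumr; under eq_fun do rewrite mulr_sumr.
apply: cvgr_sum => i _.
rewrite mulr_sumr; under eq_fun do rewrite mulr_sumr.
apply: cvgr_sum => j ij.
have [tij|tij] := eqVneq (tnth t i) (tnth t j).
  rewrite (weight_eq0 y ij tij) mul0r.
  under eq_fun do rewrite tij subrr expr0n/= mul0r !mulr0.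
  exact: cvg_cst.
have u0 : tnth t i - tnth t j != 0 by rewrite subr_eq0.
apply: cvgM; first exact: cvg_weight.
set u := _ - _ in u0; have u2 : u ^+ 2 != 0 by rewrite expf_neq0.
have h : u ^+ 2 / (u ^+ 2 + eps m) @[m --> \oo] --> (1 : R).
  have -> : 1 = u ^+ 2 / (u ^+ 2 + 0) by rewrite addr0 divff.
  apply: cvgM; first exact: cvg_cst.
  by apply: cvgV; [rewrite addr0|apply: cvgD; [exact: cvg_cst|exact: cvg_eps]].
rewrite -[X in _ --> X]mulr1.
by apply: cvgM => //; exact: cvg_cst.
Qed.

Lemma integral_kummer_integrand y : 0 < y ->
  lebn.-integrable orth (fun t => (weight 0 y t * kummer_integrand y t)%:E) /\
  (\int[lebn]_(t in orth) (weight 0 y t * kummer_integrand y t)%:E = 0)%E.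
Proof.
move=> y0.
have [C C0 hC] := @laguerre_weight_le R n s s0 s1.
have [B B0 hB] := total_bounded y0.
have mf m : measurable_fun orth (fun t => (weight (eps m) y t * total (eps m) y t)%:E).
  apply/measurable_EFinP; apply: (measurable_funS (E := setT)) => //.
  by apply: measurable_funM => //; exact: measurable_laguerre_weight.
have mf0 : measurable_fun orth (fun t => (weight 0 y t * kummer_integrand y t)%:E).
  apply/measurable_EFinP; apply: (measurable_funS (E := setT)) => //.
  apply: measurable_funM; first exact: measurable_laguerre_weight.
  have mS1 := @measurable_invsum1 R n y; have mS2 := @measurable_invsum2 R n y.
  apply: measurable_funD.
    by apply: measurable_funB => //; apply: measurable_funD; exact: measurable_funM.
  by apply: measurable_funM => //; apply: measurable_funB => //; exact: measurable_funX.
have ig := integrableZl mO (C * B) (@integrable_dominator R n s s1).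
have [||fi _ lim] := dominated_convergence mO mf mf0 _ ig.
- apply: aeW => t tpos; apply: cvg_EFin; first exact: nearW.
  exact: cvg_total.
- apply: aeW => t m tpos; rewrite /= lee_fin normrM ger0_norm ?laguerre_weight_ge0//.
  rewrite [leRHS](_ : _ = C * dom t * B); last by ring.
  apply: ler_pM; rewrite ?laguerre_weight_ge0 ?normr_ge0//.
    by apply: hC => //; [rewrite ltW ?eps_gt0 ?eps_le1|exact: ltW].
  by apply: hB => //; exact: eps_gt0.
split => //; apply/esym; apply: (cvg_unique _ _ lim) => //.
rewrite (_ : (fun _ => _) = cst 0%E); first exact: cvg_cst.
by apply/funext => m; rewrite /= integral_total// eps_gt0 eps_le1.
Qed.

End laguerre_kummer.

Section laguerre_tail.
Context {R : realType}.
Local Notation mR := (measurableTypeR R).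
Variables (n : nat) (s : R).
Hypotheses (s0 : 0 < s) (s1 : s < 1).
Local Notation lebn := (@lebesgue_tuple R n).
Local Notation orth := (@orthant R n).
Local Notation dom := (@dominator R n s).
Local Notation weight := (@laguerre_weight R n s).
Local Notation S1 := (@invsum1 R n).
Local Notation S2 := (@invsum2 R n).
Implicit Types (t : n.-tuple mR) (x y : R).

Let mO := @measurable_orthant R n.

Let mw y : measurable_fun setT (weight 0 y). Proof. exact: measurable_laguerre_weight. Qed.
Let mS1 y : measurable_fun setT (S1 y). Proof. exact: measurable_invsum1. Qed.
Let mS2 y : measurable_fun setT (S2 y). Proof. exact: measurable_invsum2. Qed.

(** Up to normalization and the factor [expR (- (n * y))], the probability that
    all the points of the Laguerre ensemble exceed [y]. *)
Definition laguerre_integral y : R := \int[lebn]_(t in orth) weight 0 y t.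

Definition laguerre_integral' y : R :=
  \int[lebn]_(t in orth) (- s * S1 y t * weight 0 y t).

Let w2 y t : R := (s ^+ 2 * S1 y t ^+ 2 + s * S2 y t) * weight 0 y t.
Let laguerre_integral'' y : R := \int[lebn]_(t in orth) w2 y t.

Lemma laguerre_weight_integrable y : 0 <= y -> lebn.-integrable orth (EFin \o weight 0 y).
Proof.
move=> y0; have [C C0 hC] := @laguerre_weight_le R n s s0 s1.
apply: (le_dominator_integrable s1 (mw y) (C := C)) => t tpos.
by rewrite ger0_norm ?laguerre_weight_ge0// hC// lexx ler01.
Qed.

Let w1_bound a : 0 < a -> exists2 K : R, 0 <= K & forall x t, a / 2 < x -> orth t ->
  `|- s * S1 x t * weight 0 x t| <= K * dom t.
Proof.
move=> a0; have [C C0 hC] := @laguerre_weight_le R n s s0 s1.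
have a2 : 0 < a / 2 by rewrite divr_gt0.
exists (s * (n%:R / (a / 2)) * C).
  by rewrite !mulr_ge0 ?invr_ge0 ?(ltW s0) ?(ltW C0) ?(ltW a2).
move=> x t ax tpos; have x0 : 0 < x by exact: lt_trans ax.
have /andP[b1 b2] := invsum1_bound x0 tpos.
rewrite normrM [X in _ * X]ger0_norm ?laguerre_weight_ge0// -[leRHS]mulrA.
apply: ler_pM; rewrite ?laguerre_weight_ge0 ?normr_ge0//; last first.
  by apply: hC => //; [rewrite lexx ler01|exact: ltW].
rewrite normrM normrN (gtr0_norm s0) (ger0_norm b1) ler_wpM2l ?(ltW s0)//.
by rewrite (le_trans b2)// ler_wpM2l// lef_pV2 ?posrE// ltW.
Qed.

Let w2_bound a : 0 < a -> exists2 K : R, 0 <= K & forall x t, a / 2 < x -> orth t ->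
  `|w2 x t| <= K * dom t.
Proof.
move=> a0; have [C C0 hC] := @laguerre_weight_le R n s s0 s1.
have a2 : 0 < a / 2 by rewrite divr_gt0.
have aV : 0 <= n%:R / (a / 2) :> R by rewrite divr_ge0// ltW.
have aV2 : 0 <= n%:R / (a / 2) ^+ 2 :> R by rewrite divr_ge0// exprn_ge0// ltW.
exists ((s ^+ 2 * (n%:R / (a / 2)) ^+ 2 + s * (n%:R / (a / 2) ^+ 2)) * C).
  by rewrite mulr_ge0 ?(ltW C0)// addr_ge0// mulr_ge0 ?exprn_ge0 ?(ltW s0).
move=> x t ax tpos; have x0 : 0 < x by exact: lt_trans ax.
have /andP[b1 b2] := invsum1_bound x0 tpos; have /andP[c1 c2] := invsum2_bound x0 tpos.
rewrite /w2 normrM [X in _ * X]ger0_norm ?laguerre_weight_ge0// -[leRHS]mulrA.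
apply: ler_pM; rewrite ?laguerre_weight_ge0 ?normr_ge0//; last first.
  by apply: hC => //; [rewrite lexx ler01|exact: ltW].
rewrite ger0_norm ?addr_ge0 ?mulr_ge0 ?exprn_ge0 ?(ltW s0)//.
apply: lerD.
  rewrite ler_wpM2l ?exprn_ge0 ?(ltW s0)// lerXn2r ?nnegrE//.
  by rewrite (le_trans b2)// ler_wpM2l// lef_pV2 ?posrE// ltW.
rewrite ler_wpM2l ?(ltW s0)// (le_trans c2)// ler_wpM2l// lef_pV2 ?posrE ?exprn_gt0//.
by rewrite lerXn2r ?nnegrE ?(ltW a2) ?(ltW x0) ?(ltW ax).
Qed.

Let half_lt (x : R) : 0 < x -> x / 2 < x. Proof. by lra. Qed.

Let w1_integrable x : 0 < x ->
  lebn.-integrable orth (EFin \o (fun t => - s * S1 x t * weight 0 x t)).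
Proof.
move=> x0; have [K K0 hK] := w1_bound x0.
apply: (le_dominator_integrable s1 _ (fun t tpos => hK x t (half_lt x0) tpos)).
by apply: measurable_funM => //; exact: measurable_funM.
Qed.

Let w2_integrable x : 0 < x -> lebn.-integrable orth (EFin \o w2 x).
Proof.
move=> x0; have [K K0 hK] := w2_bound x0.
apply: (le_dominator_integrable s1 _ (fun t tpos => hK x t (half_lt x0) tpos)).
apply: measurable_funM => //; apply: measurable_funD; apply: measurable_funM => //.
exact: measurable_funX.
Qed.

Let is_derive_H y : 0 < y -> is_derive y 1 laguerre_integral (laguerre_integral' y).
Proof.
move=> y0; have [K K0 hK] := w1_bound y0.
apply: (is_derive_dominated s1 y0 _ _ K0 hK).
- by move=> x x0; exact/laguerre_weight_integrable/ltW.
- by move=> x t x0 tpos; exact: is_derive_laguerre_weight.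
Qed.

Let is_derive_H' y : 0 < y -> is_derive y 1 laguerre_integral' (laguerre_integral'' y).
Proof.
move=> y0; have [K K0 hK] := w2_bound y0.
apply: (is_derive_dominated s1 y0 _ _ K0 hK); first exact: w1_integrable.
move=> x t x0 tpos.
have d1 := is_derive_laguerre_weight s 0 x0 tpos.
have d2 := is_derive_invsum1 x0 tpos.
apply: is_derive_eq; rewrite /GRing.scale/= /w2.
by ring.
Qed.

Let kummer_ode y : 0 < y -> y * laguerre_integral'' y + (s - y) * laguerre_integral' y
  = n%:R * s * laguerre_integral y.
Proof.
move=> y0; have [fi f0] := integral_kummer_integrand n s0 s1 y0.
have wi := laguerre_weight_integrable (ltW y0).
have w1i := w1_integrable y0; have w2i := w2_integrable y0.
pose f1 t := y * w2 y t; pose f2 t := (s - y) * (- s * S1 y t * weight 0 y t).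
pose f3 t := n%:R * s * weight 0 y t.
have i1 : lebn.-integrable orth (EFin \o f1) := integrableZl mO y w2i.
have i2 : lebn.-integrable orth (EFin \o f2) := integrableZl mO (s - y) w1i.
have i3 : lebn.-integrable orth (EFin \o f3) := integrableZl mO (n%:R * s) wi.
have i12 : lebn.-integrable orth (EFin \o (fun t => f1 t + f2 t)) := integrableD mO i1 i2.
rewrite -(RintegralZl y mO w2i) -(RintegralZl (s - y) mO w1i) -(RintegralZl (n%:R * s) mO wi).
rewrite -/f1 -/f2 -/f3 -(RintegralD mO i1 i2).
apply/eqP; rewrite -subr_eq0 -(RintegralB mO i12 i3).
have -> : \int[lebn]_(t in orth) (f1 t + f2 t - f3 t) =
    \int[lebn]_(t in orth) (s * (weight 0 y t * kummer_integrand s y t)).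
  by apply: eq_Rintegral => t _; rewrite /f1 /f2 /f3 /w2 /kummer_integrand; ring.
by rewrite RintegralZl// /Rintegral f0 mulr0.
Qed.

(** Differentiating the weight twice in [y] multiplies it by
    [s ^+ 2 * S1 ^+ 2 + s * S2], so that the defect in Kummer's equation is the
    integral of [s] times [kummer_integrand]. *)
Lemma kummer_laguerre_integral :
  kummer_solution (n%:R * s) s laguerre_integral laguerre_integral'.
Proof.
move=> y y0; split; first exact: is_derive_H.
have d1 := is_derive_H' y0; have dp := is_derive1_powR s y0.
apply: is_derive_eq; rewrite /GRing.scale/=.
have -> : y `^ s = y * y `^ (s - 1) by rewrite mulr_powRB1// ltW.
set P0 := y `^ (s - 1); set E0 := expR (- y).
transitivity (P0 * E0 * (y * laguerre_integral'' y + (s - y) * laguerre_integral' y)).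
  by ring.
by rewrite kummer_ode//; ring.
Qed.

Lemma laguerre_integral_le y : 0 <= y -> 0 <= laguerre_integral y <= laguerre_integral 0.
Proof.
move=> y0; apply/andP; split.
  by apply: Rintegral_ge0 => t _; exact: laguerre_weight_ge0.
apply: le_Rintegral => //; [exact: laguerre_weight_integrable|exact: laguerre_weight_integrable|].
move=> t tpos; rewrite /laguerre_weight ler_wpM2r ?vandermonde_pow_ge0//.
apply: ler_prod => i _; have ti := tpos i.
rewrite mulr_ge0 ?powR_ge0 ?expR_ge0//= ler_wpM2r ?expR_ge0//.
rewrite add0r !powRN lef_pV2 ?posrE ?powR_gt0 ?ltr_wpDl//.
by apply: ge0_ler_powR; rewrite ?nnegrE ?(ltW s0) ?(ltW ti) ?addr_ge0 ?lerDr// ltW.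
Qed.

Lemma cvg_laguerre_integral0 : laguerre_integral y @[y --> 0^'+] --> laguerre_integral 0.
Proof.
apply/cvg_at_rightP => u [u0 cu].
have [C C0 hC] := @laguerre_weight_le R n s s0 s1.
have mf y : measurable_fun orth (EFin \o weight 0 y).
  by apply/measurable_EFinP; apply: (measurable_funS (E := setT)).
have ig := integrableZl mO C (@integrable_dominator R n s s1).
have [||fi _ lim] := dominated_convergence mO (fun m => mf (u m)) (mf 0) _ ig.
- apply: aeW => t tpos; apply: cvg_EFin; first exact: nearW.
  apply: cvgM; last exact: cvg_cst.
  apply: cvgr_prod => i _; apply: cvgM; last exact: cvg_cst.
  have ti : 0 < 0 + tnth t i by rewrite add0r; exact: tpos.
  have : {for 0 + (tnth t i : R), continuous (@powR R ^~ (- s))}.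
    exact/is_derive_continuous/is_derive1_powR.
  by apply: cvg_comp; apply: cvgD => //; exact: cvg_cst.
- apply: aeW => t m tpos; rewrite /= lee_fin ger0_norm ?laguerre_weight_ge0//.
  by apply: hC => //; [rewrite lexx ler01|exact/ltW/u0].
apply: fine_cvg; rewrite fineK//.
exact: integrable_fin_num.
Qed.

End laguerre_tail.

(** * The tail of the limit law and its derivative *)

Section contiguous.
Context {R : realType}.
Variables (n : nat) (s : R).
Hypotheses (s0 : 0 < s) (s1 : s < 1).
Local Notation p := (n%:R * s).
Local Notation c1 := (hcoef p s).
Local Notation c2 := (hcoef (1 + p - s) (2 - s)).

Let sk k : s + k%:R != 0. Proof. by rewrite gt_eqF// ltr_wpDr. Qed.
Let s1k k : s + 1 + k%:R != 0. Proof. by rewrite gt_eqF// ltr_wpDr// addr_gt0. Qed.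
Let k1 (k : nat) : k.+1%:R != 0 :> R. Proof. by rewrite pnatr_eq0. Qed.

(** Contiguous relations, proved by comparing coefficients.  Their right-hand
    sides are, up to constants and a power of [y], the two series in Tricomi's
    function with parameters [s * (n - 1)] and [- s]; their left-hand sides come
    from differentiating [expR (- (n * y))] times either series solution. *)
Lemma contiguous_first y : n%:R * psum c1 y - psum (pseries_diffs c1) y =
  n%:R * (n%:R - 1) / (1 + s) * (y * psum (hcoef (1 + p) (2 + s)) y).
Proof.
have e1 := @entire_hcoef R p s; have ed := entire_diffs e1.
have e2 := @entire_hcoef R (1 + p) (2 + s); have es := entire_shift e2.
have en := @entireZ _ n%:R _ e1; have edN := @entireZ _ (-1) _ ed.
rewrite -(mulN1r (psum (pseries_diffs c1) y)) -(psumZ _ _ e1) -(psumZ _ _ ed) -(psumD _ en edN).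
rewrite -(psum_shift _ e2) -(psumZ _ _ es); congr psum; apply/funext => -[|k].
  rewrite /pshift /pseries_diffs hcoefS hcoef0 !addr0.
  have s10 : 1 + s != 0 by rewrite gt_eqF// addr_gt0.
  have s00 : s != 0 by rewrite gt_eqF.
  by field; rewrite s00 s10.
rewrite /pshift /pseries_diffs (hcoefS _ _ k.+1).
have -> : c1 k.+1 = n%:R * ((s + 1 + k%:R) / ((s + 1) * k.+1%:R)) * hcoef (1 + p) (2 + s) k.
  rewrite /hcoef factS natrM.
  have -> : rising p k.+1 = p * rising (1 + p) k by rewrite rising_shift addrC.
  have E : rising s k.+1 * (s + 1 + k%:R) = s * (s + 1) * rising (2 + s) k.
    rewrite (_ : s + 1 + k%:R = s + k.+1%:R); last by rewrite -(natr1 k); ring.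
    rewrite -risingS rising_shift rising_shift mulrA; congr (_ * rising _ _); ring.
  have r1 := rising_gt0 k.+1 s0.
  have s20 : 0 < 2 + s by exact: addr_gt0.
  have r2 := rising_gt0 k s20.
  have F0 : k`!%:R != 0 :> R by rewrite pnatr_eq0 -lt0n fact_gt0.
  have -> : rising s k.+1 = s * (s + 1) * rising (2 + s) k / (s + 1 + k%:R).
    by rewrite -E mulfK.
  have s10 : s + 1 != 0 by rewrite gt_eqF// addr_gt0.
  by field; rewrite F0 s10 s1k nat1r k1 !gt_eqF.
have := s1k k; have := k1 k; have := k1 k.+1; have := sk k.+1.
rewrite -(natr1 k.+1) -(natr1 k) => h1 h2 h3 h4.
have s10 : s + 1 != 0 by rewrite gt_eqF// addr_gt0.
have s10' : 1 + s != 0 by rewrite addrC.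
by field; rewrite ?h1 ?h2 ?h3 ?h4 ?s10 ?s10'.
Qed.

Lemma contiguous_second y : 0 < y ->
  kummer_second_deriv p s y - n%:R * kummer_second p s y =
  (1 - s) * (y `^ (- s) * psum (hcoef (s * (n%:R - 1)) (- s)) y).
Proof.
move=> y0.
have e2 := @entire_hcoef R (1 + p - s) (2 - s); have es := entire_shift e2.
have e3 := @entire_hcoef R (s * (n%:R - 1)) (- s).
rewrite /kummer_second_deriv /kummer_second hyp1F1E.
rewrite (gt0_powRD 1 (- s) y0) powRr1 ?(ltW y0)//.
set P0 := y `^ (- s).
transitivity (P0 * (psum (fun k => (1 - s + k%:R) * c2 k) y - n%:R * (y * psum c2 y))).
  by ring.
rewrite [RHS]mulrCA; congr (_ * _).
have ed := entire_diffs es; have esN := @entireZ _ (- s) _ e2.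
have ek : entire (fun k => (1 - s + k%:R) * c2 k).
  rewrite (_ : (fun _ => _) = (fun k => pseries_diffs (pshift c2) k + (- s) * c2 k)).
    exact: (entireD ed esN).
  by apply/funext => k; rewrite /pseries_diffs /pshift -(natr1 k); ring.
have en := @entireZ _ (- n%:R) _ es.
rewrite -(mulNr n%:R) -(psum_shift _ e2) -(psumZ _ _ es) -(psumD _ ek en) -(psumZ _ _ e3).
congr psum; apply/funext => -[|k].
  by rewrite /pshift !hcoef0; ring.
rewrite /pshift (hcoefS _ (2 - s)).
have -> : hcoef (s * (n%:R - 1)) (- s) k.+1 =
    - (n%:R - 1) * (1 - s + k%:R) / ((1 - s) * k.+1%:R) * c2 k.
  rewrite /hcoef factS natrM !rising_shift.
  have -> : s * (n%:R - 1) + 1 = 1 + p - s by ring.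
  have -> : - s + 1 = 1 - s by ring.
  have s10 : 0 < 1 - s by rewrite subr_gt0.
  have s20 : 0 < 2 - s by move: s1; lra.
  have s1k' : 0 < 1 - s + k%:R by rewrite ltr_wpDr.
  have E : rising (1 - s) k * (1 - s + k%:R) = (1 - s) * rising (2 - s) k.
    by rewrite -risingS rising_shift; congr (_ * rising _ _); ring.
  have r1 := rising_gt0 k s10; have r2 := rising_gt0 k s20.
  have F0 : k`!%:R != 0 :> R by rewrite pnatr_eq0 -lt0n fact_gt0.
  have -> : rising (1 - s) k = (1 - s) * rising (2 - s) k / (1 - s + k%:R).
    by rewrite -E mulfK// gt_eqF.
  by field; rewrite nat1r k1 F0 !gt_eqF.
have s10 : 1 - s != 0 by rewrite gt_eqF// subr_gt0.
have s2k : 2 - s + k%:R != 0 by rewrite gt_eqF// ltr_wpDr//; move: s1; lra.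
have := k1 k; rewrite -(natr1 k) => h.
by field; rewrite s10 s2k h.
Qed.

End contiguous.

Section limit_tail.
Context {R : realType}.
Variables (n : nat) (beta : R).
Hypotheses (n0 : (0 < n)%N) (beta_gt0 : 0 < beta) (beta_lt2 : beta < 2).
Local Notation s := (beta / 2).
Local Notation p := (n%:R * s).
Local Notation H := (@laguerre_integral R n s).

Let s0 : 0 < s. Proof. by rewrite divr_gt0. Qed.
Let s1 : s < 1. Proof. by rewrite ltr_pdivrMr// mul1r. Qed.
Let p0 : 0 < p. Proof. by rewrite mulr_gt0// ltr0n. Qed.

Lemma GammaN : Gamma (- s) = Gamma (1 - s) / (- s).
Proof.
have s10 : 0 < 1 - s by rewrite subr_gt0.
rewrite (GammaE s10) {1}/Gamma ltNge oppr_le0 (ltW s0)/= opprK.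
have -> : Num.truncn s = 0%N by apply: truncn_def; rewrite (ltW s0) s1.
by rewrite big_ord1 addr0 addrC.
Qed.

Let Gamma_ratio (x : R) : 0 <= x -> Gamma (x + 1) / Gamma x = x.
Proof.
rewrite le_eqVlt => /predU1P[<-|x0].
  rewrite {2}/Gamma ltxx/= oppr0.
  by rewrite truncn0 big_ord1 addr0 invr0 mulr0 invr0 mulr0.
by rewrite GammaS// mulfK// gt_eqF// Gamma_gt0.
Qed.

(** The sine in the density cancels the one in [tricomiU].  The remaining quotient
    [Gamma (x + 1) / Gamma x] is [x] also for [x = 0], the case of a single point,
    as the reciprocal of [Gamma 0] is [0]. *)
Lemma smallest_limit_densityE (y : R) : 0 < y -> smallest_limit_density beta n y =
  expR (- (n%:R * y)) * (
   Gamma s * Gamma (1 + p - s) / (Gamma p * Gamma (1 - s)) *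
      (y `^ (- s) * psum (hcoef (s * (n%:R - 1)) (- s)) y)
   + n%:R * (n%:R - 1) / (1 + s) * (y * psum (hcoef (1 + p) (2 + s)) y)).
Proof.
move=> y0; rewrite /smallest_limit_density /tricomiU !hyp1F1E.
have n1 : 1 <= n%:R :> R by rewrite ler1n.
have x0 : 0 <= s * (n%:R - 1) by rewrite mulr_ge0 ?(ltW s0)// subr_ge0.
have := Gamma_ratio x0.
rewrite (_ : beta * (n%:R - 1) / 2 = s * (n%:R - 1)); last by ring.
set x := s * (n%:R - 1) => Gx.
rewrite (_ : 1 + x - - s = 1 + p); last by rewrite /x; ring.
rewrite (_ : 1 - - s = 1 + s); last by ring.
rewrite (_ : 2 - - s = 2 + s); last by ring.
rewrite (_ : 1 + p - s = x + 1); last by rewrite /x; ring.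
rewrite GammaN (_ : pi * - s = - (s * pi)); last by ring.
rewrite sinN.
have S0 : 0 < sin (s * pi).
  by apply: sin_gt0_pi; rewrite mulr_gt0 ?pi_gt0// gtr_pMl ?pi_gt0.
rewrite (addrC 1 p) (GammaS p0) (addrC 1 s) (GammaS s0).
rewrite (_ : 2 + s = s + 1 + 1); last by ring.
have s10 : 0 < s + 1 by exact: addr_gt0.
rewrite (GammaS s10) (GammaS s0).
rewrite (gt0_powRD s 1 y0) powRr1 ?(ltW y0)// powRN.
have Y0 := powR_gt0 s y0.
have G1 := Gamma_gt0 s0; have G2 := Gamma_gt0 p0.
have s11 : 0 < 1 - s by rewrite subr_gt0.
have G3 := Gamma_gt0 s11.
set M1 := psum _ y; set M2 := psum _ y.
set X := Gamma (x + 1) in Gx *; set G := (Gamma x)^-1 in Gx *.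
have pi0 := pi_gt0 R.
have nn0 : 0 < n%:R :> R by rewrite ltr0n.
set E := expR _.
transitivity (E * (Gamma s * X / (Gamma p * Gamma (1 - s)) * ((y `^ s)^-1 * M1) +
   n%:R / (s * (1 + s)) * (X * G) * (y * M2))).
  rewrite (invfM (Gamma x)) -/G.
  have b0 : beta != 0 by rewrite gt_eqF.
  have b2 : 1 + beta / 2 != 0 by rewrite gt_eqF// addr_gt0.
  move: (y `^ s) (Gamma s) (Gamma p) (Gamma (1 - s)) (sin (s * pi)) Y0 G1 G2 G3 S0.
  move=> Y g1 g2 g3 S Y0 G1 G2 G3 S0.
  move: (pi : R) pi0 => P P0.
  have b20 : 2 + beta != 0 by rewrite gt_eqF// addr_gt0.
  by field; rewrite b20 b0 !gt_eqF.
rewrite Gx /x; congr (_ * _); congr (_ + _).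
have b0 : beta != 0 by rewrite gt_eqF.
have b2 : beta + 2 != 0 by rewrite gt_eqF// addr_gt0.
by field; rewrite b2 b0.
Qed.

(** The coefficient of the second solution is the only one for which the growth
    of the two series at infinity cancels. *)
Lemma laguerre_integral_eq (y : R) : 0 < y ->
  H y = H 0 * (hyp1F1 p s y -
    Gamma s * Gamma (1 + p - s) / (Gamma (2 - s) * Gamma p) * kummer_second p s y).
Proof.
move=> y0.
have [B HB] := kummer_solution_basis s0 s1 (@kummer_laguerre_integral R n _ s0 s1)
  (@cvg_laguerre_integral0 R n _ s0 s1).
have bnd z : 0 < z -> `|H 0 * hyp1F1 p s z + B * kummer_second p s z| <= H 0.
  move=> z0; rewrite -HB//.
  have /andP[h1 h2] := laguerre_integral_le n s0 s1 (ltW z0).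
  by rewrite (ger0_norm h1).
have := bounded_connection p0 s0 s1 bnd.
have s20 : 0 < 2 - s by move: s1; lra.
have ps0 : 0 < 1 + p - s by move: s1 p0; lra.
have G1 := Gamma_gt0 s20; have G2 := Gamma_gt0 p0; have G3 := Gamma_gt0 ps0.
move=> /eqP; rewrite addrC addr_eq0 => /eqP BE.
have -> : H y = H 0 * hyp1F1 p s y + B * kummer_second p s y by exact: HB.
have -> : B = - (H 0 * Gamma s) * (Gamma (1 + p - s) / (Gamma (2 - s) * Gamma p)).
  rewrite -BE; move: (Gamma (2 - s)) (Gamma p) (Gamma (1 + p - s)) G1 G2 G3 => g1 g2 g3 *.
  by field; rewrite !gt_eqF.
by ring.
Qed.

(** Probability that the limiting rescaled smallest eigenvalue exceeds [y]. *)
Definition limit_tail y : R := expR (- (n%:R * y)) * H y / H 0.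

Hypothesis H0_gt0 : 0 < H 0.

Lemma is_derive_limit_tail (y : R) : 0 < y ->
  is_derive y 1 limit_tail (- smallest_limit_density beta n y).
Proof.
move=> y0.
pose K := Gamma s * Gamma (1 + p - s) / (Gamma (2 - s) * Gamma p).
have dM := (kummer_hyp1F1 p s0 y0).1.
have dN := (kummer_kummer_second p s1 y0).1.
have H00 : H 0 != 0 by rewrite gt_eqF.
pose g (z : R) : R := expR (- (n%:R * z)) * (hyp1F1 p s z - K * kummer_second p s z).
apply: (@near_eq_is_derive R R R g).
  near=> z; have z0 : 0 < z by near: z; exact: lt_nbhsr.
  rewrite /g /limit_tail laguerre_integral_eq// -/K.
  by move: (H 0) H00 => h h0; field.
apply: is_derive_eq; rewrite /GRing.scale/= smallest_limit_densityE//.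
have c1 := contiguous_first n s0 y.
have c2 := contiguous_second n s0 s1 y0.
rewrite -{}c1.
have s10 : 0 < 1 - s by rewrite subr_gt0.
have p'0 := p0.
have -> : Gamma s * Gamma (1 + p - s) / (Gamma p * Gamma (1 - s)) = K * (1 - s).
  rewrite /K (_ : 2 - s = 1 - s + 1); last by ring.
  rewrite (GammaS s10).
  have G1 := Gamma_gt0 s10; have G2 := Gamma_gt0 p0.
  move: (Gamma (1 - s)) (Gamma p) (Gamma (1 + p - s)) (Gamma s) G1 G2 => g1 g2 g3 g4 G1 G2.
  have b2 : 2 - beta != 0 by rewrite gt_eqF// subr_gt0.
  by field; rewrite b2 !gt_eqF.
rewrite -[X in _ = - (_ * (X + _))]mulrA -{}c2 hyp1F1E.
by ring.
Unshelve. all: by end_near. Qed.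

Lemma limit_tail0 : limit_tail 0 = 1.
Proof. by rewrite /limit_tail mulr0 oppr0 expR0 mul1r divff// gt_eqF. Qed.

Lemma limit_tail_bounds (y : R) : 0 <= y -> 0 <= limit_tail y <= expR (- (n%:R * y)).
Proof.
move=> y0; have /andP[h1 h2] := laguerre_integral_le n s0 s1 y0.
rewrite /limit_tail -mulrA; move: (H0_gt0) h1 h2 (expR_ge0 (- (n%:R * y))).
move: (H y) (H 0) (expR _) => a b e b0 a0 ab e0.
by rewrite mulr_ge0 ?divr_ge0 ?(ltW b0)//= ler_piMr// ler_pdivrMr// mul1r.
Qed.

Lemma cvg_limit_taily : limit_tail y @[y --> +oo] --> (0 : R).
Proof.
apply: (@squeeze_cvgr _ _ _ _ (fun=> 0) (fun y => expR (- (n%:R * y)))).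
- by near=> y; apply: limit_tail_bounds; near: y; exact: nbhs_pinfty_ge.
- exact: cvg_cst.
apply: (@cvg_comp _ _ _ (fun x : R => n%:R * x) (fun x => expR (- x))); last exact: cvgr_expR.
have nn0 : 0 < n%:R :> R by rewrite ltr0n.
by apply/cvgryPge => A; near=> x; rewrite -ler_pdivrMl//; near: x; exact: nbhs_pinfty_ge.
Unshelve. all: by end_near. Qed.

Lemma cvg_limit_tail0 : limit_tail y @[y --> 0^'+] --> (1 : R).
Proof.
rewrite -limit_tail0; apply: cvgM; last exact: cvg_cst.
apply: cvgM; last exact: cvg_laguerre_integral0.
have c : {for 0, continuous (fun y : R => expR (- (n%:R * y)))}.
  apply: continuous_comp; last exact: continuous_expR.
  by apply: continuousN; apply: continuousM; [exact: cst_continuous|exact: cvg_id].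
exact: cvg_at_right_filter c.
Qed.

End limit_tail.

(** * Convergence of the rescaled Jacobi weight to the Laguerre weight *)

Section decay.
Context {R : realType}.
Implicit Types (k r x : R).

(** The factor of the Jacobi weight with its singularity at [1], in the rescaled
    variable [x = k * t]; for [r < k] it is [0] to the right of [k]. *)
Definition jacobi_decay r k x : R := Num.max 0 (1 - x / k) `^ (k - r).

Lemma measurable_jacobi_decay r k : measurable_fun setT (jacobi_decay r k).
Proof.
apply: (measurableT_comp (measurable_powR (k - r))).
apply: measurable_maxr => //; apply: measurable_funB => //.
by apply: measurable_funM.
Qed.

Lemma jacobi_decay_le_expR r k x : 0 < k -> r <= k ->
  jacobi_decay r k x <= expR (- (x / k * (k - r))).
Proof.
move=> k0 rk.
rewrite -mulNr expRM; apply: ge0_ler_powR.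
- by rewrite subr_ge0.
- by rewrite nnegrE le_max lexx.
- by rewrite nnegrE expR_ge0.
by rewrite ge_max expR_ge0/=; exact: expR_ge1Dx.
Qed.

(** Used for dominated convergence, hence uniform in [k]. *)
Lemma jacobi_decay_le_half r k x : 0 < k -> 2 * r <= k -> 0 <= r -> 0 <= x ->
  jacobi_decay r k x <= expR (- (2^-1 * x)).
Proof.
move=> k0 rk r0 x0; have rk' : r <= k by move: rk r0; lra.
rewrite (le_trans (jacobi_decay_le_expR x k0 rk'))// ler_expR lerN2.
rewrite -mulrA (mulrC 2^-1) ler_wpM2l// mulrC ler_pdivlMr//.
by move: rk; lra.
Qed.

(** Compares the weights before and after the limit at a single stage [k]. *)
Lemma jacobi_decay_le r k x : 0 < k -> r < k -> 0 <= x ->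
  jacobi_decay r k x <= expR k * expR (- x).
Proof.
move=> k0 rk x0; rewrite /jacobi_decay -expRD.
have kr : k - r != 0 by rewrite gt_eqF// subr_gt0.
have [xk|kx] := ltP x k; last first.
  rewrite max_l ?powR0 ?expR_ge0// subr_le0 ler_pdivlMr// mul1r//.
apply: (@le_trans _ _ 1).
  have m0 : 0 <= Num.max 0 (1 - x / k) by rewrite le_max lexx.
  have m1 : Num.max 0 (1 - x / k) <= 1.
    by rewrite ge_max ler01/= lerBlDr lerDl divr_ge0// ltW.
  by have := @ge0_ler_powR _ (k - r) _ _ _ m0 ler01 m1; rewrite powR1; apply; rewrite subr_ge0 ltW.
by rewrite -expR0 ler_expR subr_ge0 ltW.
Qed.

Lemma jacobi_decay_ge r k x : r <= k -> 0 <= x < k ->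
  expR (- (x * ((k - r) / (k - x)))) <= jacobi_decay r k x.
Proof.
move=> rk /andP[x0 xk]; have k0 : 0 < k by exact: le_lt_trans xk.
have kx : 0 < k - x by rewrite subr_gt0.
have u0 : 0 < 1 - x / k by rewrite subr_gt0 ltr_pdivrMr// mul1r.
rewrite /jacobi_decay max_r ?(ltW u0)//.
have -> : - (x * ((k - r) / (k - x))) = - (x / (k - x)) * (k - r).
  by rewrite mulrCA mulNr mulrC.
rewrite expRM; apply: ge0_ler_powR.
- by rewrite subr_ge0.
- by rewrite nnegrE expR_ge0.
- by rewrite nnegrE ltW.
rewrite expRN -[leRHS]invrK lef_pV2 ?posrE ?expR_gt0 ?invr_gt0//.
apply: le_trans (expR_ge1Dx _).
rewrite le_eqVlt; apply/orP; left; apply/eqP.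
by field; rewrite !gt_eqF//.
Qed.

Lemma cvg_jacobi_decay r x : 0 <= x -> jacobi_decay r k x @[k --> +oo] --> expR (- x).
Proof.
move=> x0.
(* both bounds on the decay have an exponent of this form, with c = x or c = 0 *)
have ratio (c : R) : expR (- (x * ((k - r) / (k - c)))) @[k --> +oo] --> expR (- x).
  have h : (k - c)^-1 @[k --> +oo] --> (0 : R).
    apply/gtr0_cvgV0.
      by near=> k; rewrite subr_gt0; near: k; apply: nbhs_pinfty_gt; exact: num_real.
    by apply/cvgryPge => A; near=> k; rewrite lerBrDr; near: k; apply: nbhs_pinfty_ge; exact: num_real.
  have h2 : - (x * (1 + (c - r) * (k - c)^-1)) @[k --> +oo] --> - (x * (1 + (c - r) * 0)).
    apply: cvgN; apply: cvgM; first exact: cvg_cst.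
    by apply: cvgD; [exact: cvg_cst|apply: cvgM => //; exact: cvg_cst].
  rewrite mulr0 addr0 mulr1 in h2.
  have h3 := cvg_comp _ _ h2 (@continuous_expR R (- x)).
  apply: cvg_trans h3; apply: near_eq_cvg; near=> k.
  have kc : k - c != 0 by rewrite gt_eqF// subr_gt0; near: k; apply: nbhs_pinfty_gt; exact: num_real.
  by rewrite /=; congr (expR (- (x * _))); field.
apply: (squeeze_cvgr _ (ratio x) (ratio 0)).
near=> k; apply/andP; split.
  apply: jacobi_decay_ge; first by near: k; apply: nbhs_pinfty_ge; exact: num_real.
  by rewrite x0/=; near: k; apply: nbhs_pinfty_gt; exact: num_real.
rewrite subr0 mulrA mulrAC; apply: jacobi_decay_le_expR.
  by near: k; apply: nbhs_pinfty_gt; exact: num_real.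
by near: k; apply: nbhs_pinfty_ge; exact: num_real.
Unshelve. all: by end_near. Qed.

End decay.

Section hard_edge.
Context {R : realType}.
Local Notation mR := (measurableTypeR R).
Variables (n : nat) (s r : R).
Hypotheses (s0 : 0 < s) (s1 : s < 1) (r0 : 0 <= r).
Local Notation lebn := (@lebesgue_tuple R n).
Local Notation orth := (@orthant R n).
Local Notation dom := (@dominator R n s).
Local Notation H := (@laguerre_integral R n s).
Implicit Types (t : n.-tuple mR) (k x y : R).

Definition jacobi_scaled k t : R :=
  (\prod_(i < n) (tnth t i `^ (- s) * jacobi_decay r k (tnth t i)))
  * vandermonde_pow s 0 t.

Definition above x : set (n.-tuple mR) := [set t | forall i, x < tnth t i].

Definition jacobi_tail k x : R := \int[lebn]_(t in orth `&` above x) jacobi_scaled k t.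

Definition laguerre_tail x : R :=
  \int[lebn]_(t in orth `&` above x) laguerre_weight s 0 0 t.

Lemma measurable_above x : measurable (above x).
Proof.
rewrite (_ : above x = \bigcap_(i in [set: 'I_n]) ((fun t => tnth t i : R) @^-1` `]x, +oo[)).
  apply: fin_bigcap_measurable => // i _.
  by rewrite -[X in measurable X]setTI; exact: measurable_tnthR.
apply/seteqP; split => t /=; first by move=> h i _ /=; rewrite in_itv/= andbT.
by move=> h i; have := h i I; rewrite /= in_itv/= andbT.
Qed.

Let mD x : measurable (orth `&` above x).
Proof. by apply: measurableI; [exact: measurable_orthant|exact: measurable_above]. Qed.

Lemma jacobi_scaled_ge0 k t : 0 <= jacobi_scaled k t.
Proof.
rewrite mulr_ge0 ?vandermonde_pow_ge0//.
by apply: prodr_ge0 => i _; rewrite mulr_ge0 ?powR_ge0.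
Qed.

Lemma measurable_jacobi_scaled k : measurable_fun setT (jacobi_scaled k).
Proof.
apply: measurable_funM; last exact: measurable_vandermonde_pow.
apply: (@measurable_fun_prod_tnth R n (fun x => x `^ (- s) * jacobi_decay r k x)).
by apply: measurable_funM; [exact: measurable_powR|exact: measurable_jacobi_decay].
Qed.

Let jacobi_scaled_le_dominator : exists2 C : R, 0 < C & forall k t,
  0 < k -> 2 * r <= k -> orth t -> jacobi_scaled k t <= C * dom t.
Proof.
have [C C0 hC] := @vandermonde_pow_le R n s s0 s1.
exists C => // k t k0 rk tpos; have e01 : 0 <= (0 : R) <= 1 by rewrite lexx ler01.
rewrite (le_trans (ler_wpM2l _ (hC 0 t e01 tpos)))//.
  by apply: prodr_ge0 => i _; rewrite mulr_ge0 ?powR_ge0.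
rewrite mulrCA ler_wpM2l ?(ltW C0)// -big_split/=.
apply: ler_prod => i _; have ti := tpos i.
rewrite !mulr_ge0 ?powR_ge0 ?expR_ge0//= -mulrA ler_wpM2l ?powR_ge0//.
rewrite (le_trans (ler_wpM2r (expR_ge0 _) (jacobi_decay_le_half k0 rk r0 (ltW ti))))//.
by rewrite -expRD ler_expR; move: ti; set x := tnth t i; lra.
Qed.

Lemma jacobi_scaled_integrable_orthant k : 0 < k -> 2 * r <= k ->
  lebn.-integrable orth (EFin \o jacobi_scaled k).
Proof.
move=> k0 rk; have [C C0 hC] := jacobi_scaled_le_dominator.
apply: (le_dominator_integrable s1 (@measurable_jacobi_scaled k) (C := C)) => t tpos.
by rewrite ger0_norm ?jacobi_scaled_ge0// hC.
Qed.

Lemma jacobi_scaled_integrable k x : 0 < k -> 2 * r <= k ->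
  lebn.-integrable (orth `&` above x) (EFin \o jacobi_scaled k).
Proof.
move=> k0 rk; apply: integrableS (jacobi_scaled_integrable_orthant k0 rk) => //.
exact: measurable_orthant.
Qed.

Let laguerre_integrable x :
  lebn.-integrable (orth `&` above x) (EFin \o laguerre_weight s 0 0).
Proof.
apply: integrableS (laguerre_weight_integrable n s0 s1 (lexx 0)) => //.
exact: measurable_orthant.
Qed.

(** Dominated convergence: the interaction does not depend on [k], and the decay
    is bounded uniformly for [k >= 2 * r]. *)
Lemma cvg_jacobi_tail x : jacobi_tail k x @[k --> +oo] --> laguerre_tail x.
Proof.
apply/cvg_pinftyP => u uy.
have [C C0 hC] := jacobi_scaled_le_dominator.
have [N _ hN] : \forall m \near \oo, Num.max 1 (2 * r) <= u m.
  by move/cvgryPge : uy; apply.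
have mf k : measurable_fun (orth `&` above x) (EFin \o jacobi_scaled k).
  apply/measurable_EFinP; apply: (measurable_funS (E := setT)) => //.
  exact: measurable_jacobi_scaled.
have ml : measurable_fun (orth `&` above x) (EFin \o laguerre_weight s 0 0).
  apply/measurable_EFinP; apply: (measurable_funS (E := setT)) => //.
  exact: measurable_laguerre_weight.
have ig : lebn.-integrable (orth `&` above x) (fun t => C%:E * (EFin \o dom) t)%E.
  apply: integrableZl => //; apply: integrableS (@integrable_dominator R n s s1) => //.
  exact: measurable_orthant.
have uNy : u (m + N)%N @[m --> \oo] --> +oo by apply: cvg_comp uy; exact: cvg_addnr.
suff : jacobi_tail (u (m + N)%N) x @[m --> \oo] --> laguerre_tail x.
  by move=> h; rewrite -(@cvg_shiftn N).
have [||fi _ lim] := dominated_convergence (mD x) (fun m => mf (u (m + N)%N)) ml _ ig.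
- apply: aeW => t [tpos _]; apply: cvg_EFin; first exact: nearW.
  apply: cvgM; last exact: cvg_cst.
  apply: cvgr_prod => i _; rewrite add0r; apply: cvgM; first exact: cvg_cst.
  have := (cvg_pinftyP _ _).1 (cvg_jacobi_decay r (ltW (tpos i))); apply.
  exact: uNy.
- apply: aeW => t m [tpos _]; rewrite /= lee_fin ger0_norm ?jacobi_scaled_ge0//.
  have := hN (m + N)%N; rewrite /= leq_addl => /(_ isT).
  rewrite ge_max => /andP[u1 u2]; apply: hC => //.
  exact: lt_le_trans u1.
apply: fine_cvg; rewrite fineK//.
exact: integrable_fin_num.
Qed.

(** The translation [t -> t + x] carries the orthant onto the set where all
    points exceed [x] and leaves their mutual distances unchanged. *)
Lemma laguerre_tailE x : 0 <= x -> laguerre_tail x = expR (- (n%:R * x)) * H x.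
Proof.
move=> x0; rewrite -RintegralZl//; [|exact: measurable_orthant|exact: laguerre_weight_integrable].
rewrite /laguerre_tail /Rintegral; congr fine.
rewrite (integral_mkcond (orth `&` above x)) (integral_mkcond orth).
rewrite (@ge0_integral_affine_tuple R n 1 x) ?expr1n ?mul1e//; last first.
- by apply: erestrict_ge0 => t _; rewrite lee_fin laguerre_weight_ge0.
- apply: (measurable_restrictT _ (mD x)).1.
  apply/measurable_EFinP; apply: (measurable_funS (E := setT)) => //.
  exact: measurable_laguerre_weight.
apply: eq_integral => t _; rewrite !patchE.
have E : (affine_tuple 1 x t \in orth `&` above x) = (t \in orth).
  apply/idP/idP; rewrite !inE /orthant /above/=.
    by move=> [_ h] i; have := h i; rewrite tnth_mktuple mul1r ltrDr.
  move=> h; split => i; rewrite tnth_mktuple mul1r; first by rewrite ltr_wpDr.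
  by rewrite ltrDr.
rewrite E; case: ifP => //; rewrite inE => tpos; congr EFin.
rewrite /laguerre_weight mulrA; congr (_ * _); last first.
  apply: eq_bigr => i _; apply: eq_bigr => j _; rewrite !tnth_mktuple.
  by congr ((_ ^+ 2 + _) `^ _); ring.
have -> : expR (- (n%:R * x)) = \prod_(i < n) expR (- x).
  by rewrite prodr_const card_ord -expRM_natl; congr expR; ring.
rewrite -big_split/=; apply: eq_bigr => i _.
by rewrite tnth_mktuple mul1r add0r (addrC x) opprD expRD; ring.
Qed.

Lemma laguerre_tail_max x : laguerre_tail x = laguerre_tail (Num.max 0 x).
Proof.
rewrite /laguerre_tail; congr (Rintegral _ _ _).
apply/seteqP; split => t /= [tpos h]; split => // i.
  by rewrite gt_max; apply/andP; split; [exact: tpos|exact: h].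
by have := h i; rewrite gt_max => /andP[].
Qed.

Lemma le_laguerre_tail x y : x <= y -> laguerre_tail y <= laguerre_tail x.
Proof.
move=> xy; apply: fine_le; rewrite ?integrable_fin_num//.
apply: ge0_subset_integral => //.
- by apply/measurable_EFinP; apply: (measurable_funS (E := setT)) => //;
     exact: measurable_laguerre_weight.
- by move=> t _; rewrite lee_fin laguerre_weight_ge0.
by move=> t [tpos h]; split => // i; exact: le_lt_trans xy (h i).
Qed.

(** At a fixed scale the Jacobi weight is at most a multiple of the Laguerre
    weight, and its integral cannot be [0] if it normalizes to a probability. *)
Lemma laguerre_integral_gt0 k : 0 < k -> r < k -> 2 * r <= k -> jacobi_tail k 0 != 0 -> 0 < H 0.
Proof.
move=> k0 rk rk2 jn0.
have j0 : 0 < jacobi_tail k 0.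
  by rewrite lt_def jn0/=; apply: Rintegral_ge0 => t _; exact: jacobi_scaled_ge0.
have := laguerre_tailE (lexx 0); rewrite mulr0 oppr0 expR0 mul1r => <-.
have e0 : 0 < expR k ^+ n by rewrite exprn_gt0// expR_gt0.
rewrite -(pmulr_rgt0 _ e0); apply: lt_le_trans j0 _.
rewrite -RintegralZl//; apply: le_Rintegral => //.
- exact: jacobi_scaled_integrable.
- exact: (integrableZl (mD 0) (expR k ^+ n) (laguerre_integrable 0)).
move=> t [tpos _]; rewrite /jacobi_scaled /laguerre_weight mulrA.
rewrite ler_wpM2r ?vandermonde_pow_ge0//.
rewrite -[X in _ ^+ X]card_ord -prodr_const -big_split/=.
apply: ler_prod => i _; rewrite mulr_ge0 ?powR_ge0//= add0r mulrCA ler_wpM2l ?powR_ge0//.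
by apply: jacobi_decay_le => //; exact/ltW/tpos.
Qed.

End hard_edge.

(** * Probability laws with a given density *)

Section density_probability.
Context d (T : measurableType d) (R : realType) (mu : {measure set T -> \bar R}).
Variables (D : set T) (f : T -> R).
Hypotheses (mD : measurable D) (mf : measurable_fun D f).
Hypotheses (f0 : forall x, D x -> 0 <= f x).
Hypothesis f1 : (\int[mu]_(x in D) (f x)%:E = 1)%E.

Let g : T -> \bar R := (EFin \o f) \_ D.

Let g0 x : (0 <= g x)%E.
Proof. by apply: erestrict_ge0 => y Dy; rewrite lee_fin f0. Qed.

Let mg : measurable_fun setT g.
Proof. by apply: (measurable_restrictT _ mD).1; exact/measurable_EFinP. Qed.

Let nu A := (\int[mu]_(x in A) g x)%E.

Let nu0 : nu set0 = 0%E. Proof. exact: integral_set0. Qed.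

Let nu_ge0 A : (0 <= nu A)%E. Proof. exact: integral_ge0. Qed.

Let nu_sigma_additive : semi_sigma_additive nu.
Proof. exact: semi_sigma_additive_nng_induced. Qed.

HB.instance Definition _ := isMeasure.Build _ _ _ nu nu0 nu_ge0 nu_sigma_additive.

Let nuT : nu setT = 1%E.
Proof. by rewrite /nu /g -integral_mkcondr setTI. Qed.

HB.instance Definition _ := Measure_isProbability.Build _ _ _ nu nuT.

Lemma density_probability : exists P : probability T R, has_density mu P D f.
Proof.
exists nu; split=> // A mA.
by rewrite /= /nu /g -integral_mkcondr.
Qed.

End density_probability.

(** * The Jacobi ensemble at a finite size of its parameter *)

Section jacobi_scaling.
Context {R : realType}.
Local Notation mR := (measurableTypeR R).
Variables (n : nat) (beta b : R).
Local Notation s := (beta / 2).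
Local Notation a := (2 / beta - 2).
Local Notation k := (beta * (b + n%:R) / 2).
Local Notation r := (s * (n%:R - 1) + 1).
Hypotheses (n0 : (0 < n)%N) (beta_gt0 : 0 < beta) (beta_lt2 : beta < 2).
Hypothesis rk2 : 2 * r <= k.
Local Notation lebn := (@lebesgue_tuple R n).
Local Notation orth := (@orthant R n).
Local Notation js := (@jacobi_scaled R n s r k).
Local Notation jt := (@jacobi_tail R n s r k).
Local Notation cube := [set t : n.-tuple mR | forall i, 0 <= tnth t i <= 1].
Local Notation weight := (@jacobi_weight R beta a b n).
Implicit Types t : n.-tuple mR.

Let s0 : 0 < s. Proof. by rewrite divr_gt0. Qed.
Let s1 : s < 1. Proof. by rewrite ltr_pdivrMr// mul1r. Qed.

Let r0 : 0 < r.
Proof. by rewrite ltr_wpDl// mulr_ge0 ?(ltW s0)// subr_ge0 ler1n. Qed.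

Let rk : r < k.
Proof. by move: rk2 r0; lra. Qed.

Let k0 : 0 < k. Proof. exact: lt_trans rk. Qed.

Let kN0 : k != 0. Proof. by rewrite gt_eqF. Qed.

(** The choice of [a] gives the exponent [- s] at [0]; the one at [1] is [k - r] by
    the definitions of the scale [k] and of [r]. *)
Let weightE t : weight t =
  (\prod_(i < n) (tnth t i `^ (- s) * (1 - tnth t i) `^ (k - r))) * vandermonde_pow s 0 t.
Proof.
rewrite /jacobi_weight /vandermonde_pow; congr (_ * _); apply: eq_bigr => i _.
  have b0 : beta != 0 by rewrite gt_eqF.
  by congr (_ `^ _ * _ `^ _); [field|ring].
apply: eq_bigr => j _; rewrite addr0 -real_normK ?num_real//.
rewrite -powR_mulrn// -powRrM; congr (_ `^ _); by field.
Qed.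

Let jacobian : R :=
  (\prod_(i < n) k^-1 `^ (- s)) * \prod_(i < n) \prod_(j < n | (i < j)%N) (k ^- 2) `^ s.

Let weight_scaled t : orth t -> (forall i, tnth t i <= k) ->
  weight (affine_tuple k^-1 0 t) = jacobian * js t.
Proof.
move=> tpos tk; rewrite weightE /jacobian /jacobi_scaled /vandermonde_pow mulrACA.
congr (_ * _); rewrite -big_split/=; apply: eq_bigr => i _.
  rewrite tnth_mktuple addr0 powRM ?invr_ge0 ?(ltW k0) ?(ltW (tpos i))// -mulrA.
  rewrite /jacobi_decay max_r ?(mulrC k^-1)// subr_ge0 ler_pdivrMr// mul1r.
  exact: tk.
rewrite -big_split/=; apply: eq_bigr => j _; rewrite !tnth_mktuple !addr0.
rewrite -powRM ?sqr_ge0 ?invr_ge0 ?sqr_ge0//; congr (_ `^ _).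
by rewrite -mulrBr exprMn exprVn.
Qed.

Let mcube : measurable cube.
Proof.
rewrite (_ : mkset _ = \bigcap_(i in [set: 'I_n]) ((fun t => tnth t i : R) @^-1` `[0, 1])).
  apply: fin_bigcap_measurable => // i _.
  by rewrite -[X in measurable X]setTI; exact: measurable_tnthR.
apply/seteqP; split => t /=; first by move=> h i _ /=; rewrite in_itv/=.
by move=> h i; have := h i I; rewrite /= in_itv/=.
Qed.

Variables (c : R) (nu : set (n.-tuple mR) -> \bar R).
Hypothesis nu_density : has_density lebn nu cube (fun t => c * weight t).
Hypothesis nu1 : nu setT = 1%E.

(** On the rescaled orthant the density of the ensemble is a constant multiple
    of [jacobi_scaled].  Outside the orthant only the faces [t_i = 0] lie in the
    cube, and there the density vanishes, as [0 `^ (- s)] is [0]. *)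
Let restricted_scaled (A : set (n.-tuple mR)) t :
  ((fun t => c * weight t) \_ (A `&` cube)) (affine_tuple k^-1 0 t) =
  ((fun t => c * jacobian * js t) \_ (orth `&` affine_tuple k^-1 0 @^-1` A)) t.
Proof.
have e i : tnth (affine_tuple k^-1 0 t) i = tnth t i / k.
  by rewrite tnth_mktuple addr0 mulrC.
rewrite !patchE.
have [tA|tA] := asboolP (A (affine_tuple k^-1 0 t)); last first.
  by rewrite !ifF//; apply/negbTE/negP; rewrite inE/= => -[].
have [tpos|tpos] := asboolP (orth t); last first.
  rewrite [RHS]ifF; last by apply/negbTE/negP; rewrite inE/= => -[].
  case: ifPn => //; rewrite inE/= => -[_ tc].
  have [i ti] : exists i, tnth t i = 0.
    apply: contra_notP tpos => h i; rewrite lt_def.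
    have := tc i; rewrite e => /andP[+ _]; rewrite pmulr_lge0 ?invr_gt0// => ->.
    by rewrite andbT; apply/eqP => ti; apply: h; exists i.
  rewrite weightE (bigD1 i)//= e ti mul0r powR0 ?mul0r ?mulr0//.
  by rewrite oppr_eq0 gt_eqF.
rewrite [RHS]ifT; last by rewrite inE.
have [tk|] := asboolP (forall i, tnth t i <= k).
  rewrite ifT; last first.
    rewrite inE/=; split=> // i; rewrite e divr_ge0 ?(ltW (tpos i)) ?(ltW k0)//=.
    by rewrite ler_pdivrMr// mul1r.
  by rewrite weight_scaled// mulrA.
move=> /existsNP[i /negP]; rewrite -ltNge => ki.
rewrite ifF; last first.
  apply/negbTE/negP; rewrite inE/= => -[_ /(_ i)]; rewrite e => /andP[_].
  by rewrite ler_pdivrMr// mul1r leNgt ki.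
rewrite /jacobi_scaled (bigD1 i)//= /jacobi_decay max_l.
  by rewrite powR0 ?mulr0 ?mul0r ?mulr0// subr_eq0 gt_eqF.
by rewrite subr_le0 ler_pdivlMr// mul1r ltW.
Qed.

Let scaledE : exists C : R, forall A, measurable A ->
  nu A = (C * \int[lebn]_(t in orth `&` affine_tuple k^-1 0 @^-1` A) js t)%:E.
Proof.
have [_ mw w0 nuE] := nu_density.
exists (k^-1 ^+ n * (c * jacobian)) => A mA.
have mA' : measurable (affine_tuple k^-1 0 @^-1` A : set (n.-tuple mR)).
  by rewrite -[X in measurable X]setTI; exact: measurable_affine_tuple.
have mO : measurable (orth `&` affine_tuple k^-1 0 @^-1` A).
  by apply: measurableI => //; exact: measurable_orthant.
have ji : lebn.-integrable (orth `&` affine_tuple k^-1 0 @^-1` A) (EFin \o js).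
  apply: integrableS (@jacobi_scaled_integrable_orthant R n s r s0 s1 (ltW r0) k k0 rk2) => //.
  exact: measurable_orthant.
have rE (D : set (n.-tuple mR)) (f : n.-tuple mR -> R) :
    (\int[lebn]_(t in D) (f t)%:E = \int[lebn]_t ((f \_ D) t)%:E)%E.
  by rewrite integral_mkcond; apply: eq_integral => t _; rewrite !patchE; case: ifP.
have kV0 : 0 < k^-1 by rewrite invr_gt0.
have mf : measurable_fun setT (fun t => (((fun t => c * weight t) \_ (A `&` cube)) t)%:E).
  apply/measurable_EFinP; apply: (measurable_restrictT _ (measurableI _ _ mA mcube)).1.
  exact: measurable_funS mw.
have f0 t : (0 <= (((fun t => c * weight t) \_ (A `&` cube)) t)%:E)%E.
  by rewrite lee_fin patchE; case: ifP => //; rewrite inE => -[_ /w0].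
rewrite nuE// rE (ge0_integral_affine_tuple 0 kV0 mf f0).
rewrite -[X in _ = X%:E]mulrA [RHS]EFinM -RintegralZl// /Rintegral fineK; last first.
  by apply: integrable_fin_num => //; exact: (integrableZl mO (c * jacobian) ji).
rewrite [in RHS]rE.
by under eq_integral do rewrite restricted_scaled.
Qed.

Let aboveE : exists2 C : R, C * jt 0 = 1 & forall x, nu (above (x / k)) = (C * jt x)%:E.
Proof.
have [C CE] := scaledE; exists C.
  apply: EFin_inj; rewrite -nu1 CE// preimage_setT setIT /jacobi_tail.
  congr (_ * Rintegral _ _ _)%:E.
  by apply/seteqP; split => t //= [].
move=> x; rewrite CE; last exact: measurable_above.
rewrite /jacobi_tail; congr (_ * Rintegral _ (_ `&` _) _)%:E.
apply/seteqP; split => t h i; have := h i; rewrite tnth_mktuple addr0 (mulrC k^-1);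
    by rewrite ltr_pM2r ?invr_gt0.
Qed.

Lemma jacobi_tail_neq0 : jt 0 != 0.
Proof.
have [C C1 _] := aboveE; apply/eqP => j0.
by move: C1; rewrite j0 mulr0 => /eqP; rewrite eq_sym oner_eq0.
Qed.

Lemma jacobi_above x : nu (above (x / k)) = (jt x / jt 0)%:E.
Proof.
have [C C1 ->] := aboveE; have j0 := jacobi_tail_neq0.
by congr EFin; rewrite mulrC; congr (_ * _); rewrite -[LHS](mulfK j0) C1 mul1r.
Qed.

End jacobi_scaling.

(** * The limit law *)

Section limit_law.
Context {R : realType}.
Local Notation leb := (@lebesgue_measure R).
Variables (n : nat) (beta : R).
Hypotheses (n0 : (0 < n)%N) (beta_gt0 : 0 < beta) (beta_lt2 : beta < 2).
Local Notation s := (beta / 2).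
Local Notation H := (@laguerre_integral R n s).
Local Notation f := (smallest_limit_density beta n).
Local Notation tail := (limit_tail n beta).
Hypothesis H0_gt0 : 0 < H 0.

Let s0 : 0 < s. Proof. by rewrite divr_gt0. Qed.
Let s1 : s < 1. Proof. by rewrite ltr_pdivrMr// mul1r. Qed.

Let d_tail (y : R) : 0 < y -> is_derive y 1 tail (- f y).
Proof. exact: is_derive_limit_tail. Qed.

Let tailE (y : R) : 0 <= y -> tail y = laguerre_tail n s y / H 0.
Proof. by move=> y0; rewrite laguerre_tailE. Qed.

(** The tail is nonincreasing, as the integral of a fixed weight over a
    shrinking set. *)
Let density_ge0 (y : R) : 0 < y -> 0 <= f y.
Proof.
move=> y0; rewrite leNgt; apply/negP => fy.
(* the linear term makes the tail strictly decreasing without spoiling the sign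
   of its slope at y *)
pose g (z : R) := tail z + z * (f y / 2).
have dg (z : R) : 0 < z -> is_derive z 1 g (- f z + f y / 2).
  move=> z0; have dt := d_tail z0.
  by apply: is_derive_eq; rewrite /GRing.scale/= mulr0 add0r mulr1.
have : derive1 g y <= 0.
  apply: (@decr_derive1_le0_itvy R g false 0).
  - by move=> z; rewrite inE/= in_itv/= andbT => /dg [].
  - move=> z w; rewrite !in_itv/= !andbT => z0 w0 wz.
    rewrite /g !tailE ?ltW// ler_ltD//.
      by rewrite ler_pM2r ?invr_gt0// le_laguerre_tail// ltW.
    by rewrite ltr_nM2r// pmulr_llt0 ?invr_gt0.
  - by rewrite in_itv/= y0.
rewrite derive1E; have [_ ->] := dg _ y0.
by move: fy; lra.
Qed.

Let continuous_density (y : R) : 0 < y -> {for y, continuous f}.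
Proof.
move=> y0; rewrite /prop_for /continuous_at.
pose p := n%:R * s.
pose g (z : R) := expR (- (n%:R * z)) * (
   Gamma s * Gamma (1 + p - s) / (Gamma p * Gamma (1 - s)) *
      (z `^ (- s) * psum (hcoef (s * (n%:R - 1)) (- s)) z)
   + n%:R * (n%:R - 1) / (1 + s) * (z * psum (hcoef (1 + p) (2 + s)) z)).
have fg : \forall z \near y, g z = f z.
  near=> z; have z0 : 0 < z by near: z; exact: lt_nbhsr.
  by rewrite /g smallest_limit_densityE.
rewrite smallest_limit_densityE//.
apply: cvg_trans (near_eq_cvg fg) _.
have ci : {for y, continuous (fun z : R => z)} by exact: cvg_id.
have ck (x : R) : {for y, continuous (fun _ : R => x)} by exact: cvg_cst.
have ce : {for y, continuous (fun z : R => expR (- (n%:R * z)))}.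
  apply: continuous_comp; last exact: continuous_expR.
  by apply: continuousN; apply: continuousM.
have cp : {for y, continuous (@powR R ^~ (- s))}.
  exact/is_derive_continuous/is_derive1_powR.
have c1 := @continuous_psum R _ (@entire_hcoef R (s * (n%:R - 1)) (- s)) y.
have c2 := @continuous_psum R _ (@entire_hcoef R (1 + p) (2 + s)) y.
apply: cvgM; first exact: ce.
by apply: cvgD; apply: cvgM; first [exact: ck|apply: cvgM].
Unshelve. all: by end_near. Qed.

Let tail_right (y : R) : 0 <= y -> tail z @[z --> y^'+] --> tail y.
Proof.
rewrite le_eqVlt => /predU1P[<-|y0]; first by rewrite limit_tail0//; exact: cvg_limit_tail0.
exact/cvg_at_right_filter/is_derive_continuous/d_tail.
Qed.

Let f_ge0 (y z : R) : 0 <= y -> y < z -> 0 <= f z.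
Proof. by move=> y0 yz; apply: density_ge0; exact: le_lt_trans yz. Qed.

Let integral_density (y : R) : 0 <= y ->
  (\int[leb]_(z in `]y, +oo[) (f z)%:E = (tail y)%:E)%E.
Proof.
move=> y0.
rewrite (_ : tail y = - 0 - - tail y); last by rewrite oppr0 sub0r opprK.
apply: (@ge0_FTC_ray R f (fun z => - tail z) y (- tail y) (- 0)).
- move=> z yz; have z0 := le_lt_trans y0 yz.
  by have h := d_tail z0; apply: is_derive_eq; rewrite opprK.
- by move=> z yz; apply: continuous_density; exact: le_lt_trans yz.
- by apply: cvgN; exact: tail_right.
- by apply: cvgN; exact: cvg_limit_taily.
- by move=> z; exact: f_ge0.
Qed.

(** By the fundamental theorem of calculus, the density integrates over
    [`]y, +oo[] to the tail at [y]. *)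
Lemma limit_law : exists nu : probability (measurableTypeR R) R,
  has_density leb nu `]0, +oo[ f /\
  forall x : R, nu `]-oo, x]%classic = (1 - tail (Num.max 0 x))%:E.
Proof.
have mf : measurable_fun (`]0%R, +oo[%classic : set (measurableTypeR R)) f.
  have := @ge0_integrable_ray R f (fun z => - tail z) 0 (- tail 0) (- 0).
  move=> /(_ _ _ _ _ _)/measurable_int/measurable_EFinP; apply.
  - by move=> z z0; have h := d_tail z0; apply: is_derive_eq; rewrite opprK.
  - by move=> z z0; exact: continuous_density.
  - by apply: cvgN; exact: tail_right.
  - by apply: cvgN; exact: cvg_limit_taily.
  - by move=> z; exact: f_ge0.
have [||||nu nuf] := @density_probability _ (measurableTypeR R) R leb `]0%R, +oo[%classic f.
- by [].
- exact: mf.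
- by move=> z /=; rewrite in_itv/= andbT; exact: f_ge0.
- by rewrite integral_density// limit_tail0.
exists nu; split=> // x; have [_ _ _ nuE] := nuf.
have m0 : 0 <= Num.max 0 x by rewrite le_max lexx.
have -> : `]-oo, x]%classic = ~` (`]x, +oo[%classic : set (measurableTypeR R)).
  by rewrite setCitvr.
rewrite probability_setC// nuE//.
rewrite (_ : _ `&` _ = `]Num.max 0 x, +oo[%classic); last first.
  apply/seteqP; split => z /=; rewrite !in_itv/= !andbT gt_max.
    by move=> [-> ->].
  by move=> /andP[].
by rewrite integral_density// EFinB.
Qed.

End limit_law.


(** * Convergence in distribution *)

Section smallest_eigenvalue_cdf.
Context {R : realType} d (T : measurableType d) (P : probability T R).
Variables (m : nat) (m_gt0 : (0 < m)%N) (lam : 'I_m -> {RV P >-> R}).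

(** The distribution function of the smallest point is read off the joint law of
    all the points, through the complementary event that all of them are large. *)
Lemma cdf_scale_smallest (k x : R) : 0 < k ->
  cdf (P := P) (measurable_realfun.scale_mfun k (smallest_eigenvalue m_gt0 lam)) x =
  (1 - pushforward P (fun w => [tuple lam i w | i < m]) (above (x / k)))%E.
Proof.
move=> k0; rewrite /cdf/= /distribution /pushforward.
have mA : measurable ((fun w => [tuple lam i w | i < m]) @^-1` above (x / k)).
  rewrite -[X in measurable X]setTI; apply: measurable_fun_tuple => //; last exact: measurable_above.
  move=> i; rewrite (_ : (fun w => tnth _ i) = lam i); last first.
    by apply/funext => w; rewrite tnth_mktuple.
  exact: (@measurable_funPT _ _ _ _ (lam i)).
rewrite -probability_setC//; congr (P _).
apply/seteqP; split => w /=; rewrite in_itv/= smallest_eigenvalueE.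
  move=> minx /(_ _)/= large.
  suff : x / k < \big[Num.min/lam (Ordinal m_gt0) w]_(i < m) lam i w.
    by rewrite ltr_pdivrMr// ltNge minx.
  apply/bigmin_gtP; split=> [|i _].
    by have := large (Ordinal m_gt0); rewrite tnth_mktuple.
  by have := large i; rewrite tnth_mktuple.
move=> small; rewrite leNgt; apply/negP; rewrite -ltr_pdivrMr// => /bigmin_gtP[_ large].
by apply: small => i; rewrite tnth_mktuple; exact: large.
Qed.

End smallest_eigenvalue_cdf.

Theorem theorem3p7 (R : realType) (beta a : R) (m : nat) (m_gt0 : (0 < m)%N)
    (beta_gt0 : 0 < beta) (beta_lt2 : beta < 2) (aE : a = 2 / beta - 2)
    (d : R -> measure_display) (T : forall b : R, measurableType (d b))
    (P : forall b : R, probability (T b) R)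
    (lam : forall b : R, 'I_m -> {RV (P b) >-> R})
    (lam_jacobi : forall b : R, -1 < b ->
       is_jacobi_ensemble beta a b (P b) (lam b)) :
  exists nu : probability (measurableTypeR R) R,
    has_density lebesgue_measure nu `]0, +oo[
      (smallest_limit_density beta m) /\
    cvg_in_distribution +oo P
      (fun b : R => measurable_realfun.scale_mfun (beta * (b + m%:R) / 2)
                      (smallest_eigenvalue m_gt0 (lam b))) nu.
Proof.
pose s : R := beta / 2; pose r : R := s * (m%:R - 1) + 1.
pose k (b : R) : R := beta * (b + m%:R) / 2.
pose jt (b x : R) : R := @jacobi_tail R m s r (k b) x.
have s0 : 0 < s by rewrite divr_gt0.
have s1 : s < 1 by rewrite ltr_pdivrMr// mul1r.
have r0 : 0 < r.
  by rewrite ltr_wpDl// mulr_ge0 ?(ltW s0)// subr_ge0 ler1n.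
have ky : k b @[b --> +oo] --> +oo.
  apply/cvgryPge => A; near=> b.
  rewrite /k mulrAC -ler_pdivrMl// -lerBlDr.
  by near: b; apply: nbhs_pinfty_ge; exact: num_real.
have kr : \forall b \near +oo, 2 * r <= k b by move/cvgryPge : ky; apply.
have tail_cdf (b x : R) : -1 < b -> 2 * r <= k b ->
    jt b 0 != 0 /\ cdf (P := P b) (measurable_realfun.scale_mfun (k b)
      (smallest_eigenvalue m_gt0 (lam b))) x = (1 - jt b x / jt b 0)%:E.
  move=> b1 kb; have [c den] := lam_jacobi b b1.
  have kb0 : 0 < k b by move: kb r0; lra.
  have nu1 : pushforward (P b) (fun w => [tuple lam b i w | i < m]) setT = 1%E.
    by rewrite /pushforward preimage_setT probability_setT.
  rewrite aE in den; split.
    exact: (jacobi_tail_neq0 m_gt0 beta_gt0 beta_lt2 kb den nu1).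
  rewrite cdf_scale_smallest// EFinB.
  by rewrite (jacobi_above m_gt0 beta_gt0 beta_lt2 kb den nu1).
(* the ensemble exists for one large b, so its weight has a nonzero integral *)
have H0 : 0 < @laguerre_integral R m s 0.
  have [b [b1 kb]] : exists b : R, -1 < b /\ 2 * r <= k b.
    have [M [_ hM]] := kr; exists (Num.max 0 (M + 1)).
    by rewrite lt_max ltrN10; split => //; apply: hM; rewrite lt_max ltrDl ltr01 orbT.
  have [j0 _] := tail_cdf b 0 b1 kb.
  have kb0 : 0 < k b by move: kb r0; lra.
  have rk : r < k b by move: kb r0; lra.
  exact: (laguerre_integral_gt0 s0 s1 (ltW r0) kb0 rk kb j0).
have [nu [nuf nuE]] := limit_law m_gt0 beta_gt0 beta_lt2 H0.
exists nu; split=> // x _; rewrite nuE.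
have x0 : 0 <= Num.max 0 x by rewrite le_max lexx.
have -> : limit_tail m beta (Num.max 0 x) = laguerre_tail m s x / laguerre_tail m s 0.
  rewrite (@laguerre_tail_max R m s x) !laguerre_tailE//.
  by rewrite mulr0 oppr0 expR0 mul1r.
apply: (@cvg_trans _ ((1 - jt b x / jt b 0)%:E @[b --> +oo])).
  apply: near_eq_cvg; near=> b; apply/esym; apply: (tail_cdf b x _ _).2.
    by near: b; apply: nbhs_pinfty_gt; exact: num_real.
  by near: b; exact: kr.
apply: cvg_EFin; first exact: nearW.
apply: cvgB; first exact: cvg_cst.
apply: cvgM; first exact: (cvg_comp _ _ ky (@cvg_jacobi_tail R m s r s0 s1 (ltW r0) x)).
apply: cvgV.
  by rewrite laguerre_tailE// mulr0 oppr0 expR0 mul1r gt_eqF.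
exact: (cvg_comp _ _ ky (@cvg_jacobi_tail R m s r s0 s1 (ltW r0) 0)).
Unshelve. all: by end_near. Qed.
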